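(* Let $B$ be an $n$-dimensional compact and orientable Riemannian manifold, $M$ an $m$-dimensional semi-Riemannian manifold of index $r=m-n$, and $\pi:M\to B$ a semi-Riemannian submersion with totally umbilic fibres. Suppose that the mixed curvature is non-negative (i.e. $K(X,V)\ge0$ for all nonzero horizontal $X$ and nonzero vertical $V$), that $R(X,Y,X,Y)$ is constant along fibres for all basic vector fields $X,Y$, and that the mean curvature vector field $H$ is basic. Then: (i) $K(X,V)=0$ for every nonzero horizontal $X$ and every nonzero vertical $V$; (ii) the fibres are totally geodesic and the horizontal distribution is integrable, hence $M$ is a locally warped product.
   Context: All manifolds are smooth and connected. A semi-Riemannian submersion $\pi:(M,g)\to(B,g')$ between semi-Riemannian manifolds is a smooth surjective map such that $\pi_*$ is onto at every point, the fibres $\pi^{-1}(b)$ are semi-Riemannian (nondegenerate) submanifolds of $M$, and $\pi_*$ preserves scalar products of vectors normal to fibres. Throughout, fibres are connected and $r=\dim M-\dim B>0$. Vectors tangent to fibres are vertical, vectors normal to fibres are horizontal; $h$ is the orthogonal projection onto the horizontal part; $\nabla$ is the Levi-Civita connection of $g$. A vector field on $M$ is basic if it is horizontal and $\pi$-related to a vector field on $B$. For vertical $U,V$ put $T_UV=h\nabla_UV$ (second fundamental form of the fibres); with $e_1,\dots,e_r$ a local orthonormal vertical frame, $g(e_i,e_j)=\varepsilon_i\delta_{ij}$, $\varepsilon_i\in\{-1,1\}$, put $H=\sum_i\varepsilon_iT_{e_i}e_i$. The fibres are totally umbilic if $T_UV=\frac1r g(U,V)H$ for all vertical $U,V$. Curvature: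 $R(E,F)G=\nabla_E\nabla_FG-\nabla_F\nabla_EG-\nabla_{[E,F]}G$, $R(E,F,G,G')=-g(R(E,F)G,G')$, $K(X,V)=\dfrac{R(X,V,X,V)}{g(X,X)g(V,V)-g(X,V)^2}$. A semi-Riemannian manifold is a locally warped product if every point has an open neighbourhood isometric to a warped product $B_0\times_fF_0$, i.e. $B_0\times F_0$ with metric $g_{B_0}+f^2g_{F_0}$ for a positive smooth function $f$ on $B_0$. *)

(* Defs.v *)
From HB Require Import structures.
From mathcomp Require Import all_boot all_order all_algebra.
From mathcomp Require Import all_classical all_reals all_analysis.
From mathcomp Require Import ring lra.

Set Implicit Arguments.
Unset Strict Implicit.
Unset Printing Implicit Defensive.

Import Order.TTheory GRing.Theory Num.Theory.
Import numFieldNormedType.Exports.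

Local Open Scope classical_set_scope.
Local Open Scope ring_scope.

Section Smooth.
Context {R : realType}.

(* [C^k] on the open set [U]; ['D_v f] is only used where [f] is differentiable.
   All directions [v] are used instead of the coordinate ones. *)
Fixpoint Ck (V : normedModType R) (k : nat) (U : set V) (f : V -> R) : Prop :=
  if k is k'.+1 then
    (forall x, U x -> differentiable f x) /\
    (forall v : V, Ck k' U (fun x => 'D_v f x))
  else forall x, U x -> {for x, continuous f}.

Definition smooth_on (V : normedModType R) (U : set V) (f : V -> R) : Prop :=
  forall k, Ck k U f.

Definition smooth_onv (V : normedModType R) (k : nat) (U : set V)
    (t : V -> 'rV[R]_k) : Prop :=
  forall j, smooth_on U (fun x => t x 0 j).

Definition coordL n (j : 'I_n) : {linear 'rV[R]_n -> R}.
Proof.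
by exists (fun N : 'rV[R]_n => N 0 j); do 2![eexists]; do ?[constructor];
   rewrite ?mxE// => ? *; rewrite ?mxE//; move=> ?; rewrite !mxE.
Defined.

Section CkTheory.
Variable V : normedModType R.
Implicit Types (U : set V) (f g : V -> R).

Lemma near_differentiable f g (x : V) : (\near x, f x = g x) ->
  differentiable f x -> differentiable g x.
Proof.
move=> nfg df; have fgx : f x = g x by exact: nbhs_singleton nfg.
have dc : continuous ('d f x) by exact: diff_continuous.
have E : g \o shift x = cst (g x) + 'd f x +o_ 0 id.
  apply/eqaddoP => e e0.
  have /eqaddoP/(_ e e0) H := diff_locally df.
  have H2 : \forall y \near (0 : V), f (y + x) = g (y + x).
    by have := nfg; rewrite (near_shift 0) subr0.
  by apply: filterS2 H H2 => y; rewrite !fctE /= -fgx => + <-.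
by apply/diff_locallyP; rewrite (diff_unique dc E).
Qed.

Lemma open_near (T : topologicalType) (U : set T) x : open U -> U x -> \near x, U x.
Proof. by move=> oU Ux; apply: open_nbhs_nbhs; split. Qed.

Lemma Ck_sub k U U' f : U `<=` U' -> Ck k U' f -> Ck k U f.
Proof.
move=> sU; elim: k f => [|k IH] f /=; first by move=> cf x /sU; exact: cf.
by move=> [df Df]; split=> [x /sU|v]; [exact: df|exact: IH].
Qed.

Lemma Ck_ext k U f g : open U -> (forall x, U x -> f x = g x) ->
  Ck k U f -> Ck k U g.
Proof.
move=> oU; elim: k f g => [|k IH] f g fg /=.
  move=> cf x Ux; rewrite /prop_for /continuous_at -(fg x Ux).
  apply: cvg_trans (cf x Ux); apply: near_eq_cvg.
  by apply: filterS (open_near oU Ux) => y; exact: fg.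
move=> [df Df]; have nfg x : U x -> (\near x, f x = g x).
  by move=> Ux; apply: filterS (open_near oU Ux) => y; exact: fg.
split=> [x Ux|v]; first exact: near_differentiable (nfg x Ux) (df x Ux).
by apply: IH (Df v) => x Ux; apply: near_eq_derive; exact: nfg.
Qed.

Lemma Ck_local k U f :
  (forall x, U x -> exists2 W : set V, W x & Ck k W f) -> Ck k U f.
Proof.
elim: k f => [|k IH] f loc /=.
  by move=> x /loc[W Wx cW]; exact: cW.
split=> [x /loc[W Wx [dW _]]|v]; first exact: dW.
by apply: IH => x /loc[W Wx [_ DW]]; exists W => //; exact: DW.
Qed.

Lemma Ck_continuous k U f x : Ck k U f -> U x -> {for x, continuous f}.
Proof.
case: k => [|k] /=; first exact.
by move=> [df _] /df; exact: differentiable_continuous.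
Qed.

Lemma CkW k U f : Ck k.+1 U f -> Ck k U f.
Proof.
elim: k f => [|k IH] f; last by move=> [df Df]; split=> // v; exact/IH/Df.
by move=> cf x; exact: Ck_continuous cf.
Qed.

Lemma Ck_cst k U (a : R) : Ck k U (cst a).
Proof.
elim: k a => [|k IH] a /=; first by move=> x _; exact: cvg_cst.
split=> // v; rewrite (_ : (fun _ => _) = cst 0) //.
by apply/funext => x; exact: derive_cst.
Qed.

Lemma CkD k U f g : open U -> Ck k U f -> Ck k U g -> Ck k U (f + g).
Proof.
move=> oU; elim: k f g => [|k IH] f g /=.
  by move=> cf cg x Ux; apply: cvgD; [exact: cf|exact: cg].
move=> [df Df] [dg Dg]; split=> [x Ux|v].
  by apply: differentiableD; [exact: df|exact: dg].
apply: (Ck_ext oU _ (IH _ _ (Df v) (Dg v))) => x Ux /=.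
by rewrite deriveD //; apply: diff_derivable; [exact: df|exact: dg].
Qed.

Lemma CkM k U f g : open U -> Ck k U f -> Ck k U g -> Ck k U (f * g).
Proof.
move=> oU; elim: k f g => [|k IH] f g.
  by move=> cf cg x Ux; apply: cvgM; [exact: cf|exact: cg].
move=> Cf Cg; have [df Df] := Cf; have [dg Dg] := Cg; split=> [x Ux|v].
  by apply: differentiableM; [exact: df|exact: dg].
have := CkD oU (IH _ _ (CkW Cf) (Dg v)) (IH _ _ (CkW Cg) (Df v)).
apply: Ck_ext => // x Ux.
by rewrite deriveM //; apply: diff_derivable; [exact: df|exact: dg].
Qed.

Lemma Ck_sum k U n (h : 'I_n -> V -> R) : open U ->
  (forall j, Ck k U (h j)) -> Ck k U (\sum_j h j).
Proof.
move=> oU Ch; elim/big_ind: _ => [|f g Cf Cg|j _]; [exact: Ck_cst|exact: CkD|].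
exact: Ch.
Qed.

Lemma rV_sum_delta n (t : V -> 'rV[R]_n) :
  t = \sum_j (fun x => t x 0 j *: (delta_mx 0 j : 'rV[R]_n)).
Proof. by apply/funext => x; rewrite fct_sumE; exact: row_sum_delta. Qed.

Lemma differentiable_rV n (t : V -> 'rV[R]_n) x :
  (forall j, differentiable (fun y => t y 0 j) x) -> differentiable t x.
Proof.
move=> dt; rewrite (rV_sum_delta t); apply: differentiable_sum => j.
exact: differentiableZl.
Qed.

Lemma continuous_rV (T : topologicalType) n (t : T -> 'rV[R]_n) x :
  (forall j, {for x, continuous (fun y => t y 0 j)}) -> {for x, continuous t}.
Proof.
move=> ct A [P nP sPA]; rewrite nbhs_filterE /=.
have : \near x, forall j, P 0 j (t x 0 j).
  by apply: filter_forall => j; exact: (ct j _ (nP 0 j)).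
by apply: filterS => y Py; apply: sPA => i j; rewrite (ord1 i).
Qed.

Lemma derive_lin_comp (V1 V2 : normedModType R) (l : {linear V1 -> V2})
    (t : V -> V1) x v : continuous l -> differentiable t x ->
  'D_v (l \o t) x = l ('D_v t x).
Proof.
move=> cl dt; have dl : differentiable l (t x) by exact: linear_differentiable.
rewrite deriveE; last exact: differentiable_comp.
by rewrite diff_comp // diff_lin // deriveE.
Qed.

Lemma derive_rV n (t : V -> 'rV[R]_n) x v j :
  differentiable t x -> ('D_v t x) 0 j = 'D_v (fun y => t y 0 j) x.
Proof.
move=> dt; have cL : continuous (coordL j) by exact: coord_continuous.
exact: esym (derive_lin_comp v cL dt).
Qed.

Lemma Ck_comp k n U (W : set 'rV[R]_n) (t : V -> 'rV[R]_n) (f : 'rV[R]_n -> R) :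
  open U -> (forall x, U x -> W (t x)) ->
  (forall j, Ck k U (fun x => t x 0 j)) -> Ck k W f -> Ck k U (f \o t).
Proof.
move=> oU tO; elim: k f => [|k IH] f Ct Cf.
  move=> x Ux; apply: continuous_comp; last exact/Cf/tO.
  by apply: continuous_rV => j; exact: Ct.
have [df Df] := Cf; have dt x : U x -> differentiable t x.
  by move=> Ux; apply: differentiable_rV => j; have [dj _] := Ct j; exact: dj.
split=> [x Ux|v]; first by apply: differentiable_comp; [exact: dt|exact/df/tO].
have Cj j : Ck k U (('D_(delta_mx 0 j) f \o t) * 'D_v (fun x => t x 0 j)).
  apply: CkM => //; last by have [_ Dj] := Ct j; exact: Dj.
  by apply: IH; [move=> i; exact: CkW (Ct i)|exact: Df].
apply: (Ck_ext oU _ (Ck_sum oU Cj)) => x Ux.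
have dtx := dt x Ux; have dfx := df _ (tO x Ux).
have dc : differentiable (f \o t) x by exact: differentiable_comp.
have -> : 'D_v (f \o t) x = 'd f (t x) ('D_v t x).
  by rewrite !deriveE // diff_comp.
rewrite fct_sumE [in RHS](row_sum_delta ('D_v t x)) linear_sum.
apply: eq_bigr => j _; rewrite linearZ /= -(deriveE _ dfx) derive_rV //.
exact: mulrC.
Qed.

End CkTheory.

Lemma Ck_linear (V : normedModType R) k U (l : {linear V -> R}) :
  continuous l -> Ck k U l.
Proof.
move=> cl; case: k => [|k] /=; first by move=> x _; exact: cl.
split=> [x _|v]; first exact: linear_differentiable.
rewrite (_ : (fun _ => _) = cst (l v)); first exact: Ck_cst.
apply/funext => x; rewrite deriveE; last exact: linear_differentiable.
by rewrite diff_lin.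
Qed.

Lemma Ck_coord n k U (j : 'I_n) : Ck k U (fun x : 'rV[R]_n => x 0 j).
Proof.
rewrite (_ : (fun x => _) = coordL j) //; apply: Ck_linear.
exact: coord_continuous.
Qed.

(* [cmap] and [cinv] are total functions; they are meaningful only on [dom] and
   on the open set [cmap @` dom], where they are mutually inverse. *)
Record chart (T : topologicalType) (n : nat) := Chart {
  dom : set T;
  cmap :> T -> 'rV[R]_n;
  cinv : 'rV[R]_n -> T;
  dom_open : open dom;
  cod_open : open (cmap @` dom);
  cmapK : forall x, dom x -> cinv (cmap x) = x;
  cmap_cont : forall x, dom x -> {for x, continuous cmap};
  cinv_cont : forall y, (cmap @` dom) y -> {for y, continuous cinv}
}.

Definition chart_compat (T : topologicalType) n (c c' : chart T n) : Prop :=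
  smooth_onv (c @` (dom c `&` dom c')) (c' \o cinv c).

Record manifold (n : nat) := Manifold {
  msort :> topologicalType;
  atlas : set (chart msort n);
  atlas_cover : forall p, exists2 c, atlas c & dom c p;
  atlas_compat : forall c c', atlas c -> atlas c' -> chart_compat c c';
  mfd_hausdorff : hausdorff_space msort;
  mfd_second_countable : @second_countable msort;
  mfd_connected : connected [set: msort]
}.

(* The oriented atlas may use charts that are smoothly compatible with [atlas]
   without belonging to it, since [atlas] is not assumed maximal. *)
Definition orientable n (M : manifold n) : Prop :=
  exists A : set (chart M n),
  [/\ forall p, exists2 c, A c & dom c p,
      forall c c', A c -> atlas c' -> chart_compat c c' /\ chart_compat c' c,
      forall c c', A c -> A c' -> chart_compat c c' &
      forall c c' x, A c -> A c' -> (c @` (dom c `&` dom c')) x ->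
        0 < \det ('J (c' \o cinv c) x)].

Lemma chart_open (T : topologicalType) n (c : chart T n) (W : set T) :
  open W -> W `<=` dom c -> open (c @` W).
Proof.
move=> oW sW; rewrite openE => _ [p Wp <-].
have dp := sW _ Wp; have yp : (c @` dom c) (c p) by exists p.
have n1 : \forall y \near c p, (c @` dom c) y by apply: open_near yp; exact: cod_open.
have n2 : \forall y \near c p, W (cinv c y).
  have := cinv_cont yp; rewrite /prop_for /continuous_at cmapK //; apply; exact: open_near.
rewrite /interior; apply: filterS2 n1 n2 => y [q dq <-].
by rewrite (cmapK dq); exact: imageP.
Qed.

Lemma chart_cinvK (T : topologicalType) n (c : chart T n) (W : set T) y :
  W `<=` dom c -> (c @` W) y -> [/\ W (cinv c y) & c (cinv c y) = y].
Proof. by move=> sW [q Wq <-]; rewrite cmapK //; exact: sW. Qed.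

(* [W] is meant to be open. *)
Definition smooth_map_on m n (M : manifold m) (N : manifold n) (W : set M)
    (phi : M -> N) : Prop :=
  (forall p, W p -> {for p, continuous phi}) /\
  (forall c c', atlas c -> atlas c' ->
    smooth_onv (c @` (dom c `&` W `&` phi @^-1` dom c'))
               (c' \o phi \o cinv c)).

Record smooth_map m n (M : manifold m) (N : manifold n) := SmoothMap {
  smap :> M -> N;
  smapP : smooth_map_on [set: M] smap
}.

Definition smooth_fun n (M : manifold n) (f : M -> R) : Prop :=
  forall c, atlas c -> smooth_on (c @` dom c) (f \o cinv c).

Lemma smooth_fun_comp m n (M : manifold m) (N : manifold n)
    (phi : smooth_map M N) (f : N -> R) :
  smooth_fun f -> smooth_fun (f \o phi).
Proof.
move=> sf c Ac k; apply: Ck_local => x [p dp <-].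
have [c' Ac' dp'] := atlas_cover (phi p).
have [cphi sphi] := smapP phi.
pose W := dom c `&` setT `&` phi @^-1` dom c'.
have sW : W `<=` dom c by move=> q [[]].
have oW : open W.
  rewrite openE => q [[dq _] dq']; apply: filterS2 (open_near (dom_open c) dq)
    (cphi q I _ (open_near (dom_open c') dq')) => r ? ?; by [].
have oc : open (c @` W) by exact: chart_open.
exists (c @` W); first by exists p.
have H := @Ck_comp _ k n (c @` W) (c' @` dom c') (c' \o phi \o cinv c)
  (f \o cinv c') oc _ _ (sf c' Ac' k).
apply: (Ck_ext oc _ (H _ _)).
- by move=> y /(chart_cinvK sW)[[_ d'] _]; rewrite /= cmapK.
- by move=> y /(chart_cinvK sW)[[_ d'] _]; exists (phi (cinv c y)).
- by move=> j; exact: sphi.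
Qed.

Section Product.
Variables (k l : nat).

Lemma nbhs_setX (T U : topologicalType) (x : T) (y : U) (A : set T) (B : set U) :
  nbhs x A -> nbhs y B -> nbhs (x, y) (A `*` B).
Proof. by move=> nA nB; exists (A, B). Qed.

Lemma hausdorff_setX (T U : topologicalType) :
  hausdorff_space T -> hausdorff_space U -> hausdorff_space (T * U)%type.
Proof.
move=> hT hU [x1 x2] [y1 y2] clxy; congr pair.
  apply: hT => A B nA nB.
  have := clxy (A `*` setT) (B `*` setT) (nbhs_setX nA filterT)
    (nbhs_setX nB filterT).
  by move=> [[z1 z2] [[/= Az _] [/= Bz _]]]; exists z1.
apply: hU => A B nA nB.
have := clxy (setT `*` A) (setT `*` B) (nbhs_setX filterT nA)
  (nbhs_setX filterT nB).
by move=> [[z1 z2] [[/= _ Az] [/= _ Bz]]]; exists z2.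
Qed.

Lemma open_setX (T U : topologicalType) (A : set T) (B : set U) :
  open A -> open B -> open (A `*` B).
Proof.
move=> oA oB; rewrite openE => -[x y] [/= Ax By].
by exists (A, B) => //=; split; apply: open_nbhs_nbhs.
Qed.

Lemma second_countable_setX (T U : topologicalType) :
  @second_countable T -> @second_countable U ->
  @second_countable (T * U)%type.
Proof.
move=> [B cB [oB bB]] [C cC [oC bC]].
exists ((fun P : set T * set U => P.1 `*` P.2) @` (B `*` C)).
  exact: card_le_trans (card_image_le _ _) (countableX cB cC).
split=> [_ [[P Q] [/= BP CQ] <-]|[x y] A [[P Q] [/= nP nQ] sA]].
  by apply: open_setX; [exact: oB|exact: oC].
have [P' [BP' P'x] sP] := bB x P nP; have [Q' [CQ' Q'y] sQ] := bC y Q nQ.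
exists (P' `*` Q') => /=; first by split; [exists (P', Q')|].
by move=> z [/sP Pz /sQ Qz]; apply: sA.
Qed.

Lemma connected_setX (T U : topologicalType) :
  connected [set: T] -> connected [set: U] -> connected [set: T * U].
Proof.
move=> cT cU.
have [->|/set0P[[t0 u0] _]] := eqVneq [set: T * U] set0; first exact: connected0.
have cV t : connected ([set t] `*` [set: U]).
  rewrite (_ : _ `*` _ = (fun u => (t, u)) @` setT).
    apply: connected_continuous_connected cU _; apply: continuous_subspaceT.
    by move=> u; apply: cvg_pair => //=; exact: cvg_cst.
  by apply/seteqP; split=> [[a b] [/= -> _]|_ [b _ <-]] //; exists b.
have cH : connected ([set: T] `*` [set u0]).
  rewrite (_ : _ `*` _ = (fun t => (t, u0)) @` setT).
    apply: connected_continuous_connected cT _; apply: continuous_subspaceT.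
    by move=> u; apply: cvg_pair => //=; exact: cvg_cst.
  by apply/seteqP; split=> [[a b] [/= _ ->]|_ [b _ <-]] //; exists a.
rewrite (_ : [set: _] =
  \bigcup_(t in [set: T]) ([set: T] `*` [set u0] `|` [set t] `*` [set: U])).
  apply: bigcup_connected; first by exists (t0, u0) => t _; left.
  by move=> t _; apply: connectedU => //; exists (t, u0).
by apply/seteqP; split=> // -[t u] _; exists t => //; right.
Qed.

Section ProdChart.
Variables (T U : topologicalType) (c : chart T k) (d : chart U l).

Let pmap (p : T * U) : 'rV[R]_(k + l) := row_mx (c p.1) (d p.2).
Let pinv (v : 'rV[R]_(k + l)) : T * U := (cinv c (lsubmx v), cinv d (rsubmx v)).
Let pdom : set (T * U) := dom c `*` dom d.

Lemma continuous_lsubmx : continuous (lsubmx : 'rV[R]_(k + l) -> 'rV[R]_k).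
Proof.
move=> v; apply: continuous_rV => j.
rewrite (_ : (fun _ => _) = (fun w : 'rV[R]_(k + l) => w 0 (lshift l j))).
  exact: coord_continuous.
by apply/funext => w; rewrite mxE.
Qed.

Lemma continuous_rsubmx : continuous (rsubmx : 'rV[R]_(k + l) -> 'rV[R]_l).
Proof.
move=> v; apply: continuous_rV => j.
rewrite (_ : (fun _ => _) = (fun w : 'rV[R]_(k + l) => w 0 (rshift k j))).
  exact: coord_continuous.
by apply/funext => w; rewrite mxE.
Qed.

Lemma pcodE : pmap @` pdom =
  lsubmx @^-1` (c @` dom c) `&` rsubmx @^-1` (d @` dom d).
Proof.
apply/seteqP; split=> [_ [[x y] [/= dx dy] <-]|v [/= [x dx ex] [y dy ey]]].
  by split; rewrite /= /pmap ?row_mxKl ?row_mxKr; [exists x|exists y].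
by exists (x, y) => //; rewrite /pmap /= ex ey hsubmxK.
Qed.

Lemma pcod_open : open (pmap @` pdom).
Proof.
rewrite pcodE; apply: openI; apply: open_comp; try exact: cod_open.
  by move=> v _; exact: continuous_lsubmx.
by move=> v _; exact: continuous_rsubmx.
Qed.

Lemma pmapK p : pdom p -> pinv (pmap p) = p.
Proof.
by case: p => x y [/= dx dy]; rewrite /pinv /pmap row_mxKl row_mxKr !cmapK.
Qed.

Lemma pmap_cont p : pdom p -> {for p, continuous pmap}.
Proof.
move=> [dx dy]; apply: continuous_rV => j; rewrite -(splitK j).
case: (fintype.split j) => i /=.
  rewrite (_ : (fun _ => _) = (fun x : 'rV[R]_k => x 0 i) \o (c \o fst)).
    apply: continuous_comp; last exact: coord_continuous.
    by apply: continuous_comp; [exact: cvg_fst|exact: cmap_cont].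
  by apply/funext => q; rewrite /pmap row_mxEl.
rewrite (_ : (fun _ => _) = (fun x : 'rV[R]_l => x 0 i) \o (d \o snd)).
  apply: continuous_comp; last exact: coord_continuous.
  by apply: continuous_comp; [exact: cvg_snd|exact: cmap_cont].
by apply/funext => q; rewrite /pmap row_mxEr.
Qed.

Lemma pinv_cont v : (pmap @` pdom) v -> {for v, continuous pinv}.
Proof.
rewrite pcodE => -[/= cl cr].
have h1 : {for v, continuous (cinv c \o lsubmx)}.
  by apply: continuous_comp; [exact: continuous_lsubmx|exact: cinv_cont].
have h2 : {for v, continuous (cinv d \o rsubmx)}.
  by apply: continuous_comp; [exact: continuous_rsubmx|exact: cinv_cont].
exact: (cvg_pair h1 h2).
Qed.

Definition prod_chart : chart (T * U)%type (k + l) :=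
  Chart (open_setX (dom_open c) (dom_open d)) pcod_open pmapK pmap_cont pinv_cont.

End ProdChart.

Lemma prod_chart_compat (T U : topologicalType) (c c' : chart T k)
  (d d' : chart U l) : chart_compat c c' -> chart_compat d d' ->
  chart_compat (prod_chart c d) (prod_chart c' d').
Proof.
move=> Hc Hd j r.
set W := dom (prod_chart c d) `&` dom (prod_chart c' d').
have oW : open W by apply: openI; exact: dom_open.
have sW : W `<=` dom (prod_chart c d) by move=> x [].
have oD : open (prod_chart c d @` W) by exact: chart_open.
rewrite -(splitK j); case: (fintype.split j) => i /=.
  rewrite (_ : (fun _ => _) =
    (fun x => (c' \o cinv c) x 0 i) \o (lsubmx : 'rV[R]_(k + l) -> 'rV[R]_k));
    last by apply/funext => v; rewrite /= row_mxEl.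
  apply: (Ck_comp oD _ _ (Hc i r)).
    move=> _ [[x y] [[/= dx dy] [/= dx' dy']] <-].
    by rewrite row_mxKl; exists x.
  move=> s; rewrite (_ : (fun _ => _) = (fun w : 'rV[R]_(k + l) => w 0 (lshift l s))).
    exact: Ck_coord.
  by apply/funext => w; rewrite mxE.
rewrite (_ : (fun _ => _) =
  (fun x => (d' \o cinv d) x 0 i) \o (rsubmx : 'rV[R]_(k + l) -> 'rV[R]_l));
  last by apply/funext => v; rewrite /= row_mxEr.
apply: (Ck_comp oD _ _ (Hd i r)).
  move=> _ [[x y] [[/= dx dy] [/= dx' dy']] <-].
  by rewrite row_mxKr; exists y.
move=> s; rewrite (_ : (fun _ => _) = (fun w : 'rV[R]_(k + l) => w 0 (rshift k s))).
  exact: Ck_coord.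
by apply/funext => w; rewrite mxE.
Qed.

Variables (M : manifold k) (N : manifold l).

Definition prod_atlas : set (chart (M * N)%type (k + l)) :=
  [set e | exists c d, [/\ atlas c, atlas d & e = prod_chart c d]].

Lemma prod_atlas_cover p : exists2 e, prod_atlas e & dom e p.
Proof.
have [c Ac dc] := atlas_cover p.1; have [d Ad dd] := atlas_cover p.2.
by exists (prod_chart c d) => //; exists c, d.
Qed.

Lemma prod_atlas_compat e e' :
  prod_atlas e -> prod_atlas e' -> chart_compat e e'.
Proof.
move=> [c [d [Ac Ad ->]]] [c' [d' [Ac' Ad' ->]]].
by apply: prod_chart_compat; exact: atlas_compat.
Qed.

Definition prod_manifold : manifold (k + l) :=
  Manifold prod_atlas_cover prod_atlas_compat
    (hausdorff_setX (@mfd_hausdorff _ M) (@mfd_hausdorff _ N))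
    (second_countable_setX (@mfd_second_countable _ M) (@mfd_second_countable _ N))
    (connected_setX (@mfd_connected _ M) (@mfd_connected _ N)).

Lemma prod_fst_smooth :
  @smooth_map_on _ _ prod_manifold M [set: prod_manifold] fst.
Proof.
split=> [p _|e c' [c [d [Ac Ad ->]]] Ac' j r]; first exact: cvg_fst.
set W := _ `&` _ `&` _.
have sW : W `<=` dom (prod_chart c d) by move=> x [[]].
have oW : open W.
  apply: openI; first by rewrite setIT; exact: dom_open.
  by apply: open_comp (dom_open c') => p _; exact: cvg_fst.
have oD : open (prod_chart c d @` W) by exact: chart_open.
rewrite (_ : (fun _ => _) =
  (fun x => (c' \o cinv c) x 0 j) \o (lsubmx : 'rV[R]_(k + l) -> 'rV[R]_k)) //.
apply: (Ck_comp oD _ _ (atlas_compat Ac Ac' j r)).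
  by move=> _ [[x y] [[[/= dx dy] _] /= dx'] <-]; rewrite row_mxKl; exists x.
move=> s; rewrite (_ : (fun _ => _) = (fun w : 'rV[R]_(k + l) => w 0 (lshift l s))).
  exact: Ck_coord.
by apply/funext => w; rewrite mxE.
Qed.

Lemma prod_snd_smooth :
  @smooth_map_on _ _ prod_manifold N [set: prod_manifold] snd.
Proof.
split=> [p _|e d' [c [d [Ac Ad ->]]] Ad' j r]; first exact: cvg_snd.
set W := _ `&` _ `&` _.
have sW : W `<=` dom (prod_chart c d) by move=> x [[]].
have oW : open W.
  apply: openI; first by rewrite setIT; exact: dom_open.
  by apply: open_comp (dom_open d') => p _; exact: cvg_snd.
have oD : open (prod_chart c d @` W) by exact: chart_open.
rewrite (_ : (fun _ => _) =
  (fun x => (d' \o cinv d) x 0 j) \o (rsubmx : 'rV[R]_(k + l) -> 'rV[R]_l)) //.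
apply: (Ck_comp oD _ _ (atlas_compat Ad Ad' j r)).
  by move=> _ [[x y] [[[/= dx dy] _] /= dy'] <-]; rewrite row_mxKr; exists y.
move=> s; rewrite (_ : (fun _ => _) = (fun w : 'rV[R]_(k + l) => w 0 (rshift k s))).
  exact: Ck_coord.
by apply/funext => w; rewrite mxE.
Qed.

Definition prod_fst : smooth_map prod_manifold M := SmoothMap prod_fst_smooth.
Definition prod_snd : smooth_map prod_manifold N := SmoothMap prod_snd_smooth.

End Product.

Section SmoothFunctions.
Variables (n : nat) (M : manifold n).

Definition smooth_pred : {pred M -> R} := fun f => `[< smooth_fun f >].

Lemma smooth_pred_subring : subring_closed smooth_pred.
Proof.
have S1 : (1 : M -> R) \in smooth_pred by apply/asboolP => c _ r; exact: Ck_cst.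
have SM : {in smooth_pred &, forall f g, f * g \in smooth_pred}.
  move=> f g /asboolP sf /asboolP sg; apply/asboolP => c Ac r.
  exact: (CkM (@cod_open _ _ c) (sf c Ac r) (sg c Ac r)).
have SD : {in smooth_pred &, forall f g, f + g \in smooth_pred}.
  move=> f g /asboolP sf /asboolP sg; apply/asboolP => c Ac r.
  exact: (CkD (@cod_open _ _ c) (sf c Ac r) (sg c Ac r)).
have SN1 : (-1 : M -> R) \in smooth_pred.
  by apply/asboolP => c _ r; exact: (Ck_cst _ _ (-1)).
by split=> // f g Sf Sg; rewrite -mulN1r SD // SM.
Qed.

Lemma smooth_pred_submod : scaler_closed smooth_pred.
Proof.
move=> a f /asboolP sf; apply/asboolP => c Ac r.
exact: (CkM (@cod_open _ _ c) (Ck_cst r _ a) (sf c Ac r)).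
Qed.

HB.instance Definition _ := GRing.isSubringClosed.Build (M -> R) smooth_pred
  smooth_pred_subring.
HB.instance Definition _ := GRing.isScaleClosed.Build R (M -> R) smooth_pred
  smooth_pred_submod.

Record Cinf := MkCinf { cinf_val :> M -> R; cinf_valP : cinf_val \in smooth_pred }.

HB.instance Definition _ := [isSub for cinf_val].
HB.instance Definition _ := [Choice of Cinf by <:].
HB.instance Definition _ := GRing.SubChoice_isSubComPzRing.Build _ _ Cinf (subringClosedP _).
HB.instance Definition _ := [SubZmodule_isSubLmodule of Cinf by <:].

End SmoothFunctions.

Section Tangent.
Variables (n : nat) (M : manifold n).
Notation C := (Cinf M).

(* Tangent vectors at [p] are the derivations at [p] of the algebra [Cinf M]. *)
Definition is_tangent (p : M) (v : C -> R) : Prop :=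
  (forall (a : R) (f g : C), v (a *: f + g) = a * v f + v g) /\
  (forall f g : C, v (f * g) = v f * g p + f p * v g).

Definition tangent_pred p : {pred C -> R} := fun v => `[< is_tangent p v >].

Lemma tangent_pred_zmod p : zmod_closed (tangent_pred p).
Proof.
split=> [|v w /asboolP[lv dv] /asboolP[lw dw]]; apply/asboolP.
  split=> [a f g|f g]; first by rewrite -[LHS]/(0 : R) -[RHS]/(a * 0 + 0) mulr0 addr0.
  by rewrite -[LHS]/(0 : R) -[RHS]/(0 * g p + f p * 0) mul0r mulr0 addr0.
split=> [a f g|f g]; rewrite !fctE; first by rewrite lv lw; lra.
by rewrite dv dw; lra.
Qed.

Lemma tangent_pred_scale p : scaler_closed (tangent_pred p).
Proof.
move=> b v /asboolP[lv dv]; apply/asboolP.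
split=> [a f g|f g]; rewrite /GRing.scale /=.
  by rewrite lv /GRing.scale /=; lra.
by rewrite dv /GRing.scale /=; lra.
Qed.

HB.instance Definition _ p := GRing.isZmodClosed.Build (C -> R)
  (tangent_pred p) (tangent_pred_zmod p).
HB.instance Definition _ p := GRing.isScaleClosed.Build R (C -> R)
  (tangent_pred p) (@tangent_pred_scale p).

Record tangent (p : M) := MkTangent {
  tan_val :> C -> R; tan_valP : tan_val \in tangent_pred p }.

Section TangentInstances.
Variable p : M.
HB.instance Definition _ := [isSub for @tan_val p].
HB.instance Definition _ := [Choice of tangent p by <:].
HB.instance Definition _ := [SubChoice_isSubZmodule of tangent p by <:].
HB.instance Definition _ := [SubZmodule_isSubLmodule of tangent p by <:].
End TangentInstances.

(* Smooth vector fields are the derivations of [Cinf M]; [vf_at X p] below is the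
   value of [X] at [p]. *)
Definition is_vfield (X : C -> C) : Prop :=
  (forall (a : R) (f g : C), X (a *: f + g) = a *: X f + X g) /\
  (forall f g : C, X (f * g) = X f * g + f * X g).

Definition vfield_pred : {pred C -> C} := fun X => `[< is_vfield X >].

Lemma vfield_pred_zmod : zmod_closed vfield_pred.
Proof.
split=> [|v w /asboolP[lv dv] /asboolP[lw dw]]; apply/asboolP.
  split=> [a f g|f g].
    by rewrite -[LHS]/(0 : C) -[RHS]/(a *: 0 + 0) scaler0 addr0.
  by rewrite -[LHS]/(0 : C) -[RHS]/(0 * g + f * 0) mul0r mulr0 addr0.
split=> [a f g|f g]; rewrite !fctE.
  by rewrite lv lw scalerBr opprD addrACA.
by rewrite dv dw mulrBl mulrBr opprD addrACA.
Qed.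

HB.instance Definition _ := GRing.isZmodClosed.Build (C -> C)
  vfield_pred vfield_pred_zmod.

Record vfield := MkVfield {
  vf_val :> C -> C; vf_valP : vf_val \in vfield_pred }.

HB.instance Definition _ := [isSub for vf_val].
HB.instance Definition _ := [Choice of vfield by <:].
HB.instance Definition _ := [SubChoice_isSubZmodule of vfield by <:].

Lemma vfieldP (X : vfield) : is_vfield X.
Proof. by apply/asboolP; exact: vf_valP. Qed.

Lemma vfield_scale_subproof (h : C) (X : vfield) :
  (fun f => h * X f) \in vfield_pred.
Proof.
have [lX dX] := vfieldP X; apply/asboolP; split=> [a f g|f g].
  rewrite lX mulrDr; congr +%R; apply/val_inj/funext => p /=.
  by rewrite /GRing.scale /= /GRing.mul /= mulrCA.
by rewrite dX mulrDr mulrA mulrCA.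
Qed.

Definition vfield_scale (h : C) (X : vfield) : vfield :=
  MkVfield (vfield_scale_subproof h X).

Fact vfield_scaleA h k X :
  vfield_scale h (vfield_scale k X) = vfield_scale (h * k) X.
Proof. by apply/val_inj/funext => f /=; rewrite mulrA. Qed.
Fact vfield_scale1 : left_id 1 vfield_scale.
Proof. by move=> X; apply/val_inj/funext => f /=; rewrite mul1r. Qed.
Fact vfield_scaleDr : right_distributive vfield_scale +%R.
Proof. by move=> h X Y; apply/val_inj/funext => f /=; rewrite /= fctE mulrDr. Qed.
Fact vfield_scaleDl X : {morph vfield_scale^~ X : h k / h + k}.
Proof. by move=> h k; apply/val_inj/funext => f /=; rewrite mulrDl. Qed.

HB.instance Definition _ := GRing.Zmodule_isLmodule.Build C vfield
  vfield_scaleA vfield_scale1 vfield_scaleDr vfield_scaleDl.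

Lemma vf_at_subproof (X : vfield) (p : M) :
  (fun f => X f p) \in tangent_pred p.
Proof.
have [lX dX] := vfieldP X; apply/asboolP; split=> [a f g|f g].
  by rewrite lX.
by rewrite dX.
Qed.

Definition vf_at (X : vfield) (p : M) : tangent p :=
  MkTangent (vf_at_subproof X p).

Lemma bracket_subproof (X Y : vfield) :
  (fun f => X (Y f) - Y (X f)) \in vfield_pred.
Proof.
have [lX dX] := vfieldP X; have [lY dY] := vfieldP Y.
have aX f g : X (f + g) = X f + X g by have := lX 1 f g; rewrite !scale1r.
have aY f g : Y (f + g) = Y f + Y g by have := lY 1 f g; rewrite !scale1r.
apply/asboolP; split=> [a f g|f g].
  by rewrite lY lX lX lY scalerBr opprD addrACA.
rewrite dX dY aX aY !dX !dY; ring.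
Qed.

Definition bracket (X Y : vfield) : vfield := MkVfield (bracket_subproof X Y).

End Tangent.

Section Differential.
Variables (m n : nat) (M : manifold m) (N : manifold n) (phi : smooth_map M N).

Lemma pullback_subproof (f : Cinf N) : (f \o phi : M -> R) \in @smooth_pred _ M.
Proof. by apply/asboolP/smooth_fun_comp/asboolP; exact: cinf_valP. Qed.

Definition pullback (f : Cinf N) : Cinf M := MkCinf (pullback_subproof f).

Lemma dmap_subproof p (v : tangent p) :
  (fun f : Cinf N => v (pullback f)) \in tangent_pred (phi p).
Proof.
have /asboolP[lv dv] := tan_valP v; apply/asboolP; split=> [a f g|f g].
  have -> : pullback (a *: f + g) = a *: pullback f + pullback g by exact/val_inj.
  exact: lv.
have -> : pullback (f * g) = pullback f * pullback g by exact/val_inj.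
exact: dv.
Qed.

Definition dmap p (v : tangent p) : tangent (phi p) :=
  MkTangent (dmap_subproof v).

End Differential.

(* On the connected manifold [M] the index of [g] is automatically constant. *)
Record metric n (M : manifold n) := Metric {
  gval :> forall p : M, tangent p -> tangent p -> R;
  gval_linear : forall p (a : R) (x y z : tangent p),
    gval (a *: x + y) z = a * gval x z + gval y z;
  gval_sym : forall p (x y : tangent p), gval x y = gval y x;
  gval_nondeg : forall p (x : tangent p), (forall y, gval x y = 0) -> x = 0;
  gval_smooth : forall X Y : vfield M,
    smooth_fun (fun p => gval (vf_at X p) (vf_at Y p))
}.

Section Metric.
Variables (n : nat) (M : manifold n) (g : metric M).

Definition Riemannian : Prop :=
  forall (p : M) (x : tangent p), x != 0 -> 0 < g p x x.

Definition negdef_family (p : M) k (e : 'I_k -> tangent p) : Prop :=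
  forall a : 'I_k -> R, (exists i, a i != 0) ->
    g p (\sum_i a i *: e i) (\sum_i a i *: e i) < 0.

Definition has_index (r : nat) : Prop := forall p : M,
  (exists e : 'I_r -> tangent p, negdef_family e) /\
  (forall k (e : 'I_k -> tangent p), negdef_family e -> (k <= r)%N).

Lemma gfun_subproof (X Y : vfield M) :
  (fun p => g p (vf_at X p) (vf_at Y p)) \in @smooth_pred _ M.
Proof. by apply/asboolP; exact: gval_smooth. Qed.

Definition gfun (X Y : vfield M) : Cinf M := MkCinf (gfun_subproof X Y).

Definition connection := vfield M -> vfield M -> vfield M.

Record Levi_Civita (D : connection) : Prop := LeviCivita {
  LC_linl : forall (f : Cinf M) (X Y Z : vfield M),
    D (f *: X + Y) Z = f *: D X Z + D Y Z;
  LC_addr : forall X Y Z : vfield M, D X (Y + Z) = D X Y + D X Z;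
  LC_leibniz : forall (f : Cinf M) (X Y : vfield M),
    D X (f *: Y) = X f *: Y + f *: D X Y;
  LC_torsion : forall X Y : vfield M, D X Y - D Y X = bracket X Y;
  LC_metric : forall X Y Z : vfield M,
    X (gfun Y Z) = gfun (D X Y) Z + gfun Y (D X Z)
}.

Variable D : connection.

Definition curvature (E F G : vfield M) : vfield M :=
  D E (D F G) - D F (D E G) - D (bracket E F) G.

Definition curvature4 (E F G G' : vfield M) : Cinf M :=
  - gfun (curvature E F G) G'.

(* [K(X,V)] at [p]. By tensoriality it depends only on the values of [X] and [V]
   at [p], and every tangent vector at [p] is the value of some global field. *)
Definition sectional (X V : vfield M) (p : M) : R :=
  curvature4 X V X V p /
  (gfun X X p * gfun V V p - (gfun X V p) ^+ 2).

End Metric.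

Section Submersion.
Variables (m n : nat) (M : manifold m) (B : manifold n).
Variables (g : metric M) (g' : metric B) (prj : smooth_map M B).

(* As [prj] is a submersion, the tangent space of a fibre is the kernel of [dmap]. *)
Definition vertical (p : M) (v : tangent p) : Prop := dmap prj v = 0.

Definition horizontal (p : M) (x : tangent p) : Prop :=
  forall v : tangent p, vertical v -> g p x v = 0.

(* [subm_nondeg] says that the fibres are nondegenerate submanifolds. *)
Record semi_Riemannian_submersion : Prop := SemiRiemannianSubmersion {
  subm_surj : forall b : B, exists p : M, prj p = b;
  subm_onto : forall (p : M) (w : tangent (prj p)),
    exists v : tangent p, dmap prj v = w;
  subm_nondeg : forall (p : M) (v : tangent p), vertical v ->
    (forall u : tangent p, vertical u -> g p v u = 0) -> v = 0;
  subm_isometry : forall (p : M) (x y : tangent p),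
    horizontal x -> horizontal y -> g' (prj p) (dmap prj x) (dmap prj y) = g p x y
}.

(* Such a [y] is unique, and exists, since the fibres are nondegenerate. *)
Definition hproj (p : M) (x : tangent p) : tangent p :=
  xget 0 [set y : tangent p | horizontal y /\ vertical (x - y)].

Definition vertical_field (V : vfield M) : Prop := forall p, vertical (vf_at V p).

Definition horizontal_field (X : vfield M) : Prop :=
  forall p, horizontal (vf_at X p).

Definition basic (X : vfield M) : Prop := horizontal_field X /\
  exists X' : vfield B, forall p, dmap prj (vf_at X p) = vf_at X' (prj p).

Definition fibre_sff (D : connection M) (U V : vfield M) (p : M) : tangent p :=
  hproj (vf_at (D U V) p).

(* The frame is local, on [W], but made of globally defined fields: near any given
   point every local frame is the restriction of such fields. *)
Definition orthonormal_vertical_frame r (W : set M) (e : 'I_r -> vfield M)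
    (eps : 'I_r -> R) : Prop :=
  [/\ open W,
      forall p i, W p -> vertical (vf_at (e i) p),
      forall i, eps i \in [:: -1; 1] &
      forall p i j, W p ->
        g p (vf_at (e i) p) (vf_at (e j) p) = eps i * (i == j)%:R].

Definition mean_curvature (D : connection M) (H : vfield M) : Prop :=
  forall (W : set M) (e : 'I_(m - n) -> vfield M) (eps : 'I_(m - n) -> R),
    orthonormal_vertical_frame W e eps ->
    forall p, W p -> vf_at H p = \sum_i eps i *: fibre_sff D (e i) (e i) p.

Definition totally_umbilic_fibres (D : connection M) (H : vfield M) : Prop :=
  forall U V : vfield M, vertical_field U -> vertical_field V ->
  forall p, fibre_sff D U V p = ((m - n)%:R^-1 * gfun g U V p) *: vf_at H p.

Definition totally_geodesic_fibres (D : connection M) : Prop :=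
  forall U V : vfield M, vertical_field U -> vertical_field V ->
  forall p, fibre_sff D U V p = 0.

(* Through every point passes an integral manifold of the horizontal distribution,
   that is, an injectively immersed [L] with tangent spaces the horizontal ones. *)
Definition horizontal_integrable : Prop := forall p : M,
  exists (L : manifold n) (i : smooth_map L M) (q : L),
  [/\ i q = p, injective i,
      forall (x : L) (v : tangent x), dmap i v = 0 -> v = 0 &
      forall (x : L) (w : tangent (i x)),
        horizontal w <-> exists v : tangent x, dmap i v = w].

End Submersion.

(* [phi] is an isometry from the warped product of [B0] and [F0] onto a
   neighbourhood of [p], with inverse [psi]. The dimensions [k] of the base and [l]
   of the fibre are prescribed: if a factor could be a point, then every manifold
   would be a locally warped product. *)
Definition locally_warped_product m (M : manifold m) (g : metric M)
    (k l : nat) : Prop := forall p : M,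
  exists (B0 : manifold k) (F0 : manifold l) (gB : metric B0) (gF : metric F0)
    (f : Cinf B0) (phi : smooth_map (prod_manifold B0 F0) M)
    (psi : M -> prod_manifold B0 F0),
  [/\ forall b, 0 < f b,
      open (range phi) /\ range phi p,
      cancel phi psi,
      smooth_map_on (range phi) psi &
      forall (q : prod_manifold B0 F0) (x y : tangent q),
        g (phi q) (dmap phi x) (dmap phi y) =
        gB q.1 (dmap (prod_fst B0 F0) x) (dmap (prod_fst B0 F0) y) +
        (f q.1) ^+ 2 *
        gF q.2 (dmap (prod_snd B0 F0) x) (dmap (prod_snd B0 F0) y)].

End Smooth.

(* Main.v *)
Require Import Defs.
From mathcomp Require Import all_boot all_order all_algebra.
From mathcomp Require Import all_classical all_reals all_analysis.
From mathcomp Require Import ring lra.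

Set Implicit Arguments.
Unset Strict Implicit.
Unset Printing Implicit Defensive.

Import Order.TTheory GRing.Theory Num.Theory.
Import numFieldNormedType.Exports.

Local Open Scope classical_set_scope.
Local Open Scope ring_scope.

(** The index hypothesis makes the metric negative definite on vertical vectors and
    positive definite on horizontal ones, so the mixed curvature condition says
    [R(X,V,X,V) <= 0]. With [N = H/r], umbilicity and basic [X], O'Neill's formula reads
      [R(X,V,X,V) = g(V,V) (g(X, D_X N) - g(X,N)^2) + g(W,W)],
    where [W = D_V X + g(X,N) V] is horizontal. As [H] is basic, [g(H,H)] is the pullback
    of a function on the compact [B], and it has a maximum. There [g(H, D_H H) = 0], and
    taking [X = H] makes both terms nonnegative and the first one positive unless [H = 0].
    Hence [H = 0], the fibres are totally geodesic, and the formula becomes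
    [R(X,V,X,V) = g(D_V X, D_V X) >= 0], so the mixed curvature vanishes and [D_V X = 0].
    It follows that brackets of basic fields are horizontal and that the flows of basic
    fields act isometrically on the fibres.

    For the local product, basic lifts [X_i] of coordinate fields commute. Flowing along
    them from a slice tangent to a fibre, for times corrected so that the slice becomes part
    of the fibre, gives a chart in which the [X_i] are the first coordinate fields and [prj]
    is the projection; in it the metric is a product, with [f = 1]. Flows are limits
    of Euler polygons with [2^i] steps; they also yield the inverse function theorem and
    Hadamard's lemma. *)

(** * Smooth functions on normed spaces *)

(** Tangent vectors are derivations of the algebra of global functions, so not even the dimension of
    a tangent space is known until Hadamard's lemma expands functions in coordinates; hence the
    analysis precedes the geometry. One tool serves Hadamard's lemma, the inverse function theorem
    and the adapted charts: the time-one flow of a combination of fields, smooth jointly in the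
    coefficients and the starting point. Fields known only locally are first extended to bounded
    global ones, so no polygon escapes, and a speed bound proportional to the coefficients keeps
    short flows where the extension changed nothing. A polygon satisfies an identity of the flow
    only up to an error of order [1/k]; constants independent of [k] make it exact in the limit. The
    derivative of a flow is again a flow, of the variational field in twice the dimension.

    In the curvature argument the term [g(X, D_X N)] has no sign for general [X]. A choice of both
    the point and the direction removes it; what is left is a quadratic term, whose sign is decided
    by the definiteness of the fibres. *)

Section SmoothBasics.
Context {R : realType} {V : normedModType R}.
Implicit Types (U : set V) (f g : V -> R).

Lemma smooth_sub U U' f : U `<=` U' -> smooth_on U' f -> smooth_on U f.
Proof. by move=> sU sf k; exact: Ck_sub sU (sf k). Qed.

Lemma smooth_ext U f g : open U -> (forall x, U x -> f x = g x) ->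
  smooth_on U f -> smooth_on U g.
Proof. by move=> oU fg sf k; exact: Ck_ext oU fg (sf k). Qed.

Lemma smooth_local U f :
  (forall x, U x -> exists2 W : set V, W x & smooth_on W f) -> smooth_on U f.
Proof. by move=> H k; apply: Ck_local => x /H[W Wx sW]; exists W. Qed.

Lemma smooth_cst U (a : R) : smooth_on U (fun=> a).
Proof. by move=> k; exact: Ck_cst. Qed.

Lemma smoothD U f g : open U -> smooth_on U f -> smooth_on U g ->
  smooth_on U (fun x => f x + g x).
Proof. by move=> oU sf sg k; exact: CkD. Qed.

Lemma smoothM U f g : open U -> smooth_on U f -> smooth_on U g ->
  smooth_on U (fun x => f x * g x).
Proof. by move=> oU sf sg k; exact: CkM. Qed.

Lemma smoothN U f : open U -> smooth_on U f -> smooth_on U (fun x => - f x).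
Proof.
move=> oU sf; apply: (smooth_ext oU _ (smoothM oU (smooth_cst _ (-1)) sf)).
by move=> x _; rewrite mulN1r.
Qed.

Lemma smoothB U f g : open U -> smooth_on U f -> smooth_on U g ->
  smooth_on U (fun x => f x - g x).
Proof. by move=> oU sf sg; apply: smoothD => //; exact: smoothN. Qed.

Lemma smooth_sum U (I : Type) (r : seq I) (P : pred I) (h : I -> V -> R) : open U ->
  (forall j, P j -> smooth_on U (h j)) -> smooth_on U (fun x => \sum_(j <- r | P j) h j x).
Proof.
move=> oU sh; elim: r => [|i r IH].
  by apply: (smooth_ext oU _ (smooth_cst U 0)) => x _; rewrite big_nil.
case Pi : (P i).
  apply: (smooth_ext oU _ (smoothD oU (sh i Pi) IH)) => x _.
  by rewrite big_cons Pi.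
by apply: (smooth_ext oU _ IH) => x _; rewrite big_cons Pi.
Qed.

Lemma smooth_prod U (I : Type) (r : seq I) (P : pred I) (h : I -> V -> R) : open U ->
  (forall j, P j -> smooth_on U (h j)) -> smooth_on U (fun x => \prod_(j <- r | P j) h j x).
Proof.
move=> oU sh; elim: r => [|i r IH].
  by apply: (smooth_ext oU _ (smooth_cst U 1)) => x _; rewrite big_nil.
case Pi : (P i).
  apply: (smooth_ext oU _ (smoothM oU (sh i Pi) IH)) => x _.
  by rewrite big_cons Pi.
by apply: (smooth_ext oU _ IH) => x _; rewrite big_cons Pi.
Qed.

Lemma smooth_differentiable U f x : smooth_on U f -> U x -> differentiable f x.
Proof. by move=> sf; have [df _] := sf 1%N; exact: df. Qed.

Lemma smooth_continuous U f x : smooth_on U f -> U x -> {for x, continuous f}.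
Proof. by move=> sf; exact: Ck_continuous (sf 0). Qed.

Lemma smooth_derive U f v : smooth_on U f -> smooth_on U (fun x => 'D_v f x).
Proof. by move=> sf k; have [_ Df] := sf k.+1; exact: Df. Qed.

(** The derivative [- f ^- 2 * 'D_v f] contains only the inverse itself, one order lower, so the
    induction on [k] closes. *)
Lemma Ck_inv k U f : open U -> (forall x, U x -> f x != 0) ->
  Ck k U f -> Ck k U (fun x => (f x)^-1).
Proof.
move=> oU f0; elim: k f f0 => [|k IH] f f0.
  by move=> cf x Ux; apply: cvgV; [exact: f0|exact: cf].
move=> Cf; have [df Df] := Cf.
split=> [x Ux|v]; first by apply: differentiableV; [exact: df|exact: f0].
have := CkM oU (Ck_cst k U (-1)) (CkM oU (CkM oU (IH _ f0 (CkW Cf)) (IH _ f0 (CkW Cf))) (Df v)).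
apply: Ck_ext => // x Ux.
have dv : derivable f x v by apply: diff_derivable; exact: df.
rewrite deriveV ?f0 //.
by rewrite !fctE /= mulN1r scaleNr -exprVn expr2.
Qed.

Lemma smooth_inv U f : open U -> (forall x, U x -> f x != 0) ->
  smooth_on U f -> smooth_on U (fun x => (f x)^-1).
Proof. by move=> oU f0 sf k; exact: Ck_inv. Qed.

Lemma smooth_comp n U (W : set 'rV[R]_n) (t : V -> 'rV[R]_n) (f : 'rV[R]_n -> R) :
  open U -> (forall x, U x -> W (t x)) ->
  smooth_onv U t -> smooth_on W f -> smooth_on U (fun x => f (t x)).
Proof. by move=> oU UW st sf k; apply: Ck_comp (sf k) => // j; exact: st. Qed.

Lemma smoothv_differentiable n U (t : V -> 'rV[R]_n) x :
  smooth_onv U t -> U x -> differentiable t x.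
Proof. by move=> st Ux; apply: differentiable_rV => j; exact: smooth_differentiable (st j) Ux. Qed.

Lemma smoothv_continuous n U (t : V -> 'rV[R]_n) x :
  smooth_onv U t -> U x -> {for x, continuous t}.
Proof. by move=> st Ux; apply: continuous_rV => j; exact: smooth_continuous (st j) Ux. Qed.

Lemma smoothv_derive n U (t : V -> 'rV[R]_n) v : open U ->
  smooth_onv U t -> smooth_onv U (fun x => 'D_v t x).
Proof.
move=> oU st j; apply: (smooth_ext oU _ (smooth_derive v (st j))) => x Ux.
by rewrite derive_rV //; exact: smoothv_differentiable Ux.
Qed.

Lemma smoothvD n U (s t : V -> 'rV[R]_n) : open U ->
  smooth_onv U s -> smooth_onv U t -> smooth_onv U (fun x => s x + t x).
Proof.
by move=> oU ss st j; apply: (smooth_ext oU _ (smoothD oU (ss j) (st j))) => x _; rewrite mxE.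
Qed.

Lemma smoothv_row_mx n1 n2 U (s : V -> 'rV[R]_n1) (t : V -> 'rV[R]_n2) : open U ->
  smooth_onv U s -> smooth_onv U t -> smooth_onv U (fun x => row_mx (s x) (t x)).
Proof.
move=> oU ss st j; rewrite -(splitK j); case: (fintype.split j) => i /=.
  by apply: (smooth_ext oU _ (ss i)) => x _; rewrite row_mxEl.
by apply: (smooth_ext oU _ (st i)) => x _; rewrite row_mxEr.
Qed.

Lemma smoothv_cst n U (a : 'rV[R]_n) : smooth_onv U (fun=> a).
Proof. by move=> j; exact: smooth_cst. Qed.

Lemma smoothv_mulmx n m U (t : V -> 'rV[R]_n) (A : 'M[R]_(n, m)) : open U ->
  smooth_onv U t -> smooth_onv U (fun x => t x *m A).
Proof.
move=> oU st j; have : smooth_on U (fun x => \sum_i t x 0 i * A i j).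
  by apply: smooth_sum => // i _; apply: smoothM => //; exact: smooth_cst.
by apply: smooth_ext => // x _; rewrite mxE.
Qed.

Lemma smoothv_lsub n1 n2 U (t : V -> 'rV[R]_(n1 + n2)) : open U ->
  smooth_onv U t -> smooth_onv U (fun x => lsubmx (t x)).
Proof. by move=> oU st j; apply: (smooth_ext oU _ (st (lshift n2 j))) => x _; rewrite mxE. Qed.

Lemma smoothv_rsub n1 n2 U (t : V -> 'rV[R]_(n1 + n2)) : open U ->
  smooth_onv U t -> smooth_onv U (fun x => rsubmx (t x)).
Proof. by move=> oU st j; apply: (smooth_ext oU _ (st (rshift n1 j))) => x _; rewrite mxE. Qed.

Lemma smoothv_comp n m U (W : set 'rV[R]_n) (t : V -> 'rV[R]_n) (f : 'rV[R]_n -> 'rV[R]_m) :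
  open U -> (forall x, U x -> W (t x)) ->
  smooth_onv U t -> smooth_onv W f -> smooth_onv U (fun x => f (t x)).
Proof. by move=> oU UW st sf j; apply: (smooth_comp oU UW st (sf j)). Qed.

End SmoothBasics.

(** * Norm, mean value and Taylor estimates for row vectors *)

Section RowVectors.
Context {R : realType}.

Lemma smoothv_id n (U : set 'rV[R]_n) : smooth_onv U id.
Proof. by move=> j k; exact: Ck_coord. Qed.

Lemma rV_coord_le n (x : 'rV[R]_n) j : `|x 0 j| <= `|x|.
Proof.
rewrite [leRHS]/Num.Def.normr/= mx_normrE.
by apply: le_trans (le_bigmax _ _ (0, j)).
Qed.

Lemma rV_norm_le n (x : 'rV[R]_n) e : 0 <= e -> (forall j, `|x 0 j| <= e) -> `|x| <= e.
Proof.
move=> e0 H; rewrite [leLHS]/Num.Def.normr/= mx_normrE (bigmax_le _ e0)//= => -[i j] _ /=.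
by rewrite (ord1 i).
Qed.

Lemma norm_row_mx n1 n2 (x : 'rV[R]_n1) (y : 'rV[R]_n2) e :
  `|x| <= e -> `|y| <= e -> `|row_mx x y| <= e.
Proof.
move=> hx hy; apply: rV_norm_le => [|j]; first exact: le_trans hx.
rewrite -(splitK j); case: (fintype.split j) => i /=.
  by rewrite row_mxEl (le_trans (rV_coord_le _ _)).
by rewrite row_mxEr (le_trans (rV_coord_le _ _)).
Qed.

Lemma norm_lsub n1 n2 (x : 'rV[R]_(n1 + n2)) : `|lsubmx x| <= `|x|.
Proof. by apply: rV_norm_le => // j; rewrite mxE; exact: rV_coord_le. Qed.

Lemma norm_rsub n1 n2 (x : 'rV[R]_(n1 + n2)) : `|rsubmx x| <= `|x|.
Proof. by apply: rV_norm_le => // j; rewrite mxE; exact: rV_coord_le. Qed.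

Lemma derive_sum_coord n (W : normedModType R) (f : 'rV[R]_n -> W) x v :
  differentiable f x -> 'D_v f x = \sum_j v 0 j *: 'D_(delta_mx 0 j) f x.
Proof.
move=> df; rewrite deriveE // {1}(row_sum_delta v) linear_sum.
by apply: eq_bigr => j _; rewrite linearZ -deriveE.
Qed.

Lemma compact_closed_ball n (r : R) : compact [set x : 'rV[R]_n | `|x| <= r].
Proof.
apply: bounded_closed_compact.
  exists r; split; first by rewrite num_real.
  by move=> M rM x /= xr; apply: le_trans xr (ltW rM).
have -> : [set x : 'rV[R]_n | `|x| <= r] = (fun x : 'rV[R]_n => `|x|) @^-1` [set y | y <= r] by [].
apply: closed_comp; last exact: closed_le.
by move=> x _; exact: norm_continuous.
Qed.

Lemma ball_bound n (f : 'rV[R]_n -> R) (r : R) : continuous f ->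
  exists C, 0 <= C /\ forall x, `|x| <= r -> `|f x| <= C.
Proof.
move=> cf; have [M [_ HM]] : bounded_set (f @` [set x | `|x| <= r]).
  apply: compact_bounded; apply: continuous_compact; last exact: compact_closed_ball.
  exact: continuous_subspaceT.
exists (`|M| + 1); split; first by rewrite addr_ge0.
move=> x xr; apply: (HM (`|M| + 1)); last by exists x.
by rewrite (le_lt_trans (ler_norm _)) // ltrDl.
Qed.

Lemma MVT_line n (f : 'rV[R]_n -> R) (x y : 'rV[R]_n) :
  (forall t, 0 <= t <= 1 -> differentiable f (x + t *: (y - x))) ->
  exists2 t, 0 <= t <= 1 & f y - f x = 'D_(y - x) f (x + t *: (y - x)).
Proof.
move=> df; pose l (t : R^o) : 'rV[R]_n := x + t *: (y - x).
have dfl (t : R^o) : 0 <= t <= 1 -> differentiable (f \o l : R^o -> R^o) t.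
  move=> t01; have dl : differentiable l t by apply: differentiableD => //; exact: differentiableZl.
  by apply: differentiable_comp => //; exact: df.
have dl (t : R^o) : t \in `]0, 1[%R -> is_derive t (1 : R^o) (f \o l : R^o
  -> R^o) ('D_(y - x) f (l t)).
  rewrite in_itv /= => /andP[/ltW t0 /ltW t1]; have t01 : 0 <= t <= 1 by rewrite t0.
  have H : differentiable l t by apply: differentiableD => //; exact: differentiableZl.
  apply: DeriveDef; first exact/diff_derivable/dfl.
  have dlE : 'd l t 1 = y - x.
    rewrite -deriveE // /l deriveD //; last exact/diff_derivable/differentiableZl.
    rewrite derive_cst add0r deriveE; last exact: differentiableZl.
    by rewrite diffZl //= diff_val scale1r.
  rewrite deriveE; last exact: dfl.
  have dft : differentiable f (l t) by exact: df.
  by rewrite diff_comp //= dlE [in RHS]deriveE.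
have cl : {within `[0, 1], continuous (f \o l)}.
  apply/continuous_in_subspaceT => t; rewrite inE /= in_itv /= => t01.
  exact/differentiable_continuous/dfl.
have [t tI] := MVT_segment ler01 dl cl.
rewrite subr0 mulr1 /= /l scale1r scale0r addr0 subrKC => ->.
by exists t => //; move: tI; rewrite in_itv.
Qed.

Lemma norm_segment n (x y : 'rV[R]_n) (t r : R) : 0 <= t <= 1 ->
  `|x| <= r -> `|y| <= r -> `|x + t *: (y - x)| <= r.
Proof.
move=> /andP[t0 t1] xr yr.
have -> : x + t *: (y - x) = (1 - t) *: x + t *: y.
  by rewrite scalerBr scalerBl scale1r addrA addrAC.
apply: le_trans (ler_normD _ _) _.
rewrite !normrZ (ger0_norm t0) ger0_norm ?subr_ge0 //.
have : (1 - t) * `|x| <= (1 - t) * r by rewrite ler_wpM2l ?subr_ge0.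
have : t * `|y| <= t * r by rewrite ler_wpM2l.
lra.
Qed.

(** The finitely many partial derivatives are continuous, hence bounded on the compact ball; a
    direction [v] combines the coordinate ones with coefficients at most [|v|]. *)
Lemma ball_derive_bound n (f : 'rV[R]_n -> R) (r : R) : smooth_on setT f ->
  exists C, 0 <= C /\ forall x v, `|x| <= r -> `|'D_v f x| <= C * `|v|.
Proof.
move=> sf; have H j : exists C, 0 <= C /\
    forall x, `|x| <= r -> `|'D_(delta_mx 0 j) f x| <= C.
  apply: ball_bound => x.
  by apply: (@smooth_continuous _ _ setT _ x _ I); exact: smooth_derive.
have [C HC] := choice H; exists (\sum_j C j); split.
  by apply: sumr_ge0 => j _; case: (HC j).
move=> x v xr; rewrite derive_sum_coord; last exact: smooth_differentiable sf I.
rewrite mulr_suml; apply: le_trans (ler_norm_sum _ _ _) _; apply: ler_sum => j _.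
rewrite normrM mulrC; apply: ler_pM => //; last exact: rV_coord_le.
by have [_] := HC j; exact.
Qed.

Lemma ball_lipschitz n (f : 'rV[R]_n -> R) (r : R) : smooth_on setT f ->
  exists C, 0 <= C /\ forall x y, `|x| <= r -> `|y| <= r -> `|f y - f x| <= C * `|y - x|.
Proof.
move=> sf; have [C [C0 HC]] := ball_derive_bound r sf; exists C; split => // x y xr yr.
have [|t t01 ->] := @MVT_line _ f x y; first by move=> t _; exact: smooth_differentiable sf I.
by apply: HC; exact: norm_segment.
Qed.

(** By the mean value theorem the remainder is a difference of derivatives at two points of the
    ball, and the partial derivatives are themselves Lipschitz there. *)
Lemma ball_taylor n (f : 'rV[R]_n -> R) (r : R) : smooth_on setT f ->
  exists C, 0 <= C /\ forall x y, `|x| <= r -> `|y| <= r ->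
    `|f y - f x - 'D_(y - x) f x| <= C * `|y - x| ^+ 2.
Proof.
move=> sf; have df z : differentiable f z by exact: smooth_differentiable sf I.
have H j : exists C, 0 <= C /\ forall x y, `|x| <= r -> `|y| <= r ->
    `|'D_(delta_mx 0 j) f y - 'D_(delta_mx 0 j) f x| <= C * `|y - x|.
  by apply: ball_lipschitz; exact: smooth_derive.
have [C HC] := choice H; exists (\sum_j C j); split.
  by apply: sumr_ge0 => j _; case: (HC j).
move=> x y xr yr; have [//|t t01 ->] := @MVT_line _ f x y.
rewrite !derive_sum_coord // -sumrB mulr_suml.
apply: le_trans (ler_norm_sum _ _ _) _; apply: ler_sum => j _.
rewrite -scalerBr normrM expr2 mulrCA; apply: ler_pM => //; first exact: rV_coord_le.
have [C0 HCj] := HC j; apply: le_trans (HCj _ _ _ _) _ => //; first exact: norm_segment.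
rewrite ler_wpM2l // addrAC subrr add0r normrZ.
by move/andP: t01 => [t0 t1]; rewrite ger0_norm // ler_piMl.
Qed.

End RowVectors.

(** * Flows as limits of Euler polygons *)

Section DiscreteGronwall.
Context {R : realType}.

(** Each of at most [k] steps adds [C/k] and multiplies by [1 + L/k], whose [k]-th power is at most
    [expR L]. The bound is free of [k], so a [C] of order [1/k] gives a total error of order
    [1/k]. *)
Lemma gronwall (a : nat -> R) (k : nat) (L C A : R) : (0 < k)%N ->
  0 <= L -> 0 <= C -> 0 <= A -> a 0 <= A ->
  (forall j, (j < k)%N -> a j.+1 <= (1 + L / k%:R) * a j + C / k%:R) ->
  forall j, (j <= k)%N -> a j <= (A + C) * expR L.
Proof.
move=> k0 L0 C0 A0 a0 H j jk.
have kp : (0 : R) < k%:R by rewrite ltr0n.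
have q1 : 1 <= 1 + L / k%:R by rewrite lerDl divr_ge0 // ltW.
have q0 : 0 <= 1 + L / k%:R by exact: le_trans ler01 q1.
have Ck0 : 0 <= C / k%:R by rewrite divr_ge0 // ltW.
(* The factor [(1 + L/k) ^+ i] is at least 1, so letting it multiply each new error costs nothing
   and gives a closed form. *)
have key i : (i <= k)%N -> a i <= (A + i%:R * (C / k%:R)) * (1 + L / k%:R) ^+ i.
  elim: i => [|i IH] ik; first by rewrite mul0r addr0 expr0 mulr1.
  apply: le_trans (H i ik) _.
  have -> : (A + i.+1%:R * (C / k%:R)) * (1 + L / k%:R) ^+ i.+1 =
      (1 + L / k%:R) * ((A + i%:R * (C / k%:R)) * (1 + L / k%:R) ^+ i)
      + C / k%:R * (1 + L / k%:R) ^+ i.+1.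
    by rewrite -natr1 exprS; ring.
  apply: lerD; first by rewrite ler_wpM2l // IH // ltnW.
  by rewrite ler_peMr // exprn_ege1.
apply: le_trans (key j jk) _; apply: ler_pM.
- by rewrite addr_ge0 // mulr_ge0.
- exact: exprn_ge0.
- rewrite lerD2l mulrCA ler_piMr // ler_pdivrMr // mul1r ler_nat //.
- have -> : expR L = expR (L / k%:R) ^+ k.
    by rewrite -expRM_natl mulrC divfK // gt_eqF.
  apply: le_trans (_ : (1 + L / k%:R) ^+ k <= _); first exact: ler_weXn2l.
  by rewrite lerXn2r // ?nnegrE ?expR_ge0 // expR_ge1Dx.
Qed.

Lemma geo_small (C e : R) : 0 < e -> exists i : nat, C / 2 ^+ i < e.
Proof.
move=> e0; have [|C0] := lerP C 0.
  by exists 0; rewrite expr0 divr1 (le_lt_trans _ e0).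
exists (Num.bound (C / e)); rewrite ltr_pdivrMr ?exprn_gt0 // mulrC -ltr_pdivrMr //.
apply: lt_trans (archi_boundP _) _; first by rewrite divr_ge0 // ltW.
by rewrite -natrX ltr_nat ltn_expl.
Qed.

(** Passage to the limit for polygons with [2 ^ i] steps: an estimate true up to [C / 2 ^+ i] for
    every [i] is exact. *)
Lemma le_geo (x b C : R) : (forall i : nat, x <= b + C / 2 ^+ i) -> x <= b.
Proof.
move=> H; rewrite leNgt; apply/negP => bx.
have [i Hi] := @geo_small C (x - b) ltac:(by rewrite subr_gt0).
have := H i; lra.
Qed.

Lemma geo_lim (u : nat -> R) (C : R) :
  (forall i, `|u i.+1 - u i| <= C / 2 ^+ i) ->
  forall i, `|u i - lim (u @ \oo)| <= 2 * C / 2 ^+ i.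
Proof.
move=> H.
have C0 : 0 <= C by have := H 0; rewrite expr0 divr1; exact: le_trans.
have up i d : `|u (i + d)%N - u i| <= 2 * C / 2 ^+ i - 2 * C / 2 ^+ (i + d).
  elim: d => [|d IH]; first by rewrite addn0 !subrr normr0.
  rewrite addnS; have := H (i + d)%N.
  have -> : 2 * C / 2 ^+ (i + d).+1 = C / 2 ^+ (i + d).
    by rewrite exprS invfM mulrACA divff ?mul1r // pnatr_eq0.
  have -> : u (i + d).+1 - u i = (u (i + d).+1 - u (i + d)) + (u (i + d) - u i) by ring.
  move=> Hd; apply: le_trans (ler_normD _ _) _.
  have : 2 * C / 2 ^+ (i + d) = C / 2 ^+ (i + d) + C / 2 ^+ (i + d) by field;
    rewrite expf_neq0 // pnatr_eq0.
  lra.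
have bd i d : `|u (i + d)%N - u i| <= 2 * C / 2 ^+ i.
  by apply: le_trans (up i d) _; rewrite gerBl divr_ge0 ?mulr_ge0 ?exprn_ge0.
have cu : cauchy (u @ \oo).
  apply/cauchy_ballP => e e0.
  have [i Hi] := geo_small (2 * C) e0.
  have nb : (u @ \oo) (ball (u i) e).
    exists i => // j /= ij; rewrite -ball_normE /= distrC -(subnKC ij).
    exact: le_lt_trans (bd _ _) Hi.
  have [i2 Hi2] := geo_small (2 * (2 * C)) e0.
  exists ([set x | `|x - u i2| <= 2 * C / 2 ^+ i2], [set x | `|x - u i2| <= 2 * C / 2 ^+ i2]) => /=.
    by split; exists i2 => // j /= ij; rewrite -(subnKC ij).
  move=> [x y] /= [xi yi]; rewrite -ball_normE /=.
  have -> : x - y = (x - u i2) - (y - u i2) by ring.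
  apply: le_lt_trans (ler_normB _ _) _; apply: le_lt_trans Hi2.
  by rewrite -mulrA mulrDl mul1r lerD.
have cvu : cvg (u @ \oo) by exact: cauchy_cvg.
move=> i; have c2 : (fun n => `|u i - u n|) @ \oo --> `|u i - lim (u @ \oo)|.
  by apply: cvg_norm; apply: cvgB => //; exact: cvg_cst.
rewrite -(cvg_lim _ c2) //; apply: limr_le; first by apply/cvg_ex; eexists; exact: c2.
by exists i => // j /= ij; rewrite distrC -(subnKC ij).
Qed.

End DiscreteGronwall.

Section EulerFlow.
Context {R : realType}.

Definition estep N (F : 'rV[R]_N -> 'rV[R]_N) (k : nat) x := x + k%:R^-1 *: F x.

Definition euler N (F : 'rV[R]_N -> 'rV[R]_N) (i : nat) x := iter (2 ^ i) (estep F (2 ^ i)) x.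

(** Only the time-one map is defined; another time is reached by rescaling the field, as the
    coefficients of [comb] do below. The limit is meaningful once [F] is smooth and [stable]. *)
Definition flow N (F : 'rV[R]_N -> 'rV[R]_N) x : 'rV[R]_N :=
  \row_j lim ((fun i => euler F i x 0 j) @ \oo).

(* The polygons started in a given ball stay in a ball that does not depend on the step. *)
Definition stable N (F : 'rV[R]_N -> 'rV[R]_N) := forall r, exists r', forall k j x,
  (0 < k)%N -> (j <= k)%N -> `|x| <= r -> `|iter j (estep F k) x| <= r'.

(** The variational equation: the second half of the point is carried by the linearization of [F]
    along the trajectory of the first half. *)
Definition tangent_field N (F : 'rV[R]_N -> 'rV[R]_N) (z : 'rV[R]_(N + N)) :=
  row_mx (F (lsubmx z)) ('D_(rsubmx z) F (lsubmx z)).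

(** The mean value theorem gives scalar estimates only; for vectors the constants of the coordinates
    are added. [P] and [b] are free so that one proof covers sup, Lipschitz, derivative and Taylor
    bounds. *)
Lemma vector_bound n N (P : 'rV[R]_n -> 'rV[R]_n -> Prop) (G : 'rV[R]_n -> 'rV[R]_n -> 'rV[R]_N)
    (b : 'rV[R]_n -> 'rV[R]_n -> R) : (forall x y, P x y -> 0 <= b x y) ->
  (forall j, exists C, 0 <= C /\ forall x y, P x y -> `|G x y 0 j| <= C * b x y) ->
  exists C, 0 <= C /\ forall x y, P x y -> `|G x y| <= C * b x y.
Proof.
move=> b0 /choice[C HC]; exists (\sum_j C j); split.
  by apply: sumr_ge0 => j _; case: (HC j).
move=> x y Pxy; apply: rV_norm_le => [|j].
  by rewrite mulr_ge0 ?b0 //; apply: sumr_ge0 => j _; case: (HC j).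
have [_ /(_ _ _ Pxy) H] := HC j; apply: le_trans H _; rewrite ler_wpM2r ?b0 //.
by rewrite (bigD1 j) //= lerDl; apply: sumr_ge0 => i _; case: (HC i).
Qed.

Section Bounds.
Variables (n N : nat) (F : 'rV[R]_n -> 'rV[R]_N).
Hypothesis sF : smooth_onv setT F.
Variable r : R.

Lemma vball_bound : exists C, 0 <= C /\ forall x, `|x| <= r -> `|F x| <= C.
Proof.
have [|j|C [C0 HC]] := @vector_bound n N (fun x _ => `|x| <= r) (fun x _ => F x) (fun _ _ => 1).
- by [].
- have [|C [C0 HC]] := @ball_bound _ n (fun x => F x 0 j) r.
    by move=> x; exact: smooth_continuous (sF j) I.
  by exists C; split=> // x _ /HC; rewrite mulr1.
- by exists C; split => // x xr; have := HC x 0 xr; rewrite mulr1.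
Qed.

Lemma vball_lipschitz : exists C, 0 <= C /\ forall x y, `|x| <= r -> `|y| <= r ->
  `|F y - F x| <= C * `|y - x|.
Proof.
have [//|j|C [C0 HC]] := @vector_bound n N (fun x y => `|x| <= r /\ `|y| <= r)
   (fun x y => F y - F x) (fun x y => `|y - x|).
- have [C [C0 HC]] := ball_lipschitz r (sF j).
  by exists C; split=> // x y [xr yr]; rewrite !mxE; exact: HC.
- by exists C; split => // x y xr yr; exact: HC.
Qed.

Lemma vball_derive_bound : exists C, 0 <= C /\ forall x v, `|x| <= r ->
  `|'D_v F x| <= C * `|v|.
Proof.
have [//|j|C [C0 HC]] := @vector_bound n N (fun x y => `|x| <= r)
   (fun x v => 'D_v F x) (fun x v => `|v|).
- have [C [C0 HC]] := ball_derive_bound r (sF j).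
  exists C; split=> // x v xr; rewrite derive_rV; first exact: HC.
  exact: smoothv_differentiable sF I.
- by exists C; split => // x y xr; exact: HC.
Qed.

Lemma vball_taylor : exists C, 0 <= C /\ forall x y, `|x| <= r -> `|y| <= r ->
  `|F y - F x - 'D_(y - x) F x| <= C * `|y - x| ^+ 2.
Proof.
have [x y _|j|C [C0 HC]] := @vector_bound n N (fun x y => `|x| <= r /\ `|y| <= r)
   (fun x y => F y - F x - 'D_(y - x) F x) (fun x y => `|y - x| ^+ 2).
- exact: exprn_ge0.
- have [C [C0 HC]] := ball_taylor r (sF j).
  exists C; split=> // x y [xr yr].
  have -> : (F y - F x - 'D_(y - x) F x) 0 j = F y 0 j - F x 0 j - ('D_(y - x) F x) 0 j.
    by rewrite mxE [in LHS]mxE [(- F x) 0 j]mxE [(- 'D_(_) F x) 0 j]mxE.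
  rewrite derive_rV; first exact: HC.
  exact: smoothv_differentiable sF I.
- by exists C; split => // x y xr yr; exact: HC.
Qed.

Lemma derive_vlinear x a v w : 'D_(a *: v + w) F x = a *: 'D_v F x + 'D_w F x.
Proof.
have dF : differentiable F x by exact: smoothv_differentiable sF I.
by rewrite !deriveE // linearP.
Qed.

End Bounds.

End EulerFlow.

(** * Convergence of the polygons and comparison along them *)

Section FlowLimit.
Context {R : realType} {N : nat}.
Variable F : 'rV[R]_N -> 'rV[R]_N.
Hypotheses (sF : smooth_onv setT F) (stF : stable F).

Lemma estepB k x y : estep F k y - estep F k x = (y - x) + k%:R^-1 *: (F y - F x).
Proof. by rewrite /estep scalerBr opprD addrACA. Qed.

Lemma iter_lipschitz r : exists C, 0 <= C /\ forall k j x y, (0 < k)%N -> (j <= k)%N ->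
  `|x| <= r -> `|y| <= r ->
  `|iter j (estep F k) y - iter j (estep F k) x| <= C * `|y - x|.
Proof.
have [r' Hr'] := stF r; have [L [L0 HL]] := vball_lipschitz sF r'.
exists (expR L); split; first exact: expR_ge0.
move=> k j x y k0 jk xr yr.
have kp : (0 : R) < k%:R by rewrite ltr0n.
pose a j := `|iter j (estep F k) y - iter j (estep F k) x|.
suff step i : (i < k)%N -> a i.+1 <= (1 + L / k%:R) * a i + 0 / k%:R.
  have := @gronwall R a k L 0 `|y - x| k0 L0 (lexx _) (normr_ge0 _) (lexx _) step j jk.
  by rewrite addr0 mulrC.
move=> ik; rewrite mul0r addr0 /a !iterS estepB mulrDl mul1r.
apply: le_trans (ler_normD _ _) _; rewrite lerD2l normrZ ger0_norm ?invr_ge0 ?ler0n //.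
rewrite mulrC mulrAC ler_wpM2r ?invr_ge0 ?ler0n //.
by apply: HL; apply: Hr' => //; exact: ltnW.
Qed.

(** Two half steps differ from a full one by half a step times the change of [F] over the first half
    step, which is of order [k ^- 2]; discrete Gronwall turns this into order [1/k] after [k]
    steps. *)
Lemma euler_cauchy r : exists C, 0 <= C /\ forall i x, `|x| <= r ->
  `|euler F i.+1 x - euler F i x| <= C / 2 ^+ i.
Proof.
have [r' Hr'] := stF r; have [r2 Hr2] := stF r'.
have [L [L0 HL]] := vball_lipschitz sF (Num.max r' r2).
have [B [B0 HB]] := vball_bound sF r'.
exists (L * B * expR L); split; first by rewrite !mulr_ge0 // expR_ge0.
move=> i x xr; rewrite /euler; set k := (2 ^ i)%N.
have k0 : (0 < k)%N by rewrite expn_gt0.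
have kp : (0 : R) < k%:R by rewrite ltr0n.
have -> : (2 ^ i.+1 = k.*2)%N by rewrite expnS mul2n.
have k20 : (0 < k.*2)%N by rewrite double_gt0.
pose a j := `|iter j.*2 (estep F k.*2) x - iter j (estep F k) x|.
have -> : 2 ^+ i = k%:R :> R by rewrite -natrX.
have LB0 : 0 <= L * B / k%:R by rewrite divr_ge0 ?mulr_ge0 // ltW.
have a0 : a 0 <= 0 by rewrite /a subrr normr0.
suff step j : (j < k)%N -> a j.+1 <= (1 + L / k%:R) * a j + L * B / k%:R / k%:R.
  have := @gronwall R a k L _ 0 k0 L0 LB0 (lexx _) a0 step k (leqnn k).
  by rewrite add0r mulrAC.
move=> jk; set y := iter j.*2 (estep F k.*2) x; set z := iter j (estep F k) x.
have yr : `|y| <= r' by apply: Hr' => //; rewrite leq_double ltnW.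
have zr : `|z| <= r' by apply: Hr' => //; exact: ltnW.
(* The point after the first half step is a one-step polygon started in the ball of radius [r'];
   this is what the second radius [r2] is for. *)
have y1r : `|estep F k.*2 y| <= r2 by exact: (Hr2 k.*2 1).
have m1 (v : 'rV[R]_N) : `|v| <= r' -> `|v| <= Num.max r' r2.
  by move=> h; rewrite le_max h.
have m2 (v : 'rV[R]_N) : `|v| <= r2 -> `|v| <= Num.max r' r2.
  by move=> h; rewrite le_max h orbT.
rewrite /a doubleS !iterS -/y -/z.
have h2 : (k.*2)%:R^-1 = k%:R^-1 / 2 :> R by rewrite -muln2 natrM invfM.
have -> : estep F k.*2 (estep F k.*2 y) - estep F k z =
    (y - z) + k%:R^-1 *: (F y - F z) + (k.*2)%:R^-1 *: (F (estep F k.*2 y) - F y).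
  have [y1 y1E] : {y1 | y1 = estep F k.*2 y} by exists (estep F k.*2 y).
  rewrite -y1E; apply/rowP => l.
  have y1l : y1 0 l = y 0 l + k%:R^-1 / 2 * F y 0 l by rewrite y1E /estep !mxE h2.
  by rewrite /estep !mxE y1l h2; field; rewrite gt_eqF.
apply: le_trans (ler_normD _ _) _; apply: lerD.
  rewrite mulrDl mul1r; apply: le_trans (ler_normD _ _) _; rewrite lerD2l normrZ.
  rewrite ger0_norm ?invr_ge0 ?ler0n // mulrC mulrAC ler_wpM2r ?invr_ge0 ?ler0n //.
  by apply: HL; exact: m1.
have hk : 0 <= k%:R^-1 / 2 :> R by rewrite divr_ge0 ?invr_ge0 ?ler0n.
have hk2 : k%:R^-1 / 2 <= k%:R^-1 :> R by rewrite ler_piMr ?invr_ge0 ?ler0n //; lra.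
rewrite h2 normrZ ger0_norm // mulrC; apply: ler_pM => //.
apply: le_trans (HL _ _ (m1 _ yr) (m2 _ y1r)) _.
rewrite /estep addrAC subrr add0r -mulrA ler_wpM2l // normrZ h2 ger0_norm // mulrC.
by apply: ler_pM => //; exact: HB.
Qed.

Lemma flow_spec r : exists C, 0 <= C /\ forall i x, `|x| <= r ->
  `|euler F i x - flow F x| <= C / 2 ^+ i.
Proof.
have [C [C0 HC]] := euler_cauchy r; exists (2 * C); split; first by rewrite mulr_ge0.
move=> i x xr; apply: rV_norm_le => [|j]; first by rewrite divr_ge0 ?mulr_ge0 ?exprn_ge0.
rewrite !mxE; apply: (@geo_lim _ (fun i => euler F i x 0 j)) => k.
apply: le_trans (HC k x xr); apply: le_trans (rV_coord_le _ j).
by rewrite !mxE.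
Qed.

Lemma flow_ball r : exists r', forall x, `|x| <= r -> `|flow F x| <= r' /\
  forall k j, (0 < k)%N -> (j <= k)%N -> `|iter j (estep F k) x| <= r'.
Proof.
have [r' Hr'] := stF r; exists r' => x xr; split; last by move=> k j ? ?; exact: Hr'.
have [C [C0 HC]] := flow_spec r; apply: (@le_geo _ _ _ C) => i.
have -> : flow F x = euler F i x - (euler F i x - flow F x) by rewrite subKr.
apply: le_trans (ler_normB _ _) _; apply: lerD; last exact: HC.
by apply: Hr' => //; rewrite expn_gt0.
Qed.

(* The error of [h - (j/k) w] along the polygon obeys a discrete Gronwall inequality; in
   particular [h] vanishes on the flow if [w = 0] and [|D_F h| <= L |h|]. *)
Lemma flow_compare d (h w : 'rV[R]_N -> 'rV[R]_d) (L : R) x :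
  smooth_onv setT h -> smooth_onv setT w -> 0 <= L -> h x = 0 ->
  (forall k j, (0 < k)%N -> (j <= k)%N -> let y := iter j (estep F k) x in
    `|'D_(F y) h y - w y - (j%:R / k%:R) *: 'D_(F y) w y| <=
      L * `|h y - (j%:R / k%:R) *: w y|) ->
  h (flow F x) = w (flow F x).
Proof.
move=> sh sw L0 hx H.
have [r Hr] := flow_ball `|x|; have {Hr} [fr Hr] := Hr x (lexx _).
have [T1 [T10 HT1]] := vball_taylor sh r.
have [T2 [T20 HT2]] := vball_taylor sw r.
have [W [W0 HW]] := vball_derive_bound sw r.
have [B [B0 HB]] := vball_bound sF r.
(* Three errors of order [k ^- 2] per step: the Taylor remainders of [h] and of [w], and the change
   of [w] multiplied by the increment [1/k] of the factor [j/k]. *)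
pose C := W * B + T1 * B ^+ 2 + T2 * B ^+ 2.
have C0 : 0 <= C by rewrite !addr_ge0 ?mulr_ge0 ?exprn_ge0.
have key k : (0 < k)%N ->
    `|h (iter k (estep F k) x) - w (iter k (estep F k) x)| <= C * expR L / k%:R.
  move=> k0; have kp : (0 : R) < k%:R by rewrite ltr0n.
  have ki : (0 : R) <= k%:R^-1 by rewrite invr_ge0 ltW.
  pose a j := `|h (iter j (estep F k) x) - (j%:R / k%:R) *: w (iter j (estep F k) x)|.
  have Ck : 0 <= C / k%:R by rewrite divr_ge0 // ltW.
  have a0 : a 0 <= 0 by rewrite /a /= hx mul0r scale0r subrr normr0.
  suff step j : (j < k)%N -> a j.+1 <= (1 + L / k%:R) * a j + C / k%:R / k%:R.
    have := @gronwall R a k L _ 0 k0 L0 Ck (lexx _) a0 step k (leqnn k).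
    by rewrite /a divff ?gt_eqF // scale1r add0r mulrAC.
  move=> jk; have jk' := ltnW jk; rewrite {1}/a iterS.
  set y := iter j (estep F k) x; set y' := estep F k y.
  have yr : `|y| <= r by exact: Hr.
  have y'r : `|y'| <= r by have := Hr k j.+1 k0 jk; rewrite iterS.
  have yy : y' - y = k%:R^-1 *: F y by rewrite /y' /estep addrAC subrr add0r.
  have nyy : `|y' - y| <= k%:R^-1 * B.
    by rewrite yy normrZ ger0_norm // ler_wpM2l // HB.
  have nyy2 : `|y' - y| ^+ 2 <= B ^+ 2 / k%:R / k%:R.
    have -> : B ^+ 2 / k%:R / k%:R = (k%:R^-1 * B) ^+ 2 by rewrite !expr2; ring.
    by rewrite lerXn2r // nnegrE ?mulr_ge0.
  pose e1 := h y' - h y - 'D_(y' - y) h y.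
  pose e2 := w y' - w y - 'D_(y' - y) w y.
  have ne1 : `|e1| <= T1 * (B ^+ 2 / k%:R / k%:R).
    by apply: le_trans (HT1 y y' yr y'r) _; rewrite ler_wpM2l.
  have ne2 : `|e2| <= T2 * (B ^+ 2 / k%:R / k%:R).
    by apply: le_trans (HT2 y y' yr y'r) _; rewrite ler_wpM2l.
  have Dh : 'D_(y' - y) h y = k%:R^-1 *: 'D_(F y) h y.
    by have := derive_vlinear sh y (k%:R^-1) (F y) 0; rewrite yy addr0 derive0 addr0.
  have Dw : 'D_(y' - y) w y = k%:R^-1 *: 'D_(F y) w y.
    by have := derive_vlinear sw y (k%:R^-1) (F y) 0; rewrite yy addr0 derive0 addr0.
  have -> : h y' - (j.+1%:R / k%:R) *: w y' =
      (h y - (j%:R / k%:R) *: w y) +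
      k%:R^-1 *: ('D_(F y) h y - w y - (j%:R / k%:R) *: 'D_(F y) w y) +
      (e1 - (j.+1%:R / k%:R) *: e2 - (k%:R^-1 * k%:R^-1) *: 'D_(F y) w y).
    rewrite /e1 /e2 Dh Dw -natr1.
    move: (h y') (h y) (w y') (w y) ('D_(F y) h y) ('D_(F y) w y) => p1 p2 p3 p4 p5 p6.
    by apply/rowP => l; rewrite !mxE; ring.
  apply: le_trans (ler_normD _ _) _; apply: lerD.
    rewrite mulrDl mul1r; apply: le_trans (ler_normD _ _) _; rewrite lerD2l normrZ.
    rewrite ger0_norm // mulrAC mulrC ler_wpM2r //.
    exact: (H k j k0 jk').
  apply: le_trans (ler_normB _ _) _; apply: le_trans (lerD (ler_normB _ _) (lexx _)) _.
  have q2 : `|(j.+1%:R / k%:R) *: e2| <= T2 * (B ^+ 2 / k%:R / k%:R).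
    rewrite normrZ ger0_norm ?divr_ge0 ?ler0n //; apply: le_trans ne2.
    by rewrite ler_piMl // ler_pdivrMr // mul1r ler_nat.
  have q3 : `|(k%:R^-1 * k%:R^-1) *: 'D_(F y) w y| <= W * B / k%:R / k%:R.
    rewrite normrZ ger0_norm ?mulr_ge0 // -(mulrA (W * B)) mulrC ler_wpM2r ?mulr_ge0 //.
    by apply: le_trans (HW _ _ yr) _; rewrite ler_wpM2l // HB.
  have -> : C / k%:R / k%:R = T1 * (B ^+ 2 / k%:R / k%:R)
     + T2 * (B ^+ 2 / k%:R / k%:R) + W * B / k%:R / k%:R by rewrite /C; ring.
  exact: lerD (lerD ne1 q2) q3.
have [D [D0 HD]] := flow_spec `|x|.
have [L1 [L10 HL1]] := vball_lipschitz sh r.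
have [L2 [L20 HL2]] := vball_lipschitz sw r.
apply/eqP; rewrite -subr_eq0 -normr_le0.
apply: (@le_geo _ _ _ (C * expR L + (L1 + L2) * D)) => i; rewrite add0r.
have er : `|euler F i x| <= r by apply: Hr => //; rewrite expn_gt0.
have -> : h (flow F x) - w (flow F x) = (h (euler F i x) - w (euler F i x))
    - (h (euler F i x) - h (flow F x)) + (w (euler F i x) - w (flow F x)).
  by apply/rowP => l; rewrite !mxE; ring.
apply: le_trans (ler_normD _ _) _; apply: le_trans (lerD (ler_normB _ _) (lexx _)) _.
have h1 := HD i x (lexx _).
have h2 := HL1 _ _ fr er; have h3 := HL2 _ _ fr er.
have h4 := ler_wpM2l L10 h1; have h5 := ler_wpM2l L20 h1.
have := key (2 ^ i)%N; rewrite expn_gt0 => /(_ isT); rewrite natrX -/(euler F i x).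
have -> : (C * expR L + (L1 + L2) * D) / 2 ^+ i =
  C * expR L / 2 ^+ i + L1 * (D / 2 ^+ i) + L2 * (D / 2 ^+ i) by ring.
lra.
Qed.

End FlowLimit.

(** * Differentiability and smoothness of the flow *)

Section FlowSmooth.
Context {R : realType}.

Lemma diff_of_near (V W : normedModType R) (f : V -> W) (x : V) (l : {linear V -> W}) :
  continuous l ->
  (forall e, 0 < e -> \forall h \near (0 : V), `|f (h + x) - f x - l h| <= e * `|h|) ->
  differentiable f x /\ forall v, 'D_v f x = l v.
Proof.
move=> cl H; have E : f \o shift x = cst (f x) + l +o_ 0 id.
  apply/eqaddoP => e e0; apply: filterS (H e e0) => h.
  by rewrite !fctE /= opprD addrA.
have dE := diff_unique cl E.
have df : differentiable f x by apply/diff_locallyP; rewrite dE.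
by split=> // v; rewrite deriveE // dE.
Qed.

Lemma diff_of_quadratic n N (f : 'rV[R]_n -> 'rV[R]_N) (x : 'rV[R]_n) (A : 'M[R]_(n, N))
    (C : R) : 0 <= C ->
  (forall h : 'rV[R]_n, `|h| <= 1 -> `|f (h + x) - f x - h *m A| <= C * `|h| ^+ 2) ->
  differentiable f x /\ forall v, 'D_v f x = v *m A.
Proof.
move=> C0 H; apply: (@diff_of_near _ _ f x (mulmxr A)).
  move=> y; apply: (@smoothv_continuous _ _ _ setT) => //.
  by apply: (smoothv_mulmx A openT); exact: smoothv_id.
move=> e e0; have d0 : 0 < Num.min 1 (e / (C + 1)).
  by rewrite lt_min ltr01 divr_gt0 // ltr_wpDl.
apply/nbhs_normP; exists (Num.min 1 (e / (C + 1))) => // h /=.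
rewrite sub0r normrN lt_min => /andP[/ltW h1 /ltW h2].
apply: le_trans (H h h1) _; rewrite expr2 mulrA ler_wpM2r //.
move: h2; rewrite ler_pdivlMr ?ltr_wpDl // => h2; apply: le_trans h2.
by rewrite mulrC ler_wpM2l // lerDl.
Qed.

Lemma derive_vsum N m (F : 'rV[R]_N -> 'rV[R]_m) n (a : 'I_n -> R) (v : 'I_n -> 'rV[R]_N) x :
  smooth_onv setT F -> 'D_(\sum_l a l *: v l) F x = \sum_l a l *: 'D_(v l) F x.
Proof.
move=> sF; have dF z : differentiable F z by exact: smoothv_differentiable sF I.
by rewrite deriveE // linear_sum; apply: eq_bigr => l _; rewrite linearZ -deriveE.
Qed.

Section Tangent.
Context {N : nat}.
Variable F : 'rV[R]_N -> 'rV[R]_N.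
Local Notation T := (tangent_field F).

Lemma lsub_iter k j z : lsubmx (iter j (estep T k) z) = iter j (estep F k) (lsubmx z).
Proof.
elim: j => // j IH; rewrite !iterS -IH [in LHS]/estep linearD linearZ /=.
by rewrite [T _]/tangent_field row_mxKl.
Qed.

Lemma rsub_iterS k j z : rsubmx (iter j.+1 (estep T k) z) =
  rsubmx (iter j (estep T k) z) +
  k%:R^-1 *: 'D_(rsubmx (iter j (estep T k) z)) F (iter j (estep F k) (lsubmx z)).
Proof.
by rewrite iterS [in LHS]/estep linearD linearZ /= [T _]/tangent_field row_mxKr lsub_iter.
Qed.

Lemma lsub_flow z : lsubmx (flow T z) = flow F (lsubmx z).
Proof.
apply/rowP => j; rewrite !mxE; congr (lim (_ @ \oo)); apply/funext => i.
by rewrite /euler -lsub_iter mxE.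
Qed.

Hypotheses (sF : smooth_onv setT F).

Lemma smooth_tangent_field : smooth_onv setT T.
Proof.
have sl : smooth_onv setT (@lsubmx R 1 N N).
  by apply: (smoothv_lsub openT); exact: smoothv_id.
have sr : smooth_onv setT (@rsubmx R 1 N N).
  by apply: (smoothv_rsub openT); exact: smoothv_id.
apply: (smoothv_row_mx openT); first exact: (smoothv_comp openT (fun _ _ => I) sl sF).
move=> j; have dF z : differentiable F z by exact: smoothv_differentiable sF I.
have : smooth_on setT (fun z : 'rV[R]_(N + N) => \sum_l rsubmx z 0 l * 'D_(delta_mx 0 l) (fun y =>
  F y 0 j) (lsubmx z)).
  apply: smooth_sum => [|l _]; first exact: openT.
  apply: (smoothM openT); first exact: sr.
  exact: (smooth_comp openT (fun _ _ => I) sl (smooth_derive (delta_mx 0 l) (sF j))).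
move=> S; apply: (smooth_ext _ _ S) => [|z _]; first exact: openT.
rewrite derive_sum_coord // summxE; apply: eq_bigr => l _.
by rewrite [RHS]mxE -derive_rV.
Qed.

(** Along a fixed base trajectory a variational step is linear in the tangent vector. Linearity
    holds exactly for every polygon and passes to the limit, where it provides the matrix of the
    derivative. *)
Lemma linear_recursion (Z : nat -> 'rV[R]_N -> 'rV[R]_N) (a : R) (y : nat -> 'rV[R]_N) :
  (forall v, Z 0 v = v) -> (forall j v, Z j.+1 v = Z j v + a *: 'D_(Z j v) F (y j)) ->
  forall j v, Z j v = \sum_l v 0 l *: Z j (delta_mx 0 l).
Proof.
move=> Z0 ZS; elim=> [|j IH] v.
  by rewrite Z0 [LHS]row_sum_delta; apply: eq_bigr => l _; rewrite Z0.
rewrite [LHS]ZS (IH v) derive_vsum // scaler_sumr -big_split; apply: eq_bigr => l _ /=.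
by rewrite ZS scalerDr !scalerA [v 0 l * _]mulrC.
Qed.

Lemma rsub_iter_linear k j x v : rsubmx (iter j (estep T k) (row_mx x v)) =
  \sum_l v 0 l *: rsubmx (iter j (estep T k) (row_mx x (delta_mx 0 l))).
Proof.
apply: (linear_recursion (a := k%:R^-1) (y := fun j => iter j (estep F k) x)
  (Z := fun j v => rsubmx (iter j (estep T k) (row_mx x v)))).
  by move=> w; rewrite /= row_mxKr.
by move=> i w; rewrite rsub_iterS row_mxKl.
Qed.

Hypothesis stF : stable F.

(** The second half obeys a linear recursion whose coefficients are bounded along the base polygon,
    so it grows at most by the factor [expR L]. *)
Lemma stable_tangent_field : stable T.
Proof.
move=> r; have [r' Hr'] := stF r; have [L [L0 HL]] := vball_derive_bound sF r'.
exists (Num.max r' (r * expR L)) => k j z k0 jk zr.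
have kp : (0 : R) < k%:R by rewrite ltr0n.
rewrite -[iter _ _ _]hsubmxK; apply: norm_row_mx; rewrite le_max.
  by rewrite lsub_iter Hr' //; exact: le_trans (norm_lsub _) zr.
apply/orP; right; pose a j := `|rsubmx (iter j (estep T k) z)|.
have r0 : 0 <= r by exact: le_trans zr.
have a0 : a 0 <= r by exact: le_trans (norm_rsub _) zr.
suff step i : (i < k)%N -> a i.+1 <= (1 + L / k%:R) * a i + 0 / k%:R.
  have := @gronwall R a k L 0 r k0 L0 (lexx _) r0 a0 step j jk.
  by rewrite addr0.
move=> ik; rewrite mul0r addr0 /a rsub_iterS mulrDl mul1r.
apply: le_trans (ler_normD _ _) _; rewrite lerD2l normrZ ger0_norm ?invr_ge0 ?ler0n //.
rewrite mulrC mulrAC ler_wpM2r ?invr_ge0 ?ler0n //; apply: HL.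
by apply: Hr' => //; [exact: ltnW|exact: le_trans (norm_lsub _) zr].
Qed.

(** The difference of two polygons satisfies the variational recursion up to a Taylor remainder,
    quadratic in the initial distance by [iter_lipschitz]. The constant serves all [k], so the
    estimate survives the limit. *)
Lemma iter_taylor r : exists C, 0 <= C /\ forall k x y, (0 < k)%N ->
  `|x| <= r -> `|y| <= r ->
  `|iter k (estep F k) y - iter k (estep F k) x -
     rsubmx (iter k (estep T k) (row_mx x (y - x)))| <= C * `|y - x| ^+ 2.
Proof.
have [r' Hr'] := stF r.
have [C1 [C10 HC1]] := iter_lipschitz sF stF r.
have [L [L0 HL]] := vball_derive_bound sF r'.
have [T' [T0 HT]] := vball_taylor sF r'.
exists (T' * C1 ^+ 2 * expR L); split; first by rewrite !mulr_ge0 ?exprn_ge0 // expR_ge0.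
move=> k x y k0 xr yr.
have kp : (0 : R) < k%:R by rewrite ltr0n.
have ki : (0 : R) <= k%:R^-1 by rewrite invr_ge0 ltW.
pose X j := iter j (estep F k) x; pose Y j := iter j (estep F k) y.
pose Z j := rsubmx (iter j (estep T k) (row_mx x (y - x))).
pose a j := `|Y j - X j - Z j|.
have a0 : a 0 <= 0 by rewrite /a /X /Y /Z /= row_mxKr subrr normr0.
pose C := T' * (C1 * `|y - x|) ^+ 2.
have C0 : 0 <= C by rewrite mulr_ge0 // exprn_ge0 // mulr_ge0.
suff step j : (j < k)%N -> a j.+1 <= (1 + L / k%:R) * a j + C / k%:R.
  have := @gronwall R a k L C 0 k0 L0 C0 (lexx _) a0 step k (leqnn k).
  by rewrite add0r /a /C exprMn mulrA mulrAC.
move=> jk; have Xr : `|X j| <= r' by apply: Hr' => //; exact: ltnW.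
have Yr : `|Y j| <= r' by apply: Hr' => //; exact: ltnW.
have XS : X j.+1 = X j + k%:R^-1 *: F (X j) by [].
have YS : Y j.+1 = Y j + k%:R^-1 *: F (Y j) by [].
have ZS : Z j.+1 = Z j + k%:R^-1 *: 'D_(Z j) F (X j) by rewrite /Z rsub_iterS row_mxKl.
pose e := F (Y j) - F (X j) - 'D_(Y j - X j) F (X j).
have De : 'D_(Y j - X j - Z j) F (X j) = 'D_(Y j - X j) F (X j) - 'D_(Z j) F (X j).
  have := derive_vlinear sF (X j) (-1) (Z j) (Y j - X j).
  by rewrite !scaleN1r addrC => ->; rewrite addrC.
have E : Y j.+1 - X j.+1 - Z j.+1 = (Y j - X j - Z j) + k%:R^-1 *: 'D_(Y j - X j - Z j) F (X j)
    + k%:R^-1 *: e.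
  rewrite XS YS ZS De /e.
  move: (X j) (Y j) (Z j) (F (Y j)) (F (X j)) ('D_(Y j - X j) F (X j)) ('D_(Z j) F (X j)).
  by move=> p1 p2 p3 p4 p5 p6 p7; apply/rowP => l; rewrite !mxE; ring.
rewrite {1}/a E; apply: le_trans (ler_normD _ _) _; apply: lerD.
  rewrite mulrDl mul1r; apply: le_trans (ler_normD _ _) _; rewrite lerD2l normrZ.
  rewrite ger0_norm // mulrC mulrAC ler_wpM2r //.
  exact: HL.
rewrite normrZ ger0_norm // mulrC ler_wpM2r //.
apply: le_trans (HT _ _ Xr Yr) _; rewrite /C ler_wpM2l // lerXn2r ?nnegrE ?mulr_ge0 //.
by apply: HC1 => //; exact: ltnW.
Qed.

Let stT := stable_tangent_field.
Let sT := smooth_tangent_field.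

Lemma flow_derivable x : differentiable (flow F) x /\
  forall v, 'D_v (flow F) x = rsubmx (flow T (row_mx x v)).
Proof.
pose A := \matrix_(l < N) rsubmx (flow T (row_mx x (delta_mx 0 l))).
have AE v : v *m A = rsubmx (flow T (row_mx x v)).
  rewrite [LHS]mulmx_sum_row; under eq_bigr do rewrite rowK.
  apply/esym/eqP; rewrite -subr_eq0 -normr_le0.
  (* The radius covers all starting points involved: [x] paired with [v], and [x] paired with a unit
     coordinate vector, of norm at most 1. *)
  have [C [C0 HC]] := flow_spec sT stT (Num.max `|x| (Num.max `|v| 1)).
  apply: (@le_geo _ _ _ (C + \sum_l `|v 0 l| * C)) => i; rewrite add0r.
  have nr (w : 'rV[R]_N) : `|w| <= Num.max `|v| 1 ->
      `|row_mx x w| <= Num.max `|x| (Num.max `|v| 1).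
    by move=> hw; apply: norm_row_mx; rewrite le_max ?lexx // hw orbT.
  have E w : `|w| <= Num.max `|v| 1 ->
      `|rsubmx (flow T (row_mx x w)) - rsubmx (euler T i (row_mx x w))| <= C / 2 ^+ i.
    move=> hw; rewrite distrC -linearB.
    by apply: le_trans (norm_rsub _) _; apply: HC; exact: nr.
  have := rsub_iter_linear (2 ^ i) (2 ^ i) x v; rewrite -!/(euler T i _) => lin.
  have -> : rsubmx (flow T (row_mx x v)) -
      \sum_i0 v 0 i0 *: rsubmx (flow T (row_mx x (delta_mx 0 i0))) =
    (rsubmx (flow T (row_mx x v)) - rsubmx (euler T i (row_mx x v))) -
    \sum_l v 0 l *: (rsubmx (flow T (row_mx x (delta_mx 0 l))) -
       rsubmx (euler T i (row_mx x (delta_mx 0 l)))).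
    rewrite (eq_bigr _ (fun l _ => scalerBr _ _ _)) sumrB -[X in _ - (_ - X)]lin.
    by rewrite opprB addrA subrK.
  apply: le_trans (ler_normB _ _) _; rewrite mulrDl; apply: lerD.
    by apply: E; rewrite le_max lexx.
  apply: le_trans (ler_norm_sum _ _ _) _; rewrite mulr_suml; apply: ler_sum => l _.
  rewrite normrZ -mulrA ler_wpM2l // E // le_max; apply/orP; right.
  by apply: rV_norm_le => // j; rewrite mxE; case: eqP => _; case: eqP => _;
    rewrite ?normr1 ?normr0.
have [C [C0 HC]] := iter_taylor (`|x| + 1).
have [D [D0 HD]] := flow_spec sF stF (`|x| + 1).
suff H h : `|h| <= 1 -> `|flow F (h + x) - flow F x - h *m A| <= C * `|h| ^+ 2.
  by have [? dE] := diff_of_quadratic C0 H; split=> // v; rewrite dE AE.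
move=> h1; have xr : `|x| <= `|x| + 1 by rewrite lerDl.
have yr : `|h + x| <= `|x| + 1.
  by apply: le_trans (ler_normD _ _) _; rewrite addrC lerD2l.
have [D' [D'0 HD']] := flow_spec sT stT `|row_mx x h|.
apply: (@le_geo _ _ _ (D + D + D')) => i.
have := HC (2 ^ i)%N x (h + x); rewrite expn_gt0 addrK => /(_ isT xr yr).
rewrite -!/(euler _ i _) => q; have q1 := HD i _ xr; have q2 := HD i _ yr.
have q3 := HD' i _ (lexx _).
have {}q3 : `|rsubmx (euler T i (row_mx x h)) - rsubmx (flow T (row_mx x h))| <= D' / 2 ^+ i.
  by rewrite -linearB /=; exact: le_trans (norm_rsub _) q3.
rewrite AE.
have -> : flow F (h + x) - flow F x - rsubmx (flow T (row_mx x h)) =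
   (euler F i (h + x) - euler F i x - rsubmx (euler T i (row_mx x h))) -
   (euler F i (h + x) - flow F (h + x)) + (euler F i x - flow F x) +
   (rsubmx (euler T i (row_mx x h)) - rsubmx (flow T (row_mx x h))).
  move: (euler F i _) (euler F i _) (rsubmx (euler _ _ _)) (flow F _) (flow F _) (rsubmx (flow _
    _)).
  by move=> p1 p2 p3 p4 p5 p6; apply/rowP => l; rewrite !mxE; ring.
have -> : C * `|h| ^+ 2 + (D + D + D') / 2 ^+ i =
  C * `|h| ^+ 2 + D / 2 ^+ i + D / 2 ^+ i + D' / 2 ^+ i by ring.
apply: le_trans (ler_normD _ _) _; apply: (lerD _ q3).
apply: le_trans (ler_normD _ _) _; apply: (lerD _ q1).
by apply: le_trans (ler_normB _ _) _; apply: (lerD _ q2).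
Qed.

End Tangent.

(** Induction on the order over all dimensions at once: a directional derivative of the flow is part
    of the flow of [tangent_field F], in dimension [N + N], for which one order less is required. *)
Lemma smooth_flow N (F : 'rV[R]_N -> 'rV[R]_N) :
  smooth_onv setT F -> stable F -> smooth_onv setT (flow F).
Proof.
move=> sF stF j k; elim: k N F sF stF j => [|k IH] N F sF stF j.
  move=> x _; apply: (@continuous_comp _ _ _ (flow F) (fun y : 'rV[R]_N => y 0 j)).
    by have [/differentiable_continuous] := flow_derivable sF stF x.
  exact: coord_continuous.
have dflow x : differentiable (flow F) x by have [] := flow_derivable sF stF x.
split=> [x _|v].
  by apply: differentiable_comp (differentiable_coord _ _ _).
have H := IH _ _ (smooth_tangent_field sF) (stable_tangent_field sF stF) (rshift N j).
have srow : smooth_onv setT (fun x : 'rV[R]_N => row_mx x v).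
  by apply: (smoothv_row_mx openT); [exact: smoothv_id|exact: smoothv_cst].
have := Ck_comp openT (fun _ _ => I) (fun j => srow j k) H.
apply: Ck_ext; first exact: openT.
move=> x _ /=; rewrite -derive_rV //; have [_ ->] := flow_derivable sF stF x.
by rewrite [RHS]mxE.
Qed.

End FlowSmooth.

(** * Bump functions *)

Section Bump.
Context {R : realType}.

(* The powers [t ^- k] make the family of functions stable under differentiation. *)
Definition flat (k : nat) (t : R) : R := if 0 < t then t ^- k * expR (- t^-1) else 0.

Lemma flat_gt0 t : 0 < t -> 0 < flat 0 t.
Proof. by move=> t0; rewrite /flat t0 mulr_gt0 ?expR_gt0 // invr_gt0 exprn_gt0. Qed.

Lemma flat_le0 k t : t <= 0 -> flat k t = 0.
Proof. by rewrite /flat leNgt => /negbTE ->. Qed.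

(** From [(s / (k+2)) ^+ (k+2) <= expR s] at [s = 1/t]. Two powers of [t] remain beyond the [k] in
    the denominator, which forces derivative 0 at the origin. *)
Lemma flat_small k : exists C, 0 <= C /\ forall t, `|flat k t| <= C * t ^+ 2.
Proof.
exists ((k.+2)%:R ^+ k.+2); split; first by rewrite exprn_ge0.
move=> t; rewrite /flat; case: ifP => t0; last by rewrite normr0 mulr_ge0 ?sqr_ge0 ?exprn_ge0.
rewrite ger0_norm ?mulr_ge0 ?invr_ge0 ?exprn_ge0 ?expR_ge0 // ?(ltW t0) //.
have H : (t^-1 / k.+2%:R) ^+ k.+2 <= expR t^-1.
  have -> : expR t^-1 = expR (t^-1 / k.+2%:R) ^+ k.+2.
    by rewrite -expRM_natl mulrC divfK // pnatr_eq0.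
  rewrite lerXn2r ?nnegrE ?expR_ge0 ?divr_ge0 ?invr_ge0 ?(ltW t0) //.
  by apply: le_trans (expR_ge1Dx _); rewrite lerDr.
have {}H : expR (- t^-1) <= (k.+2%:R * t) ^+ k.+2.
  rewrite expRN; apply: le_trans (_ : ((t^-1 / k.+2%:R) ^+ k.+2)^-1 <= _).
    by rewrite lef_pV2 ?posrE ?expR_gt0 ?exprn_gt0 ?divr_gt0 ?invr_gt0.
  by rewrite -exprVn invfM !invrK mulrC.
apply: le_trans (ler_wpM2l _ H) _; first by rewrite invr_ge0 exprn_ge0 // ltW.
rewrite exprMn mulrCA ler_wpM2l ?exprn_ge0 //.
by rewrite -(addn2 k) exprD mulrA mulVf ?mul1r // expf_neq0 // gt_eqF.
Qed.

Lemma flat_is_derive k (t : R) : is_derive t 1 (flat k) (flat k.+2 t - k%:R * flat k.+1 t).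
Proof.
have [t0|t0|t0] := ltrgtP t 0.
- have n0 : \near t, cst 0 t = flat k t.
    near=> s; rewrite flat_le0 //; apply/ltW; near: s; exact: lt_nbhsl.
  apply: near_eq_is_derive n0 _.
  by rewrite !flat_le0 ?ltW // mulr0 subr0; exact: is_derive_cst.
- have tn0 : t != 0 by rewrite gt_eqF.
  pose p : R -> R := (fun t => t^-1) ^+ k * (expR \o (fun t => - t^-1)).
  have np : \near t, p t = flat k t.
    near=> s; rewrite /flat ifT; last by near: s; exact: lt_nbhsr.
    by rewrite /p !fctE -exprVn; congr (_ * _); elim: (k) => [|j IH]; rewrite ?expr0 // !exprS -IH.
  apply: near_eq_is_derive np _.
  have dV := is_deriveV tn0 (is_derive_id t (1 : R)).
  have dE : is_derive t (1 : R) (expR \o (fun t => - t^-1)) (expR (- t^-1) * t ^- 2).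
    have dN : is_derive t (1 : R) (fun t : R => - t^-1) (t ^- 2).
      apply: is_derive_eq (is_deriveN dV) _.
      by rewrite scaleNr opprK [LHS]mulr1.
    by apply: is_derive_eq (is_derive1_comp (is_derive_expR _) dN) _.
  apply: is_derive_eq (is_deriveM (is_deriveX k dV) dE) _.
  rewrite /flat t0 !fctE /= scaleNr; move: (expR _) => e.
  rewrite /GRing.scale /= -!exprVn mulr1; move: (t^-1) => u.
  by case: k {p} => [|j] /=; rewrite !exprS; ring.
- have [C [C0 HC]] := flat_small k.
  rewrite !flat_le0 ?t0 // mulr0 subr0.
  have d0 h : 'd (cst 0 : R^o -> R^o) (0 : R^o) h = 0 by rewrite diff_cst.
  have [||df dE] := @diff_of_near R R^o R^o (flat k) 0 ('d (cst 0 : R^o -> R^o) (0 : R^o)).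
  - by apply: diff_continuous; exact: differentiable_cst.
  - move=> e e0; apply/nbhs_normP; exists (e / (C + 1)) => [|h /=].
      by rewrite /= divr_gt0 // ltr_wpDl.
    rewrite sub0r normrN ltr_pdivlMr ?ltr_wpDl // => /ltW he.
    rewrite addr0 (flat_le0 _ (lexx 0)) d0 !subr0; apply: le_trans (HC h) _.
    rewrite -real_normK ?num_real // expr2 mulrA ler_wpM2r //; apply: le_trans he.
    by rewrite mulrC ler_wpM2l // lerDl.
  - by apply: DeriveDef; [exact/derivable1_diffP|rewrite dE d0].
Unshelve. all: by end_near. Qed.


Section Compose.
Variable V : normedModType R.
Implicit Types (U : set V) (f : V -> R).

Lemma Ck_flat n U k f : open U -> Ck n U f -> Ck n U (fun x => flat k (f x)).
Proof.
move=> oU; have dflat j t : differentiable (flat j : R^o -> R^o) t.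
  by apply/derivable1_diffP; case: (flat_is_derive j t).
elim: n k f => [|n IH] k f.
  move=> cf x Ux; apply: (@continuous_comp _ _ _ f (flat k)); first exact: cf.
  by apply: differentiable_continuous; exact: dflat.
move=> Cf; have [df Df] := Cf; split=> [x Ux|v].
  by apply: (@differentiable_comp _ _ _ _ f (flat k : R^o -> R^o)); [exact: df|exact: dflat].
have C1 := IH k.+2 f (CkW Cf); have C2 := IH k.+1 f (CkW Cf).
have := CkM oU (CkD oU C1 (CkM oU (Ck_cst n U (- k%:R)) C2)) (Df v).
apply: Ck_ext => // x Ux.
rewrite [RHS]deriveE; last first.
  by apply: (@differentiable_comp _ _ _ _ f (flat k : R^o -> R^o)); [exact: df|exact: dflat].
have -> : 'd (fun x => flat k (f x)) x = 'd (flat k : R^o -> R^o) (f x) \o 'd f x :> (V -> R).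
  by apply: (@diff_comp _ _ _ _ f (flat k : R^o -> R^o)); [exact: df|exact: dflat].
rewrite /= -(deriveE v (df x Ux)).
rewrite deriv1E; last by case: (flat_is_derive k (f x)).
have -> : derive1 (flat k) (f x) = flat k.+2 (f x) - k%:R * flat k.+1 (f x).
  by rewrite derive1E; case: (flat_is_derive k (f x)).
by rewrite !fctE /GRing.scale /= mulNr [RHS]mulrC.
Qed.

(** The usual smooth step from 0 to 1; the denominator is positive because [t] and [1 - t] are never
    both nonpositive. *)
Definition ramp (t : R) := flat 0 t / (flat 0 t + flat 0 (1 - t)).

Lemma ramp_den t : 0 < flat 0 t + flat 0 (1 - t).
Proof.
have p s : 0 <= flat 0 s.
  by have [s0|s0] := lerP s 0; [rewrite flat_le0|rewrite ltW // flat_gt0].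
have [t0|t0] := lerP t 0; last by rewrite ltr_wpDr // flat_gt0.
by rewrite ltr_wpDl // flat_gt0 // subr_gt0 (le_lt_trans t0).
Qed.

Lemma ramp_le0 t : t <= 0 -> ramp t = 0.
Proof. by move=> t0; rewrite /ramp flat_le0 // mul0r. Qed.

Lemma ramp_ge1 t : 1 <= t -> ramp t = 1.
Proof.
move=> t1; have := ramp_den t; rewrite /ramp [flat 0 (1 - t)]flat_le0 ?subr_le0 // addr0.
by move=> /gt_eqF h; rewrite divff // h.
Qed.

Lemma smooth_ramp U f : open U -> smooth_on U f -> smooth_on U (fun x => ramp (f x)).
Proof.
move=> oU sf; have s1 : smooth_on U (fun x => flat 0 (f x)).
  by move=> k; apply: Ck_flat => //; exact: sf.
have s2 : smooth_on U (fun x => flat 0 (1 - f x)).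
  by move=> k; apply: Ck_flat => //; exact: (smoothB oU (smooth_cst U 1) sf k).
apply: smoothM => //; apply: smooth_inv => //; last exact: smoothD.
by move=> x _; rewrite gt_eqF // ramp_den.
Qed.

End Compose.

Lemma bump_rV n (x0 : 'rV[R]_n) (U : set 'rV[R]_n) : open U -> U x0 ->
  exists (b : 'rV[R]_n -> R) (r : R), [/\ smooth_on setT b, \near x0, b x0 = 1,
    forall x, `|x - x0| <= r -> U x & forall x, r < `|x - x0| -> b x = 0].
Proof.
move=> oU Ux0; have /nbhs_normP[e /= e0 eU] := open_near oU Ux0.
pose r := e / 2; have r0 : 0 < r by rewrite divr_gt0.
(* The norm of ['rV] is a maximum, hence not smooth; the squared Euclidean distance replaces it. The
   argument [2 - 4 q / r ^+ 2] of [ramp] is at least 1 for [q <= r ^+ 2 / 4] and negative for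
   [q >= r ^+ 2]. *)
pose q (x : 'rV[R]_n) := \sum_i (x 0 i - x0 0 i) ^+ 2.
have sq : smooth_on setT q.
  apply: smooth_sum => [|i _]; first exact: openT.
  have h : smooth_on setT (fun x : 'rV[R]_n => x 0 i - x0 0 i).
    by apply: smoothB; [exact: openT|exact: smoothv_id|exact: smooth_cst].
  apply: smooth_ext (smoothM openT h h) => [|x _]; first exact: openT.
  by rewrite expr2.
have sb : smooth_on setT (fun x => 2 - 4 / r ^+ 2 * q x).
  apply: smoothB; [exact: openT|exact: smooth_cst|].
  by apply: smoothM; [exact: openT|exact: smooth_cst|].
exists (fun x => ramp (2 - 4 / r ^+ 2 * q x)), r; split.
- by apply: smooth_ramp; first exact: openT.
- have cq : {for x0, continuous q} by exact: smooth_continuous sq I.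
  have q0 : q x0 = 0 by apply: big1 => i _; rewrite subrr expr0n.
  have : \near x0, q x0 < r ^+ 2 / 4.
    apply: (cq [set y | y < r ^+ 2 / 4]); apply: open_nbhs_nbhs; split; first exact: open_lt.
    by rewrite /= q0 divr_gt0 // exprn_gt0.
  apply: filterS => x qx; apply: ramp_ge1.
  have : 4 / r ^+ 2 * q x <= 4 / r ^+ 2 * (r ^+ 2 / 4).
    by rewrite ler_wpM2l ?(ltW qx) // divr_ge0 // exprn_ge0 // ltW.
  rewrite mulrA divfK ?expf_neq0 ?gt_eqF // divff ?pnatr_eq0 //; lra.
- move=> x xr; apply: eU => /=; rewrite distrC (le_lt_trans xr) // /r; lra.
- move=> x rx; apply: ramp_le0; have : r ^+ 2 <= q x.
    have [i Hi] : exists i, r < `|(x - x0) 0 i|.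
      apply: contrapT => /forallNP H; have : `|x - x0| <= r.
        apply: rV_norm_le => [|i]; first exact: ltW.
        by rewrite leNgt; apply/negP; exact: H.
      by rewrite leNgt rx.
    rewrite /q (bigD1 i) //= ler_wpDr //; first by apply: sumr_ge0 => j _; exact: sqr_ge0.
    by rewrite -[leRHS]real_normK ?num_real // lerXn2r ?nnegrE ?(ltW r0) // (le_trans (ltW Hi)) //
      !mxE.
  move=> rq; have : 4 / r ^+ 2 * r ^+ 2 <= 4 / r ^+ 2 * q x.
    by rewrite ler_wpM2l // divr_ge0 // exprn_ge0 // ltW.
  rewrite divfK ?expf_neq0 ?gt_eqF //; lra.
Qed.

(** The product with a bump function. The bound matters as much as the extension: polygons of a
    bounded field cannot escape in unit time. *)
Lemma smooth_extend n (x0 : 'rV[R]_n) (U : set 'rV[R]_n) (f : 'rV[R]_n -> R) :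
  open U -> U x0 -> smooth_on U f ->
  exists f' C, [/\ smooth_on setT f', \near x0, f' x0 = f x0 & forall x, `|f' x| <= C].
Proof.
move=> oU Ux0 sf; have [b [r [sb b1 rU b0]]] := bump_rV oU Ux0.
pose f' x := b x * f x.
have sf' : smooth_on setT f'.
  apply: smooth_local => x _; have [xr|xr] := lerP `|x - x0| r.
    exists U; first exact: rU.
    by apply: smoothM => //; exact: smooth_sub sb.
  pose W := [set x : 'rV[R]_n | r < `|x - x0|].
  have oW : open W.
    apply: (@open_comp _ _ (fun x : 'rV[R]_n => `|x - x0|) [set y | r < y]); last exact: open_gt.
    move=> y _; apply: continuous_comp; last exact: norm_continuous.
    exact: (smoothv_continuous (smoothvD openT (smoothv_id _) (smoothv_cst _ (- x0))) I).
  exists W => //; apply: smooth_ext (smooth_cst W 0) => // y Wy.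
  by rewrite /f' b0 // mul0r.
have [C [C0 HC]] : exists C, 0 <= C /\ forall x, `|x| <= r + `|x0| -> `|f' x| <= C.
  by apply: ball_bound => x; exact: smooth_continuous sf' I.
exists f', C; split=> // [|x]; first by apply: filterS b1 => x bx; rewrite /f' bx mul1r.
have [xr|xr] := lerP `|x - x0| r; last by rewrite /f' b0 // mul0r normr0.
by apply: HC; rewrite -[x](subrK x0) (le_trans (ler_normD _ _)) // lerD2r.
Qed.

Lemma smooth_extendv n N (x0 : 'rV[R]_n) (U : set 'rV[R]_n) (f : 'rV[R]_n -> 'rV[R]_N) :
  open U -> U x0 -> smooth_onv U f ->
  exists f' C, [/\ smooth_onv setT f', \near x0, f' x0 = f x0 & 0 <= C /\ forall x, `|f' x| <= C].
Proof.
move=> oU Ux0 sf; have /choice[f' Hf'] j := smooth_extend oU Ux0 (sf j).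
have /choice[C HC] := Hf'; exists (fun x => \row_j f' j x), (\sum_j `|C j|).
have C0 : 0 <= \sum_j `|C j| by exact: sumr_ge0.
split; first by move=> j; have [s _ _] := HC j; apply: (smooth_ext openT _ s) => x _; rewrite mxE.
  have H j : \near x0, f' j x0 = f x0 0 j by have [_ + _] := HC j.
  have {}H := @filter_forall _ _ _ (nbhs x0) (nbhs_filter (x0 : 'rV[R]_n)) H.
  by apply: filterS H => x H; apply/rowP => j; rewrite mxE H.
split=> // x; apply: rV_norm_le => // j; rewrite mxE; have [_ _ /(_ x) H] := HC j.
apply: le_trans H _; apply: le_trans (ler_norm _) _.
by rewrite (bigD1 j) //= lerDl sumr_ge0.
Qed.

End Bump.

(** * Transport along families of vector fields *)

Section ChainRule.
Context {R : realType}.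

Lemma derive_comp (V W Z : normedModType R) (t : V -> W) (f : W -> Z) x v :
  differentiable t x -> differentiable f (t x) ->
  'D_v (fun y => f (t y)) x = 'D_('D_v t x) f (t x).
Proof.
move=> dt df; have E := @diff_comp _ _ _ _ t f x dt df.
rewrite (deriveE v dt) (deriveE _ df) deriveE; first by rewrite E.
exact: (@differentiable_comp _ _ _ _ t f).
Qed.

Lemma derive_rsubmx (V : normedModType R) n m (t : V -> 'rV[R]_(n + m)) x v :
  differentiable t x -> 'D_v (fun y => rsubmx (t y)) x = rsubmx ('D_v t x).
Proof.
move=> dt.
have cr : continuous (rsubmx : {linear 'rV[R]_(n + m) -> 'rV[R]_m}) by exact: continuous_rsubmx.
exact: (derive_lin_comp v cr dt).
Qed.

Lemma derive_lsubmx (V : normedModType R) n m (t : V -> 'rV[R]_(n + m)) x v :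
  differentiable t x -> 'D_v (fun y => lsubmx (t y)) x = lsubmx ('D_v t x).
Proof.
move=> dt.
have cr : continuous (lsubmx : {linear 'rV[R]_(n + m) -> 'rV[R]_n}) by exact: continuous_lsubmx.
exact: (derive_lin_comp v cr dt).
Qed.

Lemma derive_row_mx (V : normedModType R) n m (s : V -> 'rV[R]_n) (t : V -> 'rV[R]_m) x v :
  differentiable s x -> differentiable t x ->
  'D_v (fun y => row_mx (s y) (t y)) x = row_mx ('D_v s x) ('D_v t x).
Proof.
move=> ds dt; have drow : differentiable (fun y => row_mx (s y) (t y)) x.
  apply: differentiable_rV => j; rewrite -(splitK j); case: (fintype.split j) => i /=.
    rewrite (_ : (fun y => _) = (fun w : 'rV[R]_n => w 0 i) \o s).
      by apply: differentiable_comp => //; exact: differentiable_coord.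
    by apply/funext => y; rewrite row_mxEl.
  rewrite (_ : (fun y => _) = (fun w : 'rV[R]_m => w 0 i) \o t).
    by apply: differentiable_comp => //; exact: differentiable_coord.
  by apply/funext => y; rewrite row_mxEr.
rewrite -[LHS]hsubmxK -(derive_lsubmx v drow) -(derive_rsubmx v drow).
congr (row_mx ('D_v _ x) ('D_v _ x)); apply/funext => y; first exact: row_mxKl.
exact: row_mxKr.
Qed.

Lemma derive_idE (V : normedModType R) (x v : V) : 'D_v (fun y : V => y) x = v.
Proof. exact: derive_id. Qed.

End ChainRule.

Section FieldFlow.
Context {R : realType} {n m : nat}.
Variable X : 'I_n -> 'rV[R]_m -> 'rV[R]_m.
Variable C : R.
Hypotheses (sX : forall l, smooth_onv setT (X l)) (C0 : 0 <= C)
  (bX : forall l y, `|X l y| <= C).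

Definition comb (b : 'rV[R]_n) (y : 'rV[R]_m) := \sum_l b 0 l *: X l y.

Definition comb_field (z : 'rV[R]_(n + m)) : 'rV[R]_(n + m) :=
  row_mx 0 (comb (lsubmx z) (rsubmx z)).

(* [b] is carried along as a constant coordinate, for joint smoothness in [(b, y)]. *)
Definition transport (b : 'rV[R]_n) (y : 'rV[R]_m) : 'rV[R]_m :=
  rsubmx (flow comb_field (row_mx b y)).

Local Notation F := comb_field.
Local Notation K := (n%:R * C).

Lemma comb_bound b y : `|comb b y| <= K * `|b|.
Proof.
apply: le_trans (ler_norm_sum _ _ _) _.
apply: le_trans (_ : \sum_(l < n) C * `|b| <= _).
  apply: ler_sum => l _; rewrite normrZ mulrC; apply: ler_pM => //.
  exact: rV_coord_le.
by rewrite sumr_const card_ord -[leLHS]mulr_natl mulrA.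
Qed.

Lemma comb_delta l y : comb (delta_mx 0 l) y = X l y.
Proof.
rewrite /comb (bigD1 l) //= mxE !eqxx scale1r big1 ?addr0 // => i il.
by rewrite mxE (negbTE il) andbF scale0r.
Qed.

Lemma smooth_comb_field : smooth_onv setT F.
Proof.
apply: (smoothv_row_mx openT); first exact: smoothv_cst.
move=> j; have sl : smooth_onv setT (fun z : 'rV[R]_(n + m) => lsubmx z).
  by apply: (smoothv_lsub openT); exact: smoothv_id.
have sr : smooth_onv setT (fun z : 'rV[R]_(n + m) => rsubmx z).
  by apply: (smoothv_rsub openT); exact: smoothv_id.
have S : smooth_on setT (fun z : 'rV[R]_(n + m) => \sum_l lsubmx z 0 l * X l (rsubmx z) 0 j).
  apply: smooth_sum => [|l _]; first exact: openT.
  by apply: smoothM; [exact: openT|exact: sl|exact: (smooth_comp openT (fun _ _ => I) sr (sX l j))].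
apply: (smooth_ext openT _ S) => z _; rewrite /comb summxE.
by apply: eq_bigr => l _; rewrite [RHS]mxE.
Qed.

Lemma lsub_iter_field k j z : lsubmx (iter j (estep F k) z) = lsubmx z.
Proof.
elim: j => // j IH; rewrite iterS [in LHS]/estep linearD linearZ /= IH.
by rewrite [F _]/comb_field row_mxKl scaler0 addr0.
Qed.

Lemma rsub_iter_fieldS k j z : rsubmx (iter j.+1 (estep F k) z) =
  rsubmx (iter j (estep F k) z) + k%:R^-1 *: comb (lsubmx z) (rsubmx (iter j (estep F k) z)).
Proof.
by rewrite iterS [in LHS]/estep linearD linearZ /= [F _]/comb_field row_mxKr lsub_iter_field.
Qed.

(** The speed is at most [K * |b|]. As this is proportional to [b], transport with small
    coefficients never leaves the region where a cut-off field agrees with the original one. *)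
Lemma rsub_iter_field k j z : (0 < k)%N -> (j <= k)%N ->
  `|rsubmx (iter j (estep F k) z) - rsubmx z| <= K * `|lsubmx z|.
Proof.
move=> k0 jk; have kp : (0 : R) < k%:R by rewrite ltr0n.
have K0 : 0 <= K * `|lsubmx z| by rewrite !mulr_ge0.
have : `|rsubmx (iter j (estep F k) z) - rsubmx z| <= j%:R / k%:R * (K * `|lsubmx z|).
  elim: j {jk} => [|j IH]; first by rewrite subrr normr0 mul0r mul0r.
  rewrite rsub_iter_fieldS addrAC -natr1 mulrDl mulrDl.
  apply: le_trans (ler_normD _ _) (lerD IH _).
  by rewrite normrZ ger0_norm ?invr_ge0 ?ler0n // mul1r ler_wpM2l ?invr_ge0 ?ler0n // comb_bound.
move/le_trans; apply; rewrite ler_piMl // ler_pdivrMr // mul1r ler_nat //.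
Qed.

Lemma stable_comb_field : stable F.
Proof.
move=> r; exists (r + K * r) => k j z k0 jk zr.
have r0 : 0 <= r by exact: le_trans zr.
have Kr : 0 <= K * r by rewrite !mulr_ge0.
rewrite -[iter _ _ _]hsubmxK; apply: norm_row_mx.
  by rewrite lsub_iter_field (le_trans (norm_lsub _)) // (le_trans zr) // lerDl.
rewrite -[rsubmx _](subrK (rsubmx z)) addrC; apply: le_trans (ler_normD _ _) _.
apply: lerD; first exact: le_trans (norm_rsub _) zr.
apply: le_trans (rsub_iter_field z k0 jk) _.
by rewrite ler_wpM2l ?mulr_ge0 // (le_trans (norm_lsub _)).
Qed.

Let sF := smooth_comb_field.
Let stF := stable_comb_field.

Lemma smooth_transport : smooth_onv setT (fun z : 'rV[R]_(n +
  m) => transport (lsubmx z) (rsubmx z)).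
Proof.
have -> : (fun z : 'rV[R]_(n + m) => transport (lsubmx z) (rsubmx z)) = (fun z => rsubmx (flow F
  z)).
  by apply/funext => z; rewrite /transport hsubmxK.
exact: smoothv_rsub openT (smooth_flow sF stF).
Qed.

Lemma transport_bound b y : `|transport b y - y| <= K * `|b|.
Proof.
have [D [D0 HD]] := flow_spec sF stF `|row_mx b y|.
apply: (@le_geo _ _ _ D) => i; have := HD i _ (lexx _) => H.
have {}H : `|rsubmx (euler F i (row_mx b y)) - transport b y| <= D / 2 ^+ i.
  by rewrite /transport -linearB; exact: le_trans (norm_rsub _) H.
have := @rsub_iter_field (2 ^ i) (2 ^ i) (row_mx b y).
rewrite expn_gt0 row_mxKl row_mxKr => /(_ isT (leqnn _)) H2.
have -> : transport b y - y = (rsubmx (euler F i (row_mx b y)) - y) -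
   (rsubmx (euler F i (row_mx b y)) - transport b y).
  by rewrite opprB [RHS]addrC subrKA.
by apply: le_trans (ler_normB _ _) _; apply: lerD.
Qed.

Lemma transport0 y : transport 0 y = y.
Proof.
by apply/eqP; rewrite -subr_eq0 -normr_le0; have := transport_bound 0 y; rewrite normr0 mulr0.
Qed.

Lemma derive_rsub (W : normedModType R) d (h : 'rV[R]_m -> 'rV[R]_d) (t : W -> 'rV[R]_(n + m)) x v :
  differentiable t x -> differentiable h (rsubmx (t x)) ->
  'D_v (fun z => h (rsubmx (t z))) x = 'D_(rsubmx ('D_v t x)) h (rsubmx (t x)).
Proof.
move=> dt dh; have dr : differentiable (fun z => rsubmx (t z)) x.
  apply: (@differentiable_comp _ _ _ _ t rsubmx) => //.
  by apply: linear_differentiable; exact: continuous_rsubmx.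
by rewrite (derive_comp (f := h) v dr dh) derive_rsubmx.
Qed.

(** The case of [flow_compare] with constant [w] and [L = 0]: [h] advances with constant velocity
    [c]. The hypothesis is confined to the ball that polygons can reach, so identities valid only
    locally can be fed in. *)
Lemma transport_integral d (h : 'rV[R]_m -> 'rV[R]_d) b y c :
  smooth_onv setT h ->
  (forall y', `|y' - y| <= K * `|b| -> 'D_(comb b y') h y' = c) ->
  h (transport b y) = h y + c.
Proof.
move=> sh H; pose h' (z : 'rV[R]_(n + m)) := h (rsubmx z) - h y.
have sr : smooth_onv setT (fun z : 'rV[R]_(n + m) => rsubmx z).
  by apply: (smoothv_rsub openT); exact: smoothv_id.
have s1 : smooth_onv setT (fun z : 'rV[R]_(n + m) => h (rsubmx z)).
  exact: (smoothv_comp openT (fun _ _ => I) sr sh).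
have sh' : smooth_onv setT h'.
  by apply: (smoothvD openT) => //; exact: smoothv_cst.
have E : h' (flow F (row_mx b y)) = c.
  apply: (@flow_compare _ _ F sF stF _ h' (cst c) 0) => //.
  - exact: smoothv_cst.
  - by rewrite /h' row_mxKr subrr.
  - move=> k j k0 jk /=; set z := iter j _ _; rewrite mul0r derive_cst scaler0 subr0.
    have -> : 'D_(F z) h' z = 'D_(comb b (rsubmx z)) h (rsubmx z).
      rewrite /h' deriveB; last 2 first.
      - exact/diff_derivable/(smoothv_differentiable s1 I).
      - exact: derivable_cst.
      rewrite derive_cst subr0.
      have di : differentiable (fun y : 'rV[R]_(n + m) => y) z by [].
      have := @derive_rsub _ _ h (fun y => y) z (F z) di (smoothv_differentiable sh I).
      by move=> ->; rewrite derive_idE [F z]/comb_field row_mxKr lsub_iter_field row_mxKl.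
    rewrite H ?subrr ?normr0 //.
    have := @rsub_iter_field k j (row_mx b y) k0 jk; rewrite row_mxKl row_mxKr; exact.
by rewrite -E /h' addrCA subrr addr0.
Qed.

End FieldFlow.

(** * Transport along commuting fields *)

Section Commuting.
Context {R : realType} {n m : nat}.
Variable X : 'I_n -> 'rV[R]_m -> 'rV[R]_m.
Variable C : R.
Hypotheses (sX : forall l, smooth_onv setT (X l)) (C0 : 0 <= C)
  (bX : forall l y, `|X l y| <= C).

Local Notation F := (comb_field X).
Local Notation P := (transport X).
Local Notation K := (n%:R * C).
Let sF := smooth_comb_field sX.
Let stF := stable_comb_field C0 bX.

Lemma derive_comb_field z v : 'D_v F z = row_mx 0
  (\sum_l (lsubmx v 0 l *: X l (rsubmx z) + lsubmx z 0 l *: 'D_(rsubmx v) (X l) (rsubmx z))).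
Proof.
have dF : differentiable F z by exact: smoothv_differentiable sF I.
have dX l y : differentiable (X l) y by exact: smoothv_differentiable (sX l) I.
apply/rowP => j; rewrite derive_rV // -(splitK j); case: (fintype.split j) => i /=.
  rewrite row_mxEl mxE (_ : (fun y => _) = cst 0) ?derive_cst //.
  by apply/funext => y; rewrite /comb_field row_mxEl mxE.
rewrite row_mxEr summxE.
have -> : (fun y => F y 0 (rshift n i)) =
    \sum_l ((fun y : 'rV[R]_(n + m) => y 0 (lshift m l)) * (fun y => X l (rsubmx y) 0 i)).
  apply/funext => y; rewrite /comb_field row_mxEr /comb summxE fct_sumE.
  by apply: eq_bigr => l _; rewrite mxE mxE.
have d1 l y : differentiable (fun y : 'rV[R]_(n +
  m) => y 0 (lshift m l)) y by exact: differentiable_coord.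
have d2 l y : differentiable (fun y : 'rV[R]_(n + m) => X l (rsubmx y)) y.
  apply: (@differentiable_comp _ _ _ _ rsubmx (X l)) => //.
  by apply: linear_differentiable; exact: continuous_rsubmx.
have d3 l y : differentiable (fun y : 'rV[R]_(n + m) => X l (rsubmx y) 0 i) y.
  exact: (@differentiable_comp _ _ _ _ (fun y : 'rV[R]_(n + m) => X l (rsubmx y)) (fun w :
    'rV[R]_m => w 0 i) _ (d2 l y) (differentiable_coord _ _ _)).
rewrite derive_sum; last by move=> l; apply: derivableM; exact: diff_derivable.
apply: eq_bigr => l _; rewrite deriveM; [|exact: diff_derivable..].
have lin2 a c (u w : 'rV[R]_m) : (a *: u + c *: w) 0 i = a * u 0 i + c * w 0 i by rewrite !mxE.
rewrite lin2.
rewrite -(derive_rV _ _ (d2 l z)) (@derive_rsub _ _ _ _ _ (X l) (fun y => y)) // derive_idE.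
have -> : 'D_v (fun y : 'rV[R]_(n + m) => y 0 (lshift m l)) z = v 0 (lshift m l).
  by rewrite -(@derive_rV _ _ _ (fun y => y)) // derive_idE.
by rewrite !mxE addrC; congr (_ + _); rewrite /GRing.scale /= mulrC.
Qed.

(* Along the polygon the variation [xi] of the endpoint in the direction of the [i]-th
   coordinate of [b] is compared with [t X_i]: both solve the same linear equation. *)
Lemma transport_derive b y i :
  (forall y', `|y' - y| <= K * `|b| -> forall l,
    'D_(X l y') (X i) y' = 'D_(X i y') (X l) y') ->
  'D_(delta_mx 0 i) (fun b => P b y) b = X i (P b y).
Proof.
move=> comm; set z := row_mx b y; set v := row_mx (delta_mx 0 i) 0 : 'rV[R]_(n + m).
have df x : differentiable (flow F) x by have [] := flow_derivable sF stF x.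
have -> : 'D_(delta_mx 0 i) (fun b => P b y) b = rsubmx ('D_v (flow F) z).
  have dt : differentiable (fun b : 'rV[R]_n => row_mx b y) b.
    apply: (@smoothv_differentiable _ _ _ setT) => //.
    by apply: (smoothv_row_mx openT); [exact: smoothv_id|exact: smoothv_cst].
  have dft : differentiable (fun b => flow F (row_mx b y)) b.
    exact: (@differentiable_comp _ _ _ _ (fun b : 'rV[R]_n => row_mx b y) (flow F)).
  rewrite (derive_rsubmx _ dft) (derive_comp (f := flow F) _ dt (df _));
    congr (rsubmx ('D_(_) _ _)).
  by rewrite (@derive_row_mx _ _ _ _ (fun y => y) (fun=> y)) // derive_idE derive_cst.
have [_ ->] := flow_derivable sF stF z; set T := tangent_field F.
have sT : smooth_onv setT T := smooth_tangent_field sF.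
have stT : stable T := stable_tangent_field sF stF.
(* A point [Z] holds [(b, y)] and then a variation of each; [h] reads the variation of [y], and [w]
   the field [X i] at the current [y]. *)
pose h (Z : 'rV[R]_(n + m + (n + m))) := rsubmx (rsubmx Z).
pose w (Z : 'rV[R]_(n + m + (n + m))) := X i (rsubmx (lsubmx Z)).
have sr : smooth_onv setT (fun Z : 'rV[R]_(n + m + (n + m)) => rsubmx Z).
  by apply: (smoothv_rsub openT); exact: smoothv_id.
have sl : smooth_onv setT (fun Z : 'rV[R]_(n + m + (n + m)) => lsubmx Z).
  by apply: (smoothv_lsub openT); exact: smoothv_id.
have sh : smooth_onv setT h by apply: (smoothv_rsub openT).
have srl : smooth_onv setT (fun Z : 'rV[R]_(n + m + (n + m)) => rsubmx (lsubmx Z)).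
  by apply: (smoothv_rsub openT).
have sw : smooth_onv setT w by exact: (smoothv_comp openT (fun _ _ => I) srl (sX i)).
have [L0 [L00 HL0]] : exists L, 0 <= L /\ forall l x u, `|x| <= `|y| + K * `|b| ->
    `|'D_u (X l) x| <= L * `|u|.
  have /choice[L HL] l := vball_derive_bound (sX l) (`|y| + K * `|b|).
  exists (\sum_l L l); split; first by apply: sumr_ge0 => l _; case: (HL l).
  move=> l x u xr; have [_ H] := HL l; apply: le_trans (H x u xr) _.
  rewrite ler_wpM2r // (bigD1 l) //= lerDl; apply: sumr_ge0 => j _; by case: (HL j).
have E : h (flow T (row_mx z v)) = w (flow T (row_mx z v)).
  apply: (@flow_compare _ _ T sT stT _ h w ((\sum_l `|b 0 l|) * L0)) => //.
  - by rewrite mulr_ge0 // sumr_ge0.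
  - by rewrite /h !row_mxKr.
  move=> k j k0 jk /=; set Z := iter j _ _.
  have Zl : lsubmx Z = iter j (estep F k) z by rewrite /Z lsub_iter row_mxKl.
  have Zll : lsubmx (lsubmx Z) = b by rewrite Zl lsub_iter_field row_mxKl.
  have Zrl : lsubmx (rsubmx Z) = delta_mx 0 i.
    rewrite /Z; elim: (j) => [|q IH]; first by rewrite /= row_mxKr row_mxKl.
    by rewrite rsub_iterS linearD linearZ /= IH derive_comb_field !row_mxKl scaler0 addr0.
  have Zr : `|rsubmx (lsubmx Z) - y| <= K * `|b|.
    by have := @rsub_iter_field _ _ _ X C C0 bX k j z k0 jk; rewrite Zl row_mxKl row_mxKr.
  have Zr' : `|rsubmx (lsubmx Z)| <= `|y| + K * `|b|.
    by rewrite -[rsubmx _](subrKC y); apply: le_trans (ler_normD _ _) _; rewrite lerD2l.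
  set y' := rsubmx (lsubmx Z) in Zr Zr' *; set xi := rsubmx (rsubmx Z).
  have TZ : T Z = row_mx (F (lsubmx Z)) ('D_(rsubmx Z) F (lsubmx Z)) by [].
  have Dh : 'D_(T Z) h Z = X i y' + \sum_l b 0 l *: 'D_xi (X l) y'.
    rewrite /h derive_rsubmx; last exact: smoothv_differentiable sr I.
    rewrite derive_rsubmx // derive_idE TZ row_mxKr derive_comb_field row_mxKr.
    rewrite big_split /= Zll Zrl; congr (_ + _).
    exact: (comb_delta X i y').
  (* Commutation enters here: the derivative of [X i] along the motion is exchanged for derivatives
     of the [X l] along [X i], that is, for the linear operator that also drives [xi]. The error is
     then linear in [xi - (j/k) X i]. *)
  have Dw : 'D_(T Z) w Z = \sum_l b 0 l *: 'D_(X i y') (X l) y'.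
    have dl := smoothv_differentiable (x := Z) sl I.
    have dXi := smoothv_differentiable (x := rsubmx (lsubmx Z)) (sX i) I.
    rewrite /w (derive_rsub (T Z) dl dXi) derive_lsubmx // derive_idE.
    rewrite TZ row_mxKl /comb_field row_mxKr Zll -/y' /comb (derive_vsum _ _ _ (sX i)).
    by apply: eq_bigr => l _; rewrite comm.
  have -> : 'D_(T Z) h Z - w Z - (j%:R / k%:R) *: 'D_(T Z) w Z =
      \sum_l b 0 l *: 'D_(xi - (j%:R / k%:R) *: X i y') (X l) y'.
    have aux (p q r : 'rV[R]_m) : p + q - p - r = q - r by rewrite [p + q]addrC addrK.
    rewrite Dh Dw /w -/y' aux scaler_sumr -sumrB.
    apply: eq_bigr => l _; rewrite scalerA [_ * b 0 l]mulrC -[in LHS]scalerA -scalerBr;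
      congr (_ *: _).
    have := derive_vlinear (sX l) y' (- (j%:R / k%:R)) (X i y') xi.
    by rewrite !scaleNr addrC => ->; rewrite addrC.
  apply: le_trans (ler_norm_sum _ _ _) _; rewrite -mulrA mulr_suml; apply: ler_sum => l _.
  by rewrite normrZ ler_wpM2l // /h /w -/y' -/xi HL0.
move: E; rewrite /h /w => ->; rewrite lsub_flow row_mxKl.
by [].
Qed.

End Commuting.

(** * Inverse functions and Hadamard's lemma *)

Section SmoothMatrix.
Context {R : realType} {V : normedModType R}.
Variables (U : set V) (oU : open U).

Lemma smooth_det n (A : V -> 'M[R]_n) : (forall i j, smooth_on U (fun x => A x i j)) ->
  smooth_on U (fun x => \det (A x)).
Proof.
move=> sA; rewrite /determinant; apply: smooth_sum => // s _.
apply: smoothM => //; first exact: smooth_cst.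
by apply: smooth_prod => // i _.
Qed.

Lemma smooth_invmx n (A : V -> 'M[R]_n) : (forall i j, smooth_on U (fun x => A x i j)) ->
  (forall x, U x -> A x \in unitmx) -> forall i j, smooth_on U (fun x => invmx (A x) i j).
Proof.
move=> sA uA i j.
have S : smooth_on U (fun x => (\det (A x))^-1 * ((-1) ^+ (j + i) * \det (row' j (col' i (A x))))).
  apply: smoothM => //.
    apply: smooth_inv => //; last exact: smooth_det.
    by move=> x /uA; rewrite unitmxE unitfE.
  apply: smoothM => //; first exact: smooth_cst.
  apply: smooth_det => k l.
  apply: (smooth_ext oU _ (sA (lift j k) (lift i l))) => x _; by rewrite !mxE.
apply: (smooth_ext oU _ S) => x Ux.
by rewrite /invmx (uA _ Ux) !mxE.
Qed.

End SmoothMatrix.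

Section InverseFunction.
Context {R : realType} {N : nat}.
Implicit Types (G s : 'rV[R]_N -> 'rV[R]_N).

Lemma open_unitmx (U : set 'rV[R]_N) (A : 'rV[R]_N -> 'M[R]_N) : open U ->
  (forall i j, smooth_on U (fun x => A x i j)) -> open (U `&` [set x | A x \in unitmx]).
Proof.
move=> oU sA; rewrite openE => x [Ux uA].
have cd : {for x, continuous (fun x => \det (A x))}.
  exact: smooth_continuous (smooth_det oU sA) Ux.
have n0 : nbhs (\det (A x)) [set d | d != 0].
  apply: open_nbhs_nbhs; split; last by rewrite /= -unitfE -unitmxE.
  exact: open_neq.
have := cd _ n0; rewrite /interior; apply: filterS2 (open_near oU Ux) => y Uy dy.
by split => //=; rewrite unitmxE unitfE.
Qed.

Lemma jacobianE G (y : 'rV[R]_N) i j : differentiable G y ->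
  ('J G y) i j = ('D_(delta_mx 0 i) G y) 0 j.
Proof. by move=> dG; rewrite deriveEjacobian // -rowE [RHS]mxE. Qed.

(* [s (G y0 + b)] is reached from [y0] by transport along [b] times the inverse Jacobian, a
   field that moves [G] with constant velocity [b]. *)
Lemma right_inverse G (U : set 'rV[R]_N) (y0 : 'rV[R]_N) : open U -> U y0 ->
  smooth_onv U G -> 'J G y0 \in unitmx ->
  exists s, [/\ smooth_onv setT s, s (G y0) = y0 & \forall z \near G y0, G (s z) = z].
Proof.
move=> oU Uy0 sG uJ.
have dG y : U y -> differentiable G y by move=> Uy; exact: smoothv_differentiable sG Uy.
have sJ i j : smooth_on U (fun y => ('J G y) i j).
  apply: (smooth_ext oU _ (smoothv_derive (delta_mx 0 i) oU sG j)) => y Uy.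
  by rewrite jacobianE //; exact: dG.
pose U' := U `&` [set x | 'J G x \in unitmx].
have oU' : open U' by exact: open_unitmx.
have sinv i : smooth_onv U' (fun y => row i (invmx ('J G y))).
  move=> j; have S := @smooth_invmx _ _ U' oU' N (fun y => 'J G y)
    (fun i j => smooth_sub (@subIsetl _ _ _) (sJ i j)) (fun x H => H.2) i j.
  by apply: (smooth_ext oU' _ S) => y _; rewrite mxE.
have /choice[X HX] i := smooth_extendv oU' (conj Uy0 uJ) (sinv i).
have /choice[C HC] := HX.
have [G' [CG [sG' nG' _]]] := smooth_extendv oU Uy0 sG.
pose K0 := \sum_i C i.
have sX i : smooth_onv setT (X i) by have [] := HC i.
have C0 i : 0 <= C i by have [_ _ []] := HC i.
have K00 : 0 <= K0 by apply: sumr_ge0 => i _; exact: C0.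
have bX i y : `|X i y| <= K0.
  have [_ _ [_ H]] := HC i; apply: le_trans (H y) _.
  by rewrite /K0 (bigD1 i) //= lerDl; apply: sumr_ge0 => j _; exact: C0.
have nX : \near y0, forall i, X i y0 = row i (invmx ('J G y0)).
  have H i : \near y0, X i y0 = row i (invmx ('J G y0)) by have [_ + _] := HC i.
  exact: (@filter_forall _ _ _ (nbhs y0) (nbhs_filter (y0 : 'rV[R]_N)) H).
have /nbhs_normP[e /= e0 He] : \forall y \near y0,
    [/\ U' y, G' y = G y & forall i, X i y = row i (invmx ('J G y))].
  by apply: filterS3 (open_near oU' (conj Uy0 uJ)) nG' nX => y.
have {}He y : `|y - y0| < e ->
    [/\ U' y, G' y = G y & forall i, X i y = row i (invmx ('J G y))].
  by move=> ye; apply: He; rewrite /= distrC.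
have near_ball y : `|y - y0| < e -> \near y, `|y - y0| < e.
  move=> ye; have : nbhs y (ball y0 e).
    by apply: open_nbhs_nbhs; split; [exact: ball_open|rewrite -ball_normE /= distrC].
  by apply: filterS => x; rewrite -ball_normE /= distrC.
have DG' y v : `|y - y0| < e -> 'D_v G' y = v *m 'J G y.
  move=> ye; have [[Uy _] _ _] := He y ye.
  rewrite -deriveEjacobian; last exact: dG.
  apply: near_eq_derive; apply: filterS (near_ball y ye) => x xe.
  by have [] := He x xe.
pose s z := transport X (z - G y0) y0.
have st : smooth_onv setT s.
  have s1 : smooth_onv setT (fun z : 'rV[R]_N => row_mx (z - G y0) y0).
    apply: (smoothv_row_mx openT); last exact: smoothv_cst.
    by apply: (smoothvD openT); [exact: smoothv_id|exact: smoothv_cst].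
  have := smoothv_comp openT (fun _ _ => I) s1 (smooth_transport sX K00 bX).
  by under eq_fun do rewrite row_mxKl row_mxKr.
have s0 : s (G y0) = y0 by rewrite /s subrr (transport0 sX K00 bX).
exists s; split => //.
pose K := N%:R * K0 + 1; have K1 : 0 < K by rewrite ltr_wpDl // mulr_ge0.
apply/nbhs_normP; exists (e / K) => /=; first by rewrite divr_gt0.
move=> z /=; rewrite ltr_pdivlMr // => ze.
(* For [z] within [e / K] of [G y0], transport stays where the cut-off fields are the rows of the
   inverse Jacobian and [G'] coincides with [G]. *)
have zb y' : `|y' - y0| <= N%:R * K0 * `|z - G y0| -> `|y' - y0| < e.
  move=> /le_lt_trans; apply; apply: le_lt_trans ze.
  by rewrite distrC mulrC ler_wpM2l // /K lerDl.
have E : G' (s z) = G' y0 + (z - G y0).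
  apply: (transport_integral sX K00 bX sG') => y' /zb y'e.
  rewrite DG' // /comb.
  have [[_ uJ'] _ XE] := He y' y'e.
  have -> : \sum_l (z - G y0) 0 l *: X l y' = (z - G y0) *m invmx ('J G y').
    by rewrite mulmx_sum_row; apply: eq_bigr => l _; rewrite XE.
  by rewrite mulmxKV.
have sz : `|s z - y0| < e by apply: zb; exact: (transport_bound sX K00 bX).
have y0e : `|y0 - y0| < e by rewrite subrr normr0.
by have [_ <- _] := He _ sz; have [_ Gy0 _] := He _ y0e; rewrite E Gy0 addrC subrK.
Qed.

(* The right inverse of the right inverse [s] agrees with [G] near [y0]. *)
Lemma inverse_function G (U : set 'rV[R]_N) (y0 : 'rV[R]_N) : open U -> U y0 ->
  smooth_onv U G -> 'J G y0 \in unitmx ->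
  exists (V : set 'rV[R]_N) s, [/\ open V, V y0, V `<=` U, open (G @` V) &
    smooth_onv setT s /\ forall y, V y -> s (G y) = y].
Proof.
move=> oU Uy0 sG uJ; have [s [ss s0 Gs]] := right_inverse oU Uy0 sG uJ.
have ds z : differentiable s z by exact: smoothv_differentiable ss I.
have dG y : U y -> differentiable G y by move=> Uy; exact: smoothv_differentiable sG Uy.
have cs z : {for z, continuous s} by exact: smoothv_continuous ss I.
have JJ : 'J s (G y0) *m 'J G y0 = 1%:M.
  have dGy0 := dG y0 Uy0; apply/row_matrixP => i.
  have E1 := derive_comp (t := s) (f := G) (delta_mx 0 i) (ds (G y0)).
  rewrite s0 in E1; have {}E1 := E1 dGy0.
  rewrite (deriveEjacobian _ dGy0) (deriveEjacobian _ (ds (G y0))) in E1.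
  rewrite row_mul [row i ('J s (G y0))]rowE -E1 (near_eq_derive _ Gs) derive_idE.
  by rewrite rowE mulmx1.
have uJs : 'J s (G y0) \in unitmx.
  exact: (proj1 (mulmx1_unit JJ)).
have [t [stt t0 tn]] := right_inverse openT I ss uJs.
rewrite s0 in t0 tn.
(* From [s (t y) = y] and [G (s (t y)) = t y] follows [G y = t y], whence [s (G y) = y]. *)
have sG_id : \forall y \near y0, s (G y) = y.
  have ct : {for y0, continuous t} by exact: smoothv_continuous stt I.
  have := ct; rewrite /prop_for /continuous_at t0 => {}ct.
  have nt : \forall y \near y0, G (s (t y)) = t y := ct _ Gs.
  by apply: filterS2 nt tn => y h1 h2; rewrite -{2}h2 -h1 h2.
have := nbhs_interior sG_id => /filterI/(_ (open_near oU Uy0)).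
rewrite nbhsE => -[V1 [oV1 V1y0] sV1].
have := nbhs_interior Gs; rewrite nbhsE => -[N2 [oN2 N2z0] sN2].
have sGV1 y : V1 y -> s (G y) = y by move=> /sV1[/nbhs_singleton].
have UV1 y : V1 y -> U y by move=> /sV1[].
have GN2 z : N2 z -> G (s z) = z by move=> /sN2/nbhs_singleton.
(* This choice makes the image of [V] under [G] equal to the intersection of [N2] with the preimage
   of [V1] under [s], which is visibly open. *)
pose V := V1 `&` G @^-1` N2.
have VE : G @` V = N2 `&` s @^-1` V1.
  apply/seteqP; split=> [_ [y [V1y N2y] <-]|z [N2z V1z]].
    by split => //=; rewrite sGV1.
  by exists (s z); [split => //=; rewrite GN2|exact: GN2].
exists V, s; split => //.
- rewrite openE => y [V1y N2y]; rewrite /interior; apply: filterI; first by apply: open_nbhs_nbhs.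
  have nN : nbhs (G y) N2 by apply: open_nbhs_nbhs; split.
  exact: (smoothv_continuous sG (UV1 _ V1y) nN).
- by move=> y [/UV1].
- by rewrite VE; apply: openI => //; apply: open_comp => // z _; exact: cs.
- by split => // y [/sGV1].
Qed.

End InverseFunction.

Lemma derive_cstM {R : realType} (V : normedModType R) (f : V -> R) (a : R) x v :
  derivable f x v -> 'D_v (fun y => a * f y) x = a * 'D_v f x.
Proof.
move=> df; have E := deriveM (derivable_cst a x v) df.
by rewrite derive_cst scaler0 addr0 in E.
Qed.

Section Hadamard.
Context {R : realType} {n : nat}.

Lemma delta_norm_le (i : 'I_n) : `|(delta_mx 0 i : 'rV[R]_n)| <= 1.
Proof.
by apply: rV_norm_le => // j; rewrite mxE; case: eqP => _; case: eqP => _; rewrite ?normr1 ?normr0.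
Qed.

(* The coefficients [int_0^1 d_i f (x0 + t (x - x0)) dt] are produced by transport for the
   fields [(e_i, 0)] and [(0, grad f)] on pairs [(y, z)]; the factor [eps] keeps the
   polygons in the region where the globalized gradient agrees with that of [f]. *)
Lemma hadamard (f : 'rV[R]_n -> R) (U : set 'rV[R]_n) (x0 : 'rV[R]_n) :
  open U -> U x0 -> smooth_on U f ->
  exists g : 'I_n -> 'rV[R]_n -> R, [/\ forall i, smooth_on setT (g i),
    forall i, g i x0 = 'D_(delta_mx 0 i) f x0 &
    \forall x \near x0, f x = f x0 + \sum_i (x 0 i - x0 0 i) * g i x].
Proof.
move=> oU Ux0 sf.
have sgrad : smooth_onv U (fun x => \row_i 'D_(delta_mx 0 i) f x).
  move=> i; apply: (smooth_ext oU _ (smooth_derive (delta_mx 0 i) sf)) => x _.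
  by rewrite mxE.
have [D [C [sD nD [C0 bD]]]] := smooth_extendv oU Ux0 sgrad.
have [f' [Cf [sf' nf' _]]] := smooth_extend oU Ux0 sf.
have /nbhs_normP[e /= e0 He0] : \forall x \near x0,
    [/\ U x, f' x = f x & D x = \row_i 'D_(delta_mx 0 i) f x].
  by apply: filterS3 (open_near oU Ux0) nf' nD => y.
have He y : `|y - x0| < e -> [/\ U y, f' y = f y & D y = \row_i 'D_(delta_mx 0 i) f y].
  by move=> ye; apply: He0; rewrite /= distrC.
have near_ball y : `|y - x0| < e -> \near y, `|y - x0| < e.
  move=> ye; have : nbhs y (ball x0 e).
    by apply: open_nbhs_nbhs; split; [exact: ball_open|rewrite -ball_normE /= distrC].
  by apply: filterS => x; rewrite -ball_normE /= distrC.
have df' y : differentiable f' y by exact: smooth_differentiable sf' I.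
have Df' y v : `|y - x0| < e -> 'D_v f' y = \sum_i v 0 i * D y 0 i.
  move=> ye; rewrite derive_sum_coord //; apply: eq_bigr => i _; congr (_ * _).
  have [_ _ ->] := He y ye; rewrite mxE; apply: near_eq_derive.
  by apply: filterS (near_ball y ye) => x xe; have [] := He x xe.
(* The first [n] fields move [y]; the last one accumulates the gradient in [z]. With coefficients
   [x - x0] and [eps] both motions run at once. *)
pose X (l : 'I_(n + 1)) (w : 'rV[R]_(n + n)) : 'rV[R]_(n + n) :=
  match fintype.split l with inl i => row_mx (delta_mx 0 i) 0 | inr _ => row_mx 0 (D (lsubmx w))
    end.
have sX l : smooth_onv setT (X l).
  rewrite /X; case: (fintype.split l) => i; first exact: smoothv_cst.
  apply: (smoothv_row_mx openT); first exact: smoothv_cst.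
  apply: (smoothv_comp openT (fun _ _ => I) _ sD).
  by apply: (smoothv_lsub openT); exact: smoothv_id.
have C10 : 0 <= C + 1 by rewrite addr_ge0.
have bX l w : `|X l w| <= C + 1.
  rewrite /X; case: (fintype.split l) => i; apply: norm_row_mx; rewrite ?normr0 //.
    by apply: le_trans (delta_norm_le i) _; rewrite lerDr.
  by apply: le_trans (bD _) _; rewrite lerDl.
have combE (b : 'rV[R]_n) (a : 'rV[R]_1) w :
    comb X (row_mx b a) w = row_mx b (a 0 0 *: D (lsubmx w)).
  rewrite /comb big_split_ord /= big_ord1.
  have Xl i : X (lshift 1 i) w = row_mx (delta_mx 0 i) 0.
    by rewrite /X; have -> : fintype.split (lshift 1 i) = inl i by exact: (unsplitK (inl i)).
  have -> : \sum_(i < n) row_mx b a 0 (lshift 1 i) *: X (lshift 1 i) w = row_mx b 0.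
    apply/rowP => j; rewrite summxE -(splitK j); case: (fintype.split j) => k /=.
      rewrite row_mxEl (bigD1 k) //= Xl mxE !row_mxEl mxE !eqxx mulr1 big1 ?addr0 // => i ik.
      by rewrite Xl mxE !row_mxEl mxE eq_sym (negbTE ik) andbF mulr0.
    rewrite row_mxEr [RHS]mxE big1 // => i _.
    by rewrite Xl [LHS]mxE row_mxEl row_mxEr mxE mulr0.
  have -> : X (rshift n ord0) w = row_mx 0 (D (lsubmx w)).
    by rewrite /X; have -> : fintype.split (rshift n (ord0 :
      'I_1)) = inr ord0 by exact: (unsplitK (inr ord0)).
  by rewrite row_mxEr scale_row_mx scaler0 add_row_mx addr0 add0r.
pose K := (n + 1)%:R * (C + 1) + 1.
have K1 : 0 < K by rewrite ltr_wpDl // mulr_ge0.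
pose eps := e / K / 2; have eps0 : 0 < eps by rewrite !divr_gt0.
have epse : eps < e.
  rewrite /eps -mulrA gtr_pMr // -invfM invf_lt1 ?mulr_gt0 //.
  have : 0 <= (n + 1)%:R * (C + 1) by rewrite mulr_ge0.
  by rewrite /K; lra.
pose b x : 'rV[R]_(n + 1) := row_mx (x - x0) (const_mx eps).
pose w0 : 'rV[R]_(n + n) := row_mx x0 0.
pose g i x := eps^-1 * rsubmx (transport X (b x) w0) 0 i.
have sb : smooth_onv setT b.
  apply: (smoothv_row_mx openT); last exact: smoothv_cst.
  by apply: (smoothvD openT); [exact: smoothv_id|exact: smoothv_cst].
have sg i : smooth_on setT (g i).
  apply: (smoothM openT); first exact: smooth_cst.
  have s1 : smooth_onv setT (fun x => row_mx (b x) w0).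
    by apply: (smoothv_row_mx openT) => //; exact: smoothv_cst.
  have s2 := smoothv_comp openT (fun _ _ => I) s1 (smooth_transport sX C10 bX).
  have s3 := smoothv_rsub openT s2 i.
  by apply: (smooth_ext openT _ s3) => x _; rewrite row_mxKl row_mxKr.
have small x : `|x - x0| <= eps -> forall w', `|w' - w0| <= (n + 1)%:R * (C + 1) * `|b x| ->
    `|lsubmx w' - x0| < e.
  move=> xe w' hw; have bx : `|b x| <= eps.
    apply: norm_row_mx => //; apply: rV_norm_le => [|j]; first exact: ltW.
    by rewrite mxE ger0_norm // ltW.
  have -> : lsubmx w' - x0 = lsubmx (w' - w0) by rewrite linearB /= row_mxKl.
  apply: le_lt_trans (norm_lsub _) _; apply: le_lt_trans hw _.
  apply: le_lt_trans (_ : K * eps < e); last first.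
    rewrite /eps mulrA mulrCA divff ?gt_eqF // mulr1; lra.
  by apply: ler_pM => //; rewrite ?mulr_ge0 // /K lerDl.
have key x : `|x - x0| <= eps -> f x = f x0 + \sum_i (x 0 i - x0 0 i) * g i x.
  move=> xe; set w1 := transport X (b x) w0.
  have sl : smooth_onv setT (fun w : 'rV[R]_(n + n) => lsubmx w).
    by apply: (smoothv_lsub openT); exact: smoothv_id.
  have sr : smooth_onv setT (fun w : 'rV[R]_(n + n) => rsubmx w).
    by apply: (smoothv_rsub openT); exact: smoothv_id.
  have dl w : differentiable (fun w : 'rV[R]_(n +
    n) => lsubmx w) w by exact: smoothv_differentiable sl I.
  have dr w : differentiable (fun w : 'rV[R]_(n +
    n) => rsubmx w) w by exact: smoothv_differentiable sr I.
  have w1l : lsubmx w1 = x.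
    have := @transport_integral _ _ _ X _ sX C10 bX n (fun w => lsubmx w) (b x) w0 (x - x0) sl.
    rewrite row_mxKl subrKC; apply => w' _; rewrite combE derive_lsubmx // derive_idE.
    by rewrite row_mxKl.
  (* A conserved quantity: [eps * f'] grows at rate [eps] times the derivative along [x - x0], which
     is also the rate of the sum, as [z] grows at [eps] times the gradient. Its equality at both
     ends is the expansion. *)
  pose h (w : 'rV[R]_(n + n)) : 'rV[R]_1 :=
    const_mx (eps * f' (lsubmx w) - \sum_i (x 0 i - x0 0 i) * rsubmx w 0 i).
  have sh0 : smooth_on setT (fun w : 'rV[R]_(n +
    n) => eps * f' (lsubmx w) - \sum_i (x 0 i - x0 0 i) * rsubmx w 0 i).
    apply: (smoothB openT).
      by apply: (smoothM openT); [exact: smooth_cst|exact: (smooth_comp openT (fun _ _ => I) sl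
        sf')].
    apply: smooth_sum => [|i _]; first exact: openT.
    by apply: (smoothM openT); [exact: smooth_cst|exact: sr].
  have sh : smooth_onv setT h by move=> j; apply: (smooth_ext openT _ sh0) => w _; rewrite mxE.
  have E := @transport_integral _ _ _ X _ sX C10 bX 1 h (b x) w0 0 sh.
  have {}E : h w1 = h w0.
    rewrite E ?addr0 // => w' /(small x xe) w'e; rewrite combE mxE.
    apply/rowP => j; rewrite derive_rV; last exact: smoothv_differentiable sh I.
    rewrite [RHS]mxE; set v := row_mx _ _.
    have -> : (fun y => h y 0 j) = (fun w : 'rV[R]_(n + n) => eps * f' (lsubmx w)) -
       \sum_i (fun w : 'rV[R]_(n + n) => (x 0 i - x0 0 i) * rsubmx w 0 i).
      by apply/funext => w; rewrite /h mxE fctE fct_sumE.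
    have dfl : differentiable (fun w : 'rV[R]_(n + n) => f' (lsubmx w)) w'.
      exact: (@differentiable_comp _ _ _ _ (fun w : 'rV[R]_(n + n) => lsubmx w) f').
    have dri i w : differentiable (fun w : 'rV[R]_(n + n) => rsubmx w 0 i) w.
      by exact: smooth_differentiable (sr i) I.
    have drii i w : derivable (fun w : 'rV[R]_(n + n) => (x 0 i - x0 0 i) * rsubmx w 0 i) w v.
      by apply: derivableM; [exact: derivable_cst|exact: diff_derivable].
    rewrite deriveB; last 2 first.
    - by apply: derivableM; [exact: derivable_cst|exact: diff_derivable].
    - by apply: derivable_sum.
    rewrite derive_sum // derive_cstM; last exact: diff_derivable.
    rewrite (derive_comp (t := fun w : 'rV[R]_(n + n) => lsubmx w) v (dl w') (df' _)).
    rewrite derive_lsubmx // derive_idE Df' // mulr_sumr; apply/eqP; rewrite subr_eq0; apply/eqP.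
    apply: eq_bigr => i _; rewrite derive_cstM; last exact: diff_derivable.
    rewrite -derive_rV // derive_rsubmx // derive_idE row_mxKl row_mxKr !mxE.
    by rewrite mulrCA.
  have := congr1 (fun M : 'rV[R]_1 => M 0 0) E; rewrite !mxE w1l row_mxKl row_mxKr.
  have [_ -> _] := He x0 ltac:(by rewrite subrr normr0).
  have [|_ -> _] := He x; first exact: le_lt_trans epse.
  rewrite [X in _ = _ - X]big1 ?subr0 => [H|i _]; last by rewrite mxE mulr0.
  have {}H : f x = f x0 + eps^-1 * \sum_i (x 0 i - x0 0 i) * rsubmx w1 0 i.
    have en0 : eps != 0 by rewrite gt_eqF.
    by rewrite -[f x0](mulKf en0) -H mulrBr mulKf // subrK.
  by rewrite H mulr_sumr; congr (_ + _); apply: eq_bigr => i _; rewrite mulrCA.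
have nkey : \forall x \near x0, f x = f x0 + \sum_i (x 0 i - x0 0 i) * g i x.
  by apply/nbhs_normP; exists eps => // x /= /ltW xe; apply: key; rewrite distrC.
(* At [x0] the factors [x_j - x0_j] vanish, so the product rule applied to the expansion leaves just
   [g i x0]. *)
exists g; split => // i; rewrite (near_eq_derive _ nkey).
have dg j : derivable (g j) x0 (delta_mx 0 i).
  by apply: diff_derivable; exact: smooth_differentiable (sg j) I.
have dc j : derivable (fun x : 'rV[R]_n => x 0 j - x0 0 j) x0 (delta_mx 0 i).
  by apply: derivableB; [exact/diff_derivable/differentiable_coord|exact: derivable_cst].
have -> : (fun x : 'rV[R]_n => f x0 + \sum_j (x 0 j - x0 0 j) * g j x) =
    cst (f x0) + \sum_j (fun x : 'rV[R]_n => x 0 j - x0 0 j) * g j.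
  by apply/funext => x; rewrite fctE fct_sumE.
rewrite deriveD; [|exact: derivable_cst|by apply: derivable_sum => j; exact: derivableM].
rewrite derive_cst add0r derive_sum; last by move=> j; exact: derivableM.
have Dc j : 'D_(delta_mx 0 i) (fun x : 'rV[R]_n => x 0 j - x0 0 j) x0 = (j == i)%:R.
  rewrite deriveB; [|exact/diff_derivable/differentiable_coord|exact: derivable_cst].
  by rewrite derive_cst subr0 -(@derive_rV _ _ _ (fun y => y)) // derive_idE mxE eqxx.
rewrite (bigD1 i) //= deriveM // Dc eqxx subrr scale0r add0r big1 ?addr0.
  by rewrite /GRing.scale /= mulr1.
by move=> j ji; rewrite deriveM // Dc (negbTE ji) subrr scale0r scaler0 addr0.
Qed.

End Hadamard.

(** * Smooth functions on manifolds *)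

Section SmoothNear.
Context {R : realType} {V : normedModType R}.
Implicit Types (f g : V -> R) (x : V).

Definition smooth_near f x := exists W, [/\ open W, W x & smooth_on W f].

Lemma smooth_nearI f x : smooth_near f x -> forall U, open U -> U x ->
  exists W, [/\ open W, W x, W `<=` U & smooth_on W f].
Proof.
move=> [W [oW Wx sW]] U oU Ux; exists (W `&` U); split => //; first exact: openI.
by apply: (smooth_sub _ sW) => y [].
Qed.

Lemma smooth_near_ext f g x : (\near x, f x = g x) -> smooth_near f x -> smooth_near g x.
Proof.
rewrite -nbhs_nearE nbhsE => -[U [oU Ux] fg] /smooth_nearI/(_ U oU Ux)[W [oW Wx WU sW]].
by exists W; split=> //; apply: (smooth_ext oW _ sW) => // y /WU/fg.
Qed.

Lemma smooth_near_op2 (op : R -> R -> R) f g x :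
  (forall U, open U -> smooth_on U f -> smooth_on U g -> smooth_on U (fun y => op (f y) (g y))) ->
  smooth_near f x -> smooth_near g x -> smooth_near (fun y => op (f y) (g y)) x.
Proof.
move=> H [W [oW Wx sW]] /smooth_nearI/(_ W oW Wx)[W' [oW' Wx' sWW sg]].
by exists W'; split=> //; apply: H => //; exact: (smooth_sub sWW sW).
Qed.

Lemma smooth_near_continuous f x : smooth_near f x -> {for x, continuous f}.
Proof. by move=> [W [oW Wx sW]]; exact: smooth_continuous sW Wx. Qed.

Lemma smooth_near_inv f x : f x != 0 -> smooth_near f x -> smooth_near (fun y => (f y)^-1) x.
Proof.
move=> f0 sf; have cf := smooth_near_continuous sf.
have n0 : nbhs (f x) [set d | d != 0] by apply: open_nbhs_nbhs; split; [exact: open_neq|].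
have := cf _ n0; rewrite nbhs_filterE nbhsE => -[U [oU Ux] fg].
have [W [oW Wx sWU sW]] := smooth_nearI sf oU Ux.
by exists W; split=> //; apply: smooth_inv => // y /sWU/fg.
Qed.

End SmoothNear.

Lemma smooth_near_comp {R : realType} {V : normedModType R} n (t : V -> 'rV[R]_n) (F : 'rV[R]_n
  -> R) (x : V) :
  (forall j, smooth_near (fun y => t y 0 j) x) -> smooth_near F (t x) ->
  smooth_near (fun y => F (t y)) x.
Proof.
move=> st [U [oU Utx sU]].
have ct : {for x, continuous t}.
  by apply: continuous_rV => j; exact: smooth_near_continuous (st j).
have nU : nbhs (t x) U by apply: open_nbhs_nbhs; split.
have := ct _ nU; rewrite nbhs_filterE nbhsE => -[W0 [oW0 W0x] sW0].
have H (j : 'I_n) : exists W, [/\ open W, W x, W `<=` W0 & smooth_on W (fun y => t y 0 j)].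
  exact: smooth_nearI.
have [W HW] := choice H.
have nW : \forall y \near x, forall j, W j y.
  have Hj j : \forall y \near x, W j y by have [oWj Wjx _ _] := HW j; exact: open_near.
  exact: (@filter_forall _ _ _ (nbhs x) (nbhs_filter x) Hj).
have : nbhs x ([set y | forall j, W j y] `&` W0).
  by apply: filterI => //; apply: open_nbhs_nbhs.
rewrite nbhsE => -[W1 [oW1 W1x] sW1].
exists W1; split=> //; apply: (smooth_comp oW1 (W := U)) => //.
  by move=> y /sW1[_ /sW0].
by move=> j; have [_ _ _ sj] := HW j; apply: (smooth_sub _ sj) => y /sW1[].
Qed.

Section ManifoldFunctions.
Context {R : realType} {n : nat} (M : @manifold R n).
Implicit Types (c e : @chart R M n) (f g : M -> R) (p q : M).

(* [atlas M] need not be maximal; [admissible] charts are those of its completion. *)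
Definition admissible c := forall c', atlas c' -> chart_compat c c' /\ chart_compat c' c.

Lemma atlas_admissible c : atlas c -> admissible c.
Proof. by move=> Ac c' Ac'; split; exact: atlas_compat. Qed.

Lemma near_cinv c p (P : M -> Prop) : dom c p -> (\near p, P p) ->
  \forall y \near c p, P (cinv c y).
Proof.
move=> dp nP; have yp : (c @` dom c) (c p) by exists p.
by have := cinv_cont yp; rewrite /prop_for /continuous_at cmapK //; apply.
Qed.

Lemma near_cmap c p (Q : 'rV[R]_n -> Prop) : dom c p -> (\forall y \near c p, Q y) ->
  \forall q \near p, Q (c q).
Proof. by move=> dp nQ; exact: (cmap_cont dp nQ). Qed.

Lemma near_cod c p : dom c p -> \forall y \near c p, (c @` dom c) y.
Proof. by move=> dp; apply: open_near; [exact: cod_open|exists p]. Qed.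

(** Locally the transition map factors through a chart of the atlas. *)
Lemma admissible_compat c e : admissible c -> admissible e -> chart_compat c e.
Proof.
move=> ac ae j; apply: smooth_local => _ [q [dq deq] <-].
have [a Aa da] := atlas_cover q.
pose W := dom c `&` dom e `&` dom a.
have oW : open W by do 2?apply: openI; exact: dom_open.
have sW : W `<=` dom c by move=> x [[]].
have ocW : open (c @` W) by exact: chart_open.
exists (c @` W); first by exists q.
have s1 : smooth_onv (c @` W) (a \o cinv c).
  move=> i; apply: (smooth_sub _ ((ac a Aa).1 i)).
  by move=> _ [x [[d1 _] d3] <-]; exists x.
have S := smooth_comp ocW (W := a @` (dom a `&` dom e)) _ s1 ((ae a Aa).2 j).
apply: (smooth_ext ocW _ (S _)) => //.
  by move=> y /(chart_cinvK sW)[[_ d] _] /=; rewrite cmapK.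
by move=> y /(chart_cinvK sW)[[[d d'] d''] _] /=; exists (cinv c y).
Qed.

Definition smooth_at f q := exists c, [/\ admissible c, dom c q & smooth_near (f \o cinv c) (c q)].

(** Transition maps are smooth, so any admissible chart decides. Charts built later, outside the
    atlas, can thus be used to test smoothness. *)
Lemma smooth_atE e f q : admissible e -> dom e q ->
  smooth_at f q <-> smooth_near (f \o cinv e) (e q).
Proof.
move=> ae deq; split; last by exists e.
move=> [c [ac dq sf]].
have [W0 [oW0 W0x W0c sW0]] := smooth_nearI sf (@cod_open _ _ _ c) (ex_intro2 _ _ q dq erefl).
pose W := [set p | [/\ dom e p, dom c p & W0 (c p)]].
have oW : open W.
  rewrite openE => p [d1 d2 w]; rewrite /interior.
  apply: filterS3 (open_near (dom_open e) d1) (open_near (dom_open c) d2)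
    (near_cmap d2 (open_near oW0 w)) => r; by split.
have sW : W `<=` dom e by move=> x [].
have oeW : open (e @` W) by exact: chart_open.
exists (e @` W); split => //; first by exists q.
have s1 : smooth_onv (e @` W) (c \o cinv e).
  move=> j; apply: (smooth_sub _ (admissible_compat ae ac j)).
  by move=> _ [x [d1 d2 _] <-]; exists x.
have S := smooth_comp oeW (W := W0) _ s1 sW0.
apply: (smooth_ext oeW _ (S _)) => y /(chart_cinvK sW)[[d1 d2 w] _] //=.
by rewrite cmapK.
Qed.

Lemma smooth_funP f : smooth_fun f <-> forall q, smooth_at f q.
Proof.
split=> [sf q|sf c Ac].
  have [c Ac dq] := atlas_cover q; exists c; split=> //; first exact: atlas_admissible.
  by exists (c @` dom c); split; [exact: cod_open|exists q|exact: sf].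
apply: smooth_local => _ [q dq <-].
have [W [_ Wq sW]] := (smooth_atE f (atlas_admissible Ac) dq).1 (sf q).
by exists W.
Qed.

Lemma smooth_at_near f g q : (\near q, f q = g q) -> smooth_at f q -> smooth_at g q.
Proof.
move=> fg [c [ac dq sf]]; exists c; split=> //.
by apply: smooth_near_ext sf; exact: near_cinv dq fg.
Qed.

Lemma smooth_at_cst (a : R) q : smooth_at (fun=> a) q.
Proof.
have [c Ac dq] := atlas_cover q; exists c; split=> //; first exact: atlas_admissible.
by exists setT; split=> //; [exact: openT|exact: smooth_cst].
Qed.

Lemma smooth_at_op2 (op : R -> R -> R) f g q :
  (forall U (f g : 'rV[R]_n -> R), open U -> smooth_on U f -> smooth_on U g ->
     smooth_on U (fun y => op (f y) (g y))) ->
  smooth_at f q -> smooth_at g q -> smooth_at (fun p => op (f p) (g p)) q.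
Proof.
move=> H [c [ac dq sf]] /(smooth_atE _ ac dq) sg; exists c; split=> //.
by apply: smooth_near_op2 sf sg => U oU; exact: H.
Qed.

Lemma smooth_atD f g q : smooth_at f q -> smooth_at g q -> smooth_at (fun p => f p + g p) q.
Proof. by apply: smooth_at_op2 => U f' g'; exact: smoothD. Qed.

Lemma smooth_atM f g q : smooth_at f q -> smooth_at g q -> smooth_at (fun p => f p * g p) q.
Proof. by apply: smooth_at_op2 => U f' g'; exact: smoothM. Qed.

Lemma smooth_at_inv f q : f q != 0 -> smooth_at f q -> smooth_at (fun p => (f p)^-1) q.
Proof.
move=> f0 [c [ac dq sf]]; exists c; split=> //.
by apply: (smooth_near_inv _ sf); rewrite /= cmapK.
Qed.

Lemma smooth_at_sum (I : Type) (r : seq I) (h : I -> M -> R) q :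
  (forall i, smooth_at (h i) q) -> smooth_at (fun p => \sum_(i <- r) h i p) q.
Proof.
move=> sh; elim: r => [|i r IH].
  by under eq_fun do rewrite big_nil; exact: smooth_at_cst.
by under eq_fun do rewrite big_cons; exact: smooth_atD.
Qed.

Lemma smooth_at_prod (I : Type) (r : seq I) (h : I -> M -> R) q :
  (forall i, smooth_at (h i) q) -> smooth_at (fun p => \prod_(i <- r) h i p) q.
Proof.
move=> sh; elim: r => [|i r IH].
  by under eq_fun do rewrite big_nil; exact: smooth_at_cst.
by under eq_fun do rewrite big_cons; exact: smooth_atM.
Qed.

Lemma smooth_at_comp k (t : M -> 'rV[R]_k) (F : 'rV[R]_k -> R) q :
  (forall j, smooth_at (fun p => t p 0 j) q) -> smooth_near F (t q) ->
  smooth_at (fun p => F (t p)) q.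
Proof.
move=> st sF; have [c Ac dq] := atlas_cover q; have ac := atlas_admissible Ac.
exists c; split=> //; apply: smooth_near_comp; last by rewrite cmapK.
by move=> j; apply: (smooth_atE (fun p => t p 0 j) ac dq).1.
Qed.

Lemma smooth_at_chart c q j : admissible c -> dom c q -> smooth_at (fun p => c p 0 j) q.
Proof.
move=> ac dq; exists c; split=> //; exists (c @` dom c); split; [exact: cod_open|by exists q|].
have S := smooth_sub (@subsetT _ (c @` dom c)) (@smoothv_id R n setT j).
apply: (smooth_ext (@cod_open _ _ _ c) _ S) => y /(chart_cinvK (@subset_refl _ (dom c)))[_ cy].
by rewrite /= cy.
Qed.

Lemma smooth_at_continuous f q : smooth_at f q -> {for q, continuous f}.
Proof.
move=> [c [ac dq sf]]; have := smooth_near_continuous sf.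
rewrite /prop_for /continuous_at /= cmapK // => cf.
have H : (f \o cinv c \o c) @ q --> f q by apply: cvg_comp cf; exact: cmap_cont dq.
apply: cvg_trans H; apply: near_eq_cvg; apply: filterS (open_near (dom_open c) dq) => r dr.
by rewrite /= cmapK.
Qed.

Lemma cinf_smooth_at (f : Cinf M) q : smooth_at f q.
Proof. by apply: (smooth_funP f).1; apply/asboolP; exact: cinf_valP. Qed.

Lemma cinf_build_subproof f : (forall q, smooth_at f q) -> f \in @smooth_pred _ _ M.
Proof. by move=> sf; apply/asboolP; exact: (smooth_funP f).2. Qed.

Definition cinf_build f (sf : forall q, smooth_at f q) : Cinf M := MkCinf (cinf_build_subproof sf).

Lemma cinfP (f g : Cinf M) : (forall q, f q = g q) -> f = g.
Proof. by move=> fg; apply/val_inj/funext. Qed.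

(** Off the closed set [K] the product is locally zero. This turns functions given on a chart into
    elements of [Cinf M], the only functions on which tangent vectors act. *)
Lemma cutoff (b : Cinf M) (K : set M) f : closed K -> (forall q, ~ K q -> b q = 0) ->
  (forall q, K q -> smooth_at f q) -> {h : Cinf M | forall q, h q = b q * f q}.
Proof.
move=> cK b0 sf; have H q : smooth_at (fun q => b q * f q) q.
  have [Kq|nKq] := pselect (K q); first by apply: smooth_atM (sf q Kq); exact: cinf_smooth_at.
  apply: smooth_at_near (smooth_at_cst 0 q).
  apply: filterS (open_near (closed_openC cK) nKq) => p /b0 ->; by rewrite mul0r.
by exists (cinf_build H).
Qed.

Lemma bump p (U : set M) : nbhs p U -> exists (b : Cinf M) (K : set M),
  [/\ closed K, K `<=` U, forall q, ~ K q -> b q = 0 & \near p, b p = 1].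
Proof.
rewrite nbhsE => -[U0 [oU0 U0p] sU0].
have [c Ac dp] := atlas_cover p; have ac := atlas_admissible Ac.
pose U1 := dom c `&` U0; have oU1 : open U1 by apply: openI => //; exact: dom_open.
have sU1 : U1 `<=` dom c by move=> x [].
have [b [r [sb b1 rU b0]]] := bump_rV (chart_open oU1 sU1) (ex_intro2 _ _ p (conj dp U0p) erefl).
pose B := [set y : 'rV[R]_n | `|y - c p| <= r].
have cB : compact B.
  have -> : B = (fun y => y + c p) @` [set x | `|x| <= r].
    apply/seteqP; split=> [y By|_ [x xr <-]]; last by rewrite /B /= addrK.
    by exists (y - c p) => //; rewrite subrK.
  apply: continuous_compact; last exact: compact_closed_ball.
  apply: continuous_subspaceT => y.
  exact: (smoothv_continuous (smoothvD openT (smoothv_id _) (smoothv_cst _ (c p))) I).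
pose K := cinv c @` B.
have KU1 : K `<=` U1.
  by move=> _ [y /rU[x U1x <-] <-]; rewrite cmapK //; exact: sU1.
(* Hausdorffness makes the compact image closed, so that the extension by zero is locally constant
   at every point outside it. *)
have cK : closed K.
  apply: compact_closed; first exact: mfd_hausdorff.
  apply: continuous_compact => //; apply/continuous_in_subspaceT => y; rewrite inE => By.
  apply: cinv_cont; have [x U1x xy] := rU y By; by exists x => //; exact: sU1.
pose f q := if pselect (dom c q) then b (c q) else 0.
have f0 q : ~ K q -> f q = 0.
  rewrite /f; case: pselect => //= dq nK; apply: b0; rewrite ltNge; apply/negP => H.
  by apply: nK; exists (c q) => //; rewrite cmapK.
have fnear q : dom c q -> \near q, b (c q) = f q.
  move=> dq; apply: filterS (open_near (dom_open c) dq) => x dx.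
  by rewrite /f; case: pselect.
have sf q : smooth_at f q.
  have [dq|ndq] := pselect (dom c q).
    apply: smooth_at_near (fnear q dq) _; apply: smooth_at_comp.
      by move=> j; exact: smooth_at_chart.
    by exists setT; split=> //; exact: openT.
  apply: smooth_at_near (smooth_at_cst 0 q).
  have nKq : (~` K) q by move=> /KU1[].
  by apply: filterS (open_near (closed_openC cK) nKq) => x /f0.
exists (cinf_build sf), K; split=> //.
  by move=> q /KU1[_ /sU0].
apply: filterS2 (fnear p dp) (near_cmap dp b1) => q /= <-; exact.
Qed.

End ManifoldFunctions.

(** * Tangent vectors and coordinate frames *)

Section Tangents.
Context {R : realType} {n : nat} {M : @manifold R n}.
Implicit Types (p q : M) (f g : Cinf M).

Lemma cinfD f g q : (f + g) q = f q + g q. Proof. by []. Qed.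
Lemma cinfM f g q : (f * g) q = f q * g q. Proof. by []. Qed.
Lemma cinfN f q : (- f) q = - f q. Proof. by []. Qed.
Lemma cinfZ (a : R) f q : (a *: f) q = a * f q. Proof. by []. Qed.
Lemma cinf0 q : (0 : Cinf M) q = 0. Proof. by []. Qed.
Lemma cinf1 q : (1 : Cinf M) q = 1. Proof. by []. Qed.

Lemma cinf_sum (I : Type) (r : seq I) (h : I -> Cinf M) q :
  (\sum_(i <- r) h i) q = \sum_(i <- r) h i q.
Proof. by elim/big_ind2 : _ => // x1 x2 y1 y2 <- <-. Qed.

Lemma tangentP p (v w : tangent p) : (forall f, v f = w f) -> v = w.
Proof. by move=> vw; apply/val_inj/funext. Qed.

Definition cinf_const (a : R) : Cinf M := a *: (1 : Cinf M).
Lemma cinf_constE a q : cinf_const a q = a. Proof. exact: mulr1. Qed.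

Section AtPoint.
Variables (p : M) (v w : tangent p).

Lemma tan_is : is_tangent p v. Proof. by apply/asboolP; exact: tan_valP. Qed.

Lemma tanD f g : v (f + g) = v f + v g.
Proof. by have [/(_ 1 f g)] := tan_is; rewrite scale1r mul1r. Qed.

Lemma tanM f g : v (f * g) = v f * g p + f p * v g.
Proof. by have [_] := tan_is; exact. Qed.

Lemma tan0 : v 0 = 0.
Proof. by have := tanD 0 0; rewrite addr0 => /eqP;
  rewrite -subr_eq0 opprD addrA subrr sub0r oppr_eq0 => /eqP. Qed.

Lemma tanZ (a : R) f : v (a *: f) = a * v f.
Proof. by have [/(_ a f 0)] := tan_is; rewrite !addr0 tan0 addr0. Qed.

Lemma tanN f : v (- f) = - v f.
Proof. by rewrite -scaleN1r tanZ mulN1r. Qed.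

Lemma tanB f g : v (f - g) = v f - v g.
Proof. by rewrite tanD tanN. Qed.

Lemma tan_sum (I : Type) (r : seq I) (h : I -> Cinf M) :
  v (\sum_(i <- r) h i) = \sum_(i <- r) v (h i).
Proof. by elim: r => [|i r IH]; rewrite ?big_nil ?tan0 // !big_cons tanD IH. Qed.

Lemma tan1 : v 1 = 0.
Proof. by have := tanM 1 1; rewrite mulr1 cinf1 mulr1 mul1r => /eqP;
  rewrite -subr_eq0 opprD addrA subrr sub0r oppr_eq0 => /eqP. Qed.

Lemma tan_const a : v (cinf_const a) = 0.
Proof. by rewrite /cinf_const tanZ tan1 mulr0. Qed.

(** For a bump [b] supported where [f = g], the difference equals [(f - g) * (1 - b)]; both factors
    vanish at [p], and Leibniz' rule kills the product. *)
Lemma tan_near f g : (\near p, f p = g p) -> v f = v g.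
Proof.
move=> fg; have [b [K [cK KU b0 b1]]] := bump fg.
have E : f - g = (f - g) * (1 - b).
  apply: cinfP => q; rewrite cinfM !cinfD !cinfN cinf1.
  have [/KU ->|/b0 ->] := pselect (K q); first by rewrite subrr mul0r.
  by rewrite subr0 mulr1.
apply/eqP; rewrite -subr_eq0 -tanB E tanM !cinfD !cinfN cinf1.
by rewrite (nbhs_singleton b1) (nbhs_singleton fg) !subrr mulr0 mul0r addr0.
Qed.

Lemma tan_valD f : (v + w) f = v f + w f. Proof. by []. Qed.
Lemma tan_valN f : (- v) f = - v f. Proof. by []. Qed.
Lemma tan_valZ (a : R) f : (a *: v) f = a * v f. Proof. by []. Qed.
Lemma tan_val0 f : (0 : tangent p) f = 0. Proof. by []. Qed.

End AtPoint.

Lemma tan_val_sum p (I : Type) (r : seq I) (h : I -> tangent p) f :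
  (\sum_(i <- r) h i) f = \sum_(i <- r) h i f.
Proof. by elim/big_ind2 : _ => // x1 x2 y1 y2 <- <-. Qed.

Lemma vf_atD (X Y : vfield M) p : vf_at (X + Y) p = vf_at X p + vf_at Y p.
Proof. by apply: tangentP. Qed.
Lemma vf_atN (X : vfield M) p : vf_at (- X) p = - vf_at X p.
Proof. by apply: tangentP. Qed.
Lemma vf_at0 p : vf_at (0 : vfield M) p = 0.
Proof. by apply: tangentP. Qed.
Lemma vf_atZ h (X : vfield M) p : vf_at (h *: X) p = h p *: vf_at X p.
Proof. by apply: tangentP. Qed.
Lemma vf_at_sum (I : Type) (r : seq I) (X : I -> vfield M) p :
  vf_at (\sum_(i <- r) X i) p = \sum_(i <- r) vf_at (X i) p.
Proof.
elim: r => [|i r IH]; first by rewrite !big_nil vf_at0.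
by rewrite !big_cons vf_atD IH.
Qed.

Lemma vf_ext (X Y : vfield M) : (forall p, vf_at X p = vf_at Y p) -> X = Y.
Proof.
move=> H; apply/val_inj/funext => f; apply: cinfP => q.
exact: (congr1 (fun v : tangent q => v f) (H q)).
Qed.

Lemma vf_build (t : forall p, tangent p) :
  (forall f q, smooth_at (fun p => t p f) q) -> {X : vfield M | forall p, vf_at X p = t p}.
Proof.
move=> st; pose X f := cinf_build (st f).
have vX : X \in @vfield_pred R n M.
  apply/asboolP; split=> [a f g|f g]; apply: cinfP => q /=.
    by rewrite -[LHS]/(t q (a *: f + g)) tanD tanZ.
  by rewrite -[LHS]/(t q (f * g)) tanM.
by exists (MkVfield vX) => p; apply: tangentP.
Qed.

(** Cut-off coordinates and coordinate fields, global on [M] and faithful on [O] only. [cf_tan]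
    carries the real content: derivations at points of [O] are determined by their values on the
    coordinates. *)
Record chart_frame (c : @chart R M n) (O : set M) (x : 'I_n -> Cinf M) (E : 'I_n -> vfield M) :
  Prop :=
  ChartFrame {
  cf_open : open O;
  cf_dom : O `<=` dom c;
  cf_coord : forall q i, O q -> x i q = c q 0 i;
  cf_field : forall q i f, O q -> E i f q = 'D_(delta_mx 0 i) (f \o cinv c) (c q);
  cf_tan : forall q (v : tangent q) f, O q -> v f = \sum_i v (x i) * E i f q;
  cf_dual : forall q i j, O q -> E i (x j) q = (i == j)%:R
}.

Lemma smooth_near_derive (f : M -> R) c q (d : 'rV[R]_n) : admissible c -> dom c q ->
  smooth_at f q -> smooth_at (fun q => 'D_d (f \o cinv c) (c q)) q.
Proof.
move=> ac dq /(smooth_atE f ac dq)[W [oW Wq sW]].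
exists c; split=> //; exists (W `&` (c @` dom c)).
have oW' : open (W `&` (c @` dom c)) by apply: openI => //; exact: cod_open.
have Wq' : (W `&` (c @` dom c)) (c q) by split=> //; exact: imageP.
split=> //.
have S := smooth_sub (@subIsetl _ W (c @` dom c)) (smooth_derive d sW).
apply: (smooth_ext oW' _ S) => y [_ /(chart_cinvK (@subset_refl _ (dom c)))[_ cy]] /=.
by rewrite cy.
Qed.

Lemma chart_differentiable (f : Cinf M) c q : admissible c -> dom c q ->
  differentiable (f \o cinv c) (c q).
Proof.
move=> ac dq; have [W [oW Wq sW]] := (smooth_atE f ac dq).1 (cinf_smooth_at f q).
exact: smooth_differentiable sW Wq.
Qed.

(** Near [q], Hadamard's lemma writes [f] as [f q] plus a sum of [(x i - x i q) * h i] with global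
    [h i]. A derivation at [q] sees only the [v (x i) * h i q], and [h i q] is the partial
    derivative: this gives [cf_tan]. *)
Lemma chart_frame_exists (c : @chart R M n) p : admissible c -> dom c p ->
  exists O x E, chart_frame c O x E /\ O p.
Proof.
move=> ac dp; have [b [K [cK Kd b0 b1]]] := bump (open_near (dom_open c) dp).
have cut (f : M -> R) : (forall q, dom c q -> smooth_at f q) -> {h : Cinf M | forall q,
  h q = b q * f q}.
  by move=> sf; apply: (cutoff cK b0) => q /Kd; exact: sf.
have [x Hx] : {x : 'I_n -> Cinf M | forall i q, x i q = b q * c q 0 i}.
  have H i : {h : Cinf M | forall q, h q = b q * c q 0 i}.
    by apply: (cut (fun q => c q 0 i)) => q dq; exact: smooth_at_chart.
  by exists (fun i => sval (H i)) => i; exact: svalP (H i).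
have [E HE] : {E : 'I_n -> vfield M | forall i f q,
  E i f q = b q * 'D_(delta_mx 0 i) (f \o cinv c) (c q)}.
  have H i : {X : vfield M | forall f q, X f q = b q * 'D_(delta_mx 0 i) (f \o cinv c) (c q)}.
    have H f : {h : Cinf M | forall q, h q = b q * 'D_(delta_mx 0 i) (f \o cinv c) (c q)}.
      by apply: (cut (fun q => 'D_(delta_mx 0 i) (f \o cinv c) (c q))) => q dq;
        apply: smooth_near_derive => //; exact: cinf_smooth_at.
    pose X f := sval (H f); have XE f q := svalP (H f) q.
    have vX : X \in @vfield_pred R n M.
      apply/asboolP; split=> [a f g|f g]; apply: cinfP => q.
        rewrite cinfD cinfZ !XE; have [Kq|/b0 ->] := pselect (K q);
          last by rewrite !mul0r mulr0 addr0.
        have dq := Kd q Kq; have df := chart_differentiable f ac dq;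
          have dg := chart_differentiable g ac dq.
        have -> : cinf_val (a *: f + g) \o cinv c = cst a * (f \o cinv c) + (g \o cinv c) by [].
        rewrite deriveD; last 2 first.
        - by apply: derivableM; [exact: derivable_cst|exact: diff_derivable].
        - exact: diff_derivable.
        rewrite (@derive_cstM _ _ (f \o cinv c)); last exact: diff_derivable.
        by rewrite mulrDr mulrCA.
      rewrite cinfD !cinfM !XE; have [Kq|/b0 ->] := pselect (K q);
        last by rewrite !mul0r mulr0 addr0.
      have dq := Kd q Kq; have df := chart_differentiable f ac dq;
        have dg := chart_differentiable g ac dq.
      have -> : cinf_val (f * g) \o cinv c = (f \o cinv c) * (g \o cinv c) by [].
      rewrite deriveM; [|exact: diff_derivable..].
      rewrite /GRing.scale /= !(cmapK dq).
      by move: ('D_ _ _ _) ('D_ _ _ _) => u v; ring.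
    by exists (MkVfield vX) => f q; exact: XE.
  by exists (fun i => sval (H i)) => i; exact: svalP (H i).
have : nbhs p ([set q | b q = 1] `&` dom c).
  by apply: filterI => //; apply: open_nbhs_nbhs; split=> //; exact: dom_open.
rewrite nbhsE => -[Oo [oO Op] sO].
pose O := Oo; have O1 q : O q -> b q = 1 by move=> /sO[].
have Od : O `<=` dom c by move=> q /sO[].
have xO q i : O q -> x i q = c q 0 i by move=> Oq; rewrite Hx O1 // mul1r.
exists O, x, E; split=> //; split => //.
- by move=> q i f Oq; rewrite HE O1 // mul1r.
- move=> q v f Oq; have dq := Od q Oq.
  have [W [oW Wq sW]] := (smooth_atE f ac dq).1 (cinf_smooth_at f q).
  have [g [sg g0 ng]] := hadamard oW Wq sW.
  have H i : {h : Cinf M | forall q, h q = b q * g i (c q)}.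
    apply: (cut (fun q => g i (c q))) => r dr; apply: smooth_at_comp; first by move=> j;
      exact: smooth_at_chart.
    by exists setT; split=> //; exact: openT.
  pose h i := sval (H i); have hE i r := svalP (H i) r.
  rewrite (@tan_near q v f (cinf_const (f q) + \sum_i (x i - cinf_const (x i q)) * h i)).
    rewrite tanD tan_const add0r tan_sum; apply: eq_bigr => i _.
    rewrite tanM tanB tan_const subr0 cinfD cinfN cinf_constE subrr mul0r addr0.
    by rewrite /h hE HE g0 O1 // !mul1r.
  apply: filterS2 (open_near oO Oq) (near_cmap dq ng) => r Or H'.
  have {}H' : f r = f q + \sum_i (c r 0 i - c q 0 i) * g i (c r).
    by move: H'; rewrite /= !cmapK //; exact: Od.
  rewrite H' cinfD cinf_constE cinf_sum; congr (_ + _); apply: eq_bigr => i _.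
  by rewrite cinfM cinfD cinfN cinf_constE /h hE O1 // mul1r !xO.
- move=> q i j Oq; rewrite HE O1 // mul1r.
  have dq := Od q Oq.
  have nx : \forall y \near c q, (x j \o cinv c) y = y 0 j.
    apply: filterS2 (near_cod dq) (near_cinv dq (open_near oO Oq)) => y ycod Oy /=.
    by have [_ cy] := chart_cinvK (@subset_refl _ (dom c)) ycod; rewrite xO // cy.
  rewrite (near_eq_derive _ nx) -(@derive_rV _ _ _ (fun y => y)) // derive_idE mxE eqxx.
  by rewrite eq_sym.
Qed.

End Tangents.

Lemma unitmx_ker (K : fieldType) n (A : 'M[K]_n) :
  (forall u : 'rV[K]_n, u *m A = 0 -> u = 0) -> A \in unitmx.
Proof.
move=> H; rewrite -row_free_unit -kermx_eq0; apply/rowV0P => u /sub_kermxP; exact: H.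
Qed.

Section TangentSpace.
Context {R : realType} {n : nat} {M : @manifold R n}.
Implicit Types (p q : M) (f : Cinf M) (X Y : vfield M).

Lemma frame_expand c W0 x (E : 'I_n -> vfield M) q (v : tangent q) :
  chart_frame c W0 x E -> W0 q -> v = \sum_i v (x i) *: vf_at (E i) q.
Proof.
move=> F Oq; apply: tangentP => f; rewrite tan_val_sum (cf_tan F v f Oq).
by apply: eq_bigr => i _.
Qed.

Lemma frame_coord c W0 x (E : 'I_n -> vfield M) q (a : 'I_n -> R) j :
  chart_frame c W0 x E -> W0 q -> (\sum_i a i *: vf_at (E i) q) (x j) = a j.
Proof.
move=> F Oq; rewrite tan_val_sum (bigD1 j) // tan_valZ [vf_at _ _ _](cf_dual F j j Oq) eqxx mulr1.
rewrite big1 => [|i ij]; first exact: addr0.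
rewrite tan_valZ [vf_at _ _ _](cf_dual F i j Oq) (negbTE ij).
exact: mulr0.
Qed.

Lemma frame_near p : exists c W0 x (E : 'I_n -> vfield M),
  [/\ admissible c, dom c p, chart_frame c W0 x E & W0 p].
Proof.
have [c Ac dp] := atlas_cover p; have ac := atlas_admissible Ac.
by have [W0 [x [E [F Op]]]] := chart_frame_exists ac dp; exists c, W0, x, E.
Qed.

Lemma tangent_extension p (v : tangent p) : exists X : vfield M, vf_at X p = v.
Proof.
have [c [W0 [x [E [_ _ F Op]]]]] := frame_near p.
exists (\sum_i cinf_const (v (x i)) *: E i).
rewrite vf_at_sum [RHS](frame_expand v F Op); apply: eq_bigr => i _.
by rewrite vf_atZ cinf_constE.
Qed.

(** One factor [b] cuts off the coefficients [X (x i)] and another the frame, so that the expansion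
    of [b *: (b *: X)] holds on all of [M] and [L] can be applied to it; at [p] the coefficients
    vanish. *)
Lemma tensor_zero p (L : vfield M -> R) X :
  (forall Y Z, L (Y + Z) = L Y + L Z) -> (forall h Y, L (h *: Y) = h p * L Y) ->
  vf_at X p = 0 -> L X = 0.
Proof.
move=> LD LZ X0; have [c [W0 [x [E [_ _ F Op]]]]] := frame_near p.
have nO : nbhs p W0 by apply: open_nbhs_nbhs; split=> //; exact: cf_open F.
have [b [K [cK KO b0 b1]]] := bump nO.
have bp : b p = 1 := nbhs_singleton b1.
have EX : b *: (b *: X) = \sum_i (b * X (x i)) *: (b *: E i).
  apply: vf_ext => q; rewrite vf_at_sum !vf_atZ.
  have [/KO Oq|nK] := pselect (K q); last first.
    by rewrite b0 // scale0r big1 // => i _; rewrite !vf_atZ b0 // scale0r scaler0.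
  rewrite {1}(frame_expand (vf_at X q) F Oq) !scaler_sumr; apply: eq_bigr => i _.
  rewrite !vf_atZ cinfM !scalerA; congr (_ *: _); rewrite -[vf_at X q (x i)]/(X (x i) q).
  by rewrite mulrAC.
have L0 : L 0 = 0 by have := LZ 0 0; rewrite scale0r mul0r.
have -> : L X = L (b *: (b *: X)) by rewrite !LZ bp !mul1r.
rewrite EX; elim: (index_enum _) => [|i r IH]; first by rewrite big_nil.
rewrite big_cons LD IH addr0 LZ cinfM -[X (x i) p]/(vf_at X p (x i)) X0.
by rewrite tan_val0 mulr0 mul0r.
Qed.

Lemma tensor_eq p (L : vfield M -> R) X Y :
  (forall Y Z, L (Y + Z) = L Y + L Z) -> (forall h Y, L (h *: Y) = h p * L Y) ->
  vf_at X p = vf_at Y p -> L X = L Y.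
Proof.
move=> LD LZ XY; have : L (X - Y) = 0.
  by apply: (tensor_zero LD LZ); rewrite vf_atD vf_atN XY subrr.
have LN : L (- Y) = - L Y.
  have := LD Y (- Y); rewrite subrr; have -> : L 0 = 0 by have := LZ 0 0; rewrite scale0r mul0r.
  by move=> /eqP; rewrite eq_sym addrC addr_eq0 => /eqP.
by rewrite LD LN => /eqP; rewrite subr_eq0 => /eqP.
Qed.

Lemma derive_max (F : 'rV[R]_n -> R) (y v : 'rV[R]_n) : smooth_near F y ->
  (\forall z \near y, F z <= F y) -> 'D_v F y = 0.
Proof.
move=> [W [oW Wy sW]] Fy.
have /nbhs_normP[e /= e0 He] : nbhs y (W `&` [set z | F z <= F y]).
  by apply: filterI => //; apply: open_nbhs_nbhs.
pose l (t : R^o) : 'rV[R]_n := y + t *: v.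
have dl (t : R^o) : differentiable l t by apply: differentiableD => //; exact: differentiableZl.
pose d := e / (`|v| + 1); have d0 : 0 < d by rewrite divr_gt0 // ltr_wpDl.
have ld t : t \in `](- d), d[%R -> W (l t) /\ F (l t) <= F y.
  rewrite in_itv /= -ltr_norml => td; apply: He;
    rewrite /= /l opprD addrA subrr sub0r normrN normrZ.
  have : `|t| * (`|v| + 1) < e by rewrite -ltr_pdivlMr // ltr_wpDl.
  by apply: le_lt_trans; rewrite ler_wpM2l // lerDl.
have l0 : l 0 = y by rewrite /l scale0r addr0.
have dFl t : t \in `](- d), d[%R -> differentiable (fun t : R^o => F (l t)) t.
  move=> /ld[Wt _]; apply: (@differentiable_comp _ _ _ _ l F) => //.
  exact: smooth_differentiable sW Wt.
have dd : - d <= d by lra.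
have I0 : (0 : R) \in `](- d), d[%R by rewrite in_itv /= oppr_lt0 d0.
have dF1 t : t \in `](- d), d[%R -> derivable (fun t => F (l t)) t 1.
  by move=> /dFl H; apply/derivable1_diffP.
have Fm t : t \in `](- d), d[%R -> F (l t) <= F (l 0) by rewrite l0 => /ld[].
have [_ D0] := derive1_at_max dd dF1 I0 Fm.
have dF : differentiable F (l 0) by rewrite l0; exact: smooth_differentiable sW Wy.
have := derive_comp (t := l) (f := F) (1 : R^o) (dl 0) dF; rewrite l0.
have -> : 'D_1 l 0 = v.
  rewrite /l deriveD //; last exact/diff_derivable/differentiableZl.
  rewrite derive_cst add0r deriveE; last exact: differentiableZl.
  by rewrite diffZl //= diff_val scale1r.
by move=> <-.
Qed.

Lemma tan_max p f (v : tangent p) : (forall q, f q <= f p) -> v f = 0.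
Proof.
move=> fp; have [c [W0 [x [E [ac dp F Op]]]]] := frame_near p.
rewrite (cf_tan F v f Op) big1 // => i _; rewrite (cf_field F _ _ Op) derive_max ?mulr0 //.
  exact: ((smooth_atE f ac dp).1 (cinf_smooth_at f p)).
by apply: filterE => z /=; rewrite cmapK.
Qed.

Definition smooth_mx a b (A : M -> 'M[R]_(a, b)) p := forall i j, smooth_at (fun q => A q i j) p.

Lemma smooth_mx_mul a b d (A : M -> 'M[R]_(a, b)) (B : M -> 'M[R]_(b, d)) p :
  smooth_mx A p -> smooth_mx B p -> smooth_mx (fun q => A q *m B q) p.
Proof.
move=> sA sB i j; under eq_fun do rewrite mxE.
by apply: smooth_at_sum => k; exact: smooth_atM.
Qed.

Lemma smooth_mx_tr a b (A : M -> 'M[R]_(a, b)) p :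
  smooth_mx A p -> smooth_mx (fun q => (A q)^T) p.
Proof. by move=> sA i j; under eq_fun do rewrite mxE; exact: sA. Qed.

Lemma smooth_at_det a (A : M -> 'M[R]_a) p : smooth_mx A p -> smooth_at (fun q => \det (A q)) p.
Proof.
move=> sA; apply: smooth_at_sum => s; apply: smooth_atM; first exact: smooth_at_cst.
by apply: smooth_at_prod => i; exact: sA.
Qed.

Lemma smooth_mx_inv a (A : M -> 'M[R]_a) p : (\near p, A p \in unitmx) ->
  smooth_mx A p -> smooth_mx (fun q => invmx (A q)) p.
Proof.
move=> uA sA i j.
have S : smooth_at (fun q => (\det (A q))^-1 * ((-1) ^+ (j + i) * \det (row' j (col' i (A q))))) p.
  apply: smooth_atM.
    apply: smooth_at_inv; last exact: smooth_at_det.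
    by have := nbhs_singleton uA; rewrite unitmxE unitfE.
  apply: smooth_atM; first exact: smooth_at_cst.
  by apply: smooth_at_det => k l; under eq_fun do rewrite !mxE; exact: sA.
apply: smooth_at_near S; apply: filterS uA => q uq.
by rewrite /invmx uq !mxE.
Qed.

Section MetricAlgebra.
Variable g : metric M.
Implicit Types v w : forall p, tangent p.

Section AtPoint.
Variable p : M.
Implicit Types x y z : tangent p.

Lemma gDl x y z : g p (x + y) z = g p x z + g p y z.
Proof. by have := gval_linear g 1 x y z; rewrite scale1r mul1r. Qed.
Lemma g0l z : g p 0 z = 0.
Proof. by have := gDl 0 0 z; rewrite addr0 => /eqP;
  rewrite -subr_eq0 opprD addrA subrr sub0r oppr_eq0 => /eqP. Qed.
Lemma gZl (a : R) x z : g p (a *: x) z = a * g p x z.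
Proof. by have := gval_linear g a x 0 z; rewrite !addr0 g0l addr0. Qed.
Lemma gNl x z : g p (- x) z = - g p x z.
Proof. by rewrite -scaleN1r gZl mulN1r. Qed.
Lemma gDr z x y : g p z (x + y) = g p z x + g p z y.
Proof. by rewrite gval_sym gDl !(gval_sym _ _ z). Qed.
Lemma g0r z : g p z 0 = 0. Proof. by rewrite gval_sym g0l. Qed.
Lemma gZr (a : R) z x : g p z (a *: x) = a * g p z x.
Proof. by rewrite gval_sym gZl gval_sym. Qed.
Lemma gNr z x : g p z (- x) = - g p z x.
Proof. by rewrite gval_sym gNl gval_sym. Qed.
Lemma g_suml (I : Type) (r : seq I) (h : I -> tangent p) z :
  g p (\sum_(i <- r) h i) z = \sum_(i <- r) g p (h i) z.
Proof. by elim: r => [|i r IH]; rewrite ?big_nil ?g0l // !big_cons gDl IH. Qed.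
Lemma g_sumr (I : Type) (r : seq I) (h : I -> tangent p) z :
  g p z (\sum_(i <- r) h i) = \sum_(i <- r) g p z (h i).
Proof. by elim: r => [|i r IH]; rewrite ?big_nil ?g0r // !big_cons gDr IH. Qed.
End AtPoint.

Definition gram k (E : 'I_k -> vfield M) q : 'M[R]_k :=
  \matrix_(i, j) g q (vf_at (E i) q) (vf_at (E j) q).

Lemma gram_unit c W0 x (E : 'I_n -> vfield M) q : chart_frame c W0 x E -> W0 q ->
  gram E q \in unitmx.
Proof.
move=> F Oq; apply: unitmx_ker => u uG; apply/rowP => j; rewrite [RHS]mxE.
rewrite -(frame_coord (u 0) j F Oq) (_ : \sum_i _ = 0) //; apply: (@gval_nondeg _ _ _ g) => y.
rewrite (frame_expand y F Oq) g_sumr big1 // => k _; rewrite gZr g_suml.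
have := congr1 (fun A : 'rV[R]_n => A 0 k) uG; rewrite !mxE.
under eq_bigr do rewrite mxE; under [in X in _ -> X]eq_bigr do rewrite gZl.
by move=> ->; rewrite mulr0.
Qed.

Lemma smooth_gram k (E : 'I_k -> vfield M) p : smooth_mx (gram E) p.
Proof.
move=> i j; have := cinf_smooth_at (gfun g (E i) (E j)) p.
by apply: smooth_at_near; apply: filterE => q; rewrite mxE.
Qed.

End MetricAlgebra.

End TangentSpace.

(** * Horizontal lifts *)

Section Submersion.
Context {R : realType} {m n : nat} {M : @manifold R m} {B : @manifold R n}.
Variables (g : metric M) (g' : metric B) (prj : smooth_map M B).
Hypothesis sub : semi_Riemannian_submersion g g' prj.
Implicit Types (p q : M).

Lemma dmapE p (v : tangent p) f : dmap prj v f = v (pullback prj f).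
Proof. by []. Qed.

Lemma dmapD p (v w : tangent p) : dmap prj (v + w) = dmap prj v + dmap prj w.
Proof. by apply: tangentP. Qed.
Lemma dmapN p (v : tangent p) : dmap prj (- v) = - dmap prj v.
Proof. by apply: tangentP. Qed.
Lemma dmapZ p (a : R) (v : tangent p) : dmap prj (a *: v) = a *: dmap prj v.
Proof. by apply: tangentP. Qed.
Lemma dmap0 p : dmap prj (0 : tangent p) = 0.
Proof. by apply: tangentP. Qed.
Lemma dmap_sum p (I : Type) (r : seq I) (h : I -> tangent p) :
  dmap prj (\sum_(i <- r) h i) = \sum_(i <- r) dmap prj (h i).
Proof. by elim: r => [|i r IH]; rewrite ?big_nil ?dmap0 // !big_cons dmapD IH. Qed.

Lemma horizontal_vertical0 p (v : tangent p) : horizontal g prj v -> vertical prj v -> v = 0.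
Proof. by move=> hv vv; apply: (subm_nondeg sub) => // u; exact: hv. Qed.

Lemma horizontalD p (v w : tangent p) :
  horizontal g prj v -> horizontal g prj w -> horizontal g prj (v + w).
Proof. by move=> hv hw u vu; rewrite gDl hv // hw // addr0. Qed.
Lemma horizontalN p (v : tangent p) : horizontal g prj v -> horizontal g prj (- v).
Proof. by move=> hv u vu; rewrite gNl hv // oppr0. Qed.
Lemma horizontalZ p (a : R) (v : tangent p) :
  horizontal g prj v -> horizontal g prj (a *: v).
Proof. by move=> hv u vu; rewrite gZl hv // mulr0. Qed.
Lemma horizontal_sum p (I : Type) (r : seq I) (h : I -> tangent p) :
  (forall i, horizontal g prj (h i)) -> horizontal g prj (\sum_(i <- r) h i).
Proof. by move=> hh u vu; rewrite g_suml big1 // => i _; exact: hh. Qed.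

Lemma horizontal_inj p (v w : tangent p) : horizontal g prj v -> horizontal g prj w ->
  dmap prj v = dmap prj w -> v = w.
Proof.
move=> hv hw vw; apply/eqP; rewrite -subr_eq0; apply/eqP/horizontal_vertical0.
  by apply: horizontalD => //; exact: horizontalN.
by rewrite /vertical dmapD dmapN vw subrr.
Qed.

Section LocalLift.
Variables (c : @chart R M m) (W : set M) (x : 'I_m -> Cinf M) (E : 'I_m -> vfield M).
Variables (d : @chart R B n) (W' : set B) (y : 'I_n -> Cinf B) (E' : 'I_n -> vfield B).
Hypotheses (F : chart_frame c W x E) (F' : chart_frame d W' y E').

Definition jac q : 'M[R]_(m, n) := \matrix_(i, j) E i (pullback prj (y j)) q.

(* The gradients of the functions [y_j o prj] are horizontal with invertible Gram matrix
   [jac^T gram^-1 jac]; the lift is the combination of them with the given projection. *)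
Definition lift_coef q : 'M[R]_(n, m) :=
  invmx ((jac q)^T *m invmx (gram g E q) *m jac q) *m (jac q)^T *m invmx (gram g E q).

Definition lift_vec q (t : 'rV[R]_n) : tangent q :=
  \sum_i (t *m lift_coef q) 0 i *: vf_at (E i) q.

Lemma jac_tangent q (v : tangent q) j : W q ->
  v (pullback prj (y j)) = \sum_i v (x i) * jac q i j.
Proof.
by move=> Wq; rewrite (cf_tan F v _ Wq); apply: eq_bigr => i _; rewrite mxE.
Qed.

Lemma vertical_coord q (v : tangent q) : W' (prj q) ->
  (forall j, v (pullback prj (y j)) = 0) -> vertical prj v.
Proof.
move=> Wq H; apply: tangentP => f; rewrite (cf_tan F' (dmap prj v) f Wq) big1 // => j _.
by rewrite dmapE H mul0r.
Qed.

Lemma gram_row q (u : 'rV[R]_m) (w : tangent q) : W q ->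
  g q (\sum_i u 0 i *: vf_at (E i) q) w = \sum_j (u *m gram g E q) 0 j * w (x j).
Proof.
move=> Wq; rewrite {1}(frame_expand w F Wq) g_sumr; apply: eq_bigr => j _.
rewrite gZr mulrC g_suml mxE; congr (_ * _); apply: eq_bigr => i _; by rewrite gZl mxE.
Qed.

(** A kernel vector [u] gives a combination [w] of gradients which is horizontal by construction and
    vertical because [u] is in the kernel; nondegenerate fibres force [w = 0]. Pairing [w] with a
    vector above [E' j] returns the coordinate [u_j]. *)
Lemma schur_unit q : W q -> W' (prj q) ->
  (jac q)^T *m invmx (gram g E q) *m jac q \in unitmx.
Proof.
move=> Wq W'q; apply: unitmx_ker => u uS.
have uG := gram_unit g F Wq.
pose a := u *m (jac q)^T *m invmx (gram g E q).
pose w : tangent q := \sum_i a 0 i *: vf_at (E i) q.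
have gw z : g q w z = \sum_j u 0 j * z (pullback prj (y j)).
  rewrite gram_row // /a mulmxKV //.
  under eq_bigr do rewrite mxE mulr_suml.
  rewrite exchange_big; apply: eq_bigr => j _; rewrite jac_tangent // mulr_sumr.
  by apply: eq_bigr => i _; rewrite [_^T _ _]mxE; move: (jac _ _ _) (z _) (u _ _) => r1 r2 r3; ring.
have w0 : w = 0.
  apply: horizontal_vertical0.
    move=> v vv; rewrite gw big1 // => j _; have := congr1 (fun t : tangent (prj q) => t (y j)) vv.
    by rewrite dmapE => ->; rewrite mulr0.
  apply: vertical_coord => // j; rewrite jac_tangent //.
  transitivity ((a *m jac q) 0 j); last by rewrite (_ : a *m _ = 0) ?mxE // -uS /a !mulmxA.
  by rewrite [RHS]mxE; apply: eq_bigr => i _; rewrite (frame_coord (a 0) i F Wq).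
apply/rowP => j; rewrite [RHS]mxE.
have [z zE] := subm_onto sub (vf_at (E' j) (prj q)).
have := gw z; rewrite w0 g0l (bigD1 j) //= -dmapE zE.
rewrite -[vf_at _ _ _]/(E' j (y j) (prj q)) (cf_dual F' _ _ W'q) eqxx mulr1 big1 ?addr0 => [->//|i
  ij].
rewrite -dmapE zE -[vf_at _ _ _]/(E' j (y i) (prj q)) (cf_dual F' _ _ W'q).
by rewrite eq_sym (negbTE ij) mulr0.
Qed.

Lemma lift_vec_horizontal q t : W q -> W' (prj q) -> horizontal g prj (lift_vec q t).
Proof.
move=> Wq W'q v vv; rewrite gram_row // /lift_coef !mulmxA mulmxKV ?(gram_unit g F Wq) //.
set s := t *m _; under eq_bigr do rewrite mxE mulr_suml.
rewrite exchange_big big1 // => j _ /=.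
transitivity (s 0 j * v (pullback prj (y j))).
  by rewrite jac_tangent // mulr_sumr; apply: eq_bigr => i _; rewrite [_^T _ _]mxE;
    move: (s _ _) (jac _ _ _) (v _) => r1 r2 r3; ring.
have := congr1 (fun t : tangent (prj q) => t (y j)) vv.
by rewrite dmapE => ->; rewrite mulr0.
Qed.

Lemma lift_vec_dmap q (w : tangent (prj q)) : W q -> W' (prj q) ->
  dmap prj (lift_vec q (\row_j w (y j))) = w.
Proof.
move=> Wq W'q; rewrite [RHS](frame_expand w F' W'q) [LHS](frame_expand _ F' W'q).
apply: eq_bigr => j _; congr (_ *: _); rewrite dmapE jac_tangent //.
set t := \row_j _; transitivity ((t *m lift_coef q *m jac q) 0 j).
  by rewrite [RHS]mxE; apply: eq_bigr => i _; rewrite /lift_vec (frame_coord ((t *m lift_coef q)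
    0) i F Wq).
rewrite /lift_coef -!mulmxA mulVmx ?mulmx1 ?mxE // mulmxA; exact: schur_unit.
Qed.

Lemma lift_coef_smooth q : W q -> W' (prj q) -> smooth_mx lift_coef q.
Proof.
move=> Wq W'q.
have nW : \near q, W q /\ W' (prj q).
  have [cprj _] := smapP prj.
  have n2 : \near q, W' (prj q).
    by apply: (cprj q I); apply: open_nbhs_nbhs; split=> //; exact: cf_open F'.
  by apply: filterS2 (open_near (cf_open F) Wq) n2 => r.
have sJ : smooth_mx jac q.
  move=> i j; apply: smooth_at_near (cinf_smooth_at (E i (pullback prj (y j))) q).
  by apply: filterE => r; rewrite mxE.
have sG : smooth_mx (fun q => invmx (gram g E q)) q.
  apply: smooth_mx_inv; last exact: smooth_gram.
  by apply: filterS nW => r [Wr _]; exact: gram_unit F Wr.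
have sJT := smooth_mx_tr sJ.
apply: (smooth_mx_mul (smooth_mx_mul _ sJT) sG); apply: smooth_mx_inv.
  by apply: filterS nW => r [Wr W'r]; exact: schur_unit.
exact: (smooth_mx_mul (smooth_mx_mul sJT sG) sJ).
Qed.

End LocalLift.

Lemma two_frames p : exists c W x (E : 'I_m -> vfield M) d W' y (E' : 'I_n -> vfield B),
  [/\ chart_frame c W x E, chart_frame d W' y E', W p & W' (prj p)].
Proof.
have [c [W [x [E [_ _ F Wp]]]]] := frame_near p.
have [d [W' [y [E' [_ _ F' W'p]]]]] := frame_near (prj p).
by exists c, W, x, E, d, W', y, E'.
Qed.

Lemma lift_point p (w : tangent (prj p)) : exists v : tangent p, horizontal g prj v /\
  dmap prj v = w.
Proof.
have [c [W [x [E [d [W' [y [E' [F F' Wp W'p]]]]]]]]] := two_frames p.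
exists (lift_vec E y p (\row_j w (y j))); split.
  exact: (lift_vec_horizontal y F _ Wp W'p).
exact: (lift_vec_dmap F F' _ Wp W'p).
Qed.

(** The lift is chosen pointwise; being unique, it agrees near every point with the explicit formula
    [lift_vec], whose coefficients are smooth. *)
Lemma lift_field (T : forall p, tangent (prj p)) :
  (forall f p, smooth_at (fun p => T p f) p) ->
  exists X : vfield M, horizontal_field g prj X /\ forall p, dmap prj (vf_at X p) = T p.
Proof.
move=> sT; pose t p := sval (cid (lift_point (T p))).
have tP p : horizontal g prj (t p) /\ dmap prj (t p) = T p := svalP (cid (lift_point (T p))).
suff st f q : smooth_at (fun p => t p f) q.
  have [X XE] := vf_build st; exists X; split=> p.
    by rewrite XE; exact: (tP p).1.
  by rewrite XE; exact: (tP p).2.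
have [c [W [x [E [d [W' [y [E' [F F' Wp W'p]]]]]]]]] := two_frames q.
have nW : \near q, W q /\ W' (prj q).
  have [cprj _] := smapP prj.
  have n2 : \near q, W' (prj q).
    by apply: (cprj q I); apply: open_nbhs_nbhs; split=> //; exact: cf_open F'.
  by apply: filterS2 (open_near (cf_open F) Wp) n2 => r.
have sl := lift_coef_smooth F F' Wp W'p.
have S : smooth_at (fun p => \sum_i ((\row_j T p (y j)) *m lift_coef E y p) 0 i * E i f p) q.
  apply: smooth_at_sum => i; apply: smooth_atM; last exact: cinf_smooth_at.
  apply: (@smooth_mx_mul _ _ _ _ _ _ (fun p => \row_j T p (y j)) (lift_coef E y)) => // k j.
  by under eq_fun do rewrite mxE; exact: sT.
apply: smooth_at_near S; apply: filterS nW => p [Wr W'r].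
have -> : t p = lift_vec E y p (\row_j T p (y j)).
  apply: horizontal_inj; [exact: (tP p).1|exact: (lift_vec_horizontal y F _ Wr W'r)|].
  by rewrite (tP p).2 (lift_vec_dmap F F' _ Wr W'r).
by rewrite tan_val_sum; apply: eq_bigr => i _.
Qed.

Lemma horizontal_part (E : vfield M) : exists X : vfield M,
  horizontal_field g prj X /\ vertical_field prj (E - X).
Proof.
have [|X [hX XE]] := @lift_field (fun p => dmap prj (vf_at E p)).
  by move=> f p; exact: (cinf_smooth_at (E (pullback prj f)) p).
exists X; split=> // p; rewrite /vertical vf_atD vf_atN dmapD dmapN XE.
exact: subrr.
Qed.

Lemma vertical_extension p (v : tangent p) : vertical prj v ->
  exists V : vfield M, vertical_field prj V /\ vf_at V p = v.
Proof.
move=> vv; have [E Ev] := tangent_extension v; have [X [hX vX]] := horizontal_part E.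
exists (E - X); split=> //; rewrite vf_atD vf_atN Ev.
suff -> : vf_at X p = 0 by rewrite subr0.
apply: horizontal_vertical0; first exact: hX.
have := vX p; rewrite /vertical vf_atD vf_atN dmapD dmapN Ev vv add0r => /eqP.
by rewrite oppr_eq0 => /eqP.
Qed.

Lemma basic_lift (X' : vfield B) : exists X : vfield M, horizontal_field g prj X /\
  forall p, dmap prj (vf_at X p) = vf_at X' (prj p).
Proof.
apply: (@lift_field (fun p => vf_at X' (prj p))) => f p.
exact: (cinf_smooth_at (pullback prj (X' f)) p).
Qed.

Lemma basic_extension p (v : tangent p) : horizontal g prj v ->
  exists X : vfield M, basic g prj X /\ vf_at X p = v.
Proof.
move=> hv; have [X' X'v] := tangent_extension (dmap prj v).
have [X [hX XX']] := basic_lift X'; exists X; split; first by split=> //; exists X'.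
by apply: horizontal_inj; [exact: hX|exact: hv|rewrite XX' X'v].
Qed.

Section Definite.
Hypotheses (Rie : Riemannian g') (ind : has_index g (m - n)) (nm : (n < m)%N).

Lemma horizontal_pos p (v : tangent p) : horizontal g prj v -> v != 0 -> 0 < g p v v.
Proof.
move=> hv v0; rewrite -(subm_isometry sub hv hv); apply: Rie.
apply: contra v0 => /eqP v0; apply/eqP/horizontal_vertical0 => //.
Qed.

Lemma horizontal_ge0 p (v : tangent p) : horizontal g prj v -> 0 <= g p v v.
Proof.
by move=> hv; have [->|/horizontal_pos/ltW] := eqVneq v 0; [rewrite g0l|exact].
Qed.

(** If [g p v v] were nonnegative, [m - n] vectors spanning a negative space, [n] horizontal lifts
    and [v] would be [m + 1] vectors in dimension [m]. In a linear relation the negative part equals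
    minus the rest, whose square is nonnegative as horizontal and vertical vectors are orthogonal.
    So the coefficients [a] vanish, then [b], then [s]. *)
Lemma vertical_neg p (v : tangent p) : vertical prj v -> v != 0 -> g p v v < 0.
Proof.
move=> vv; apply: contraNT; rewrite -leNgt => gv.
have [[e he] _] := ind p.
have [c [W [x [E [d [W' [y [E' [F F' Wp W'p]]]]]]]]] := two_frames p.
have /choice[h Hh] (j : 'I_n) : exists h : tangent p, horizontal g prj h /\
  dmap prj h = vf_at (E' j) (prj p).
  exact: lift_point.
pose A : 'M[R]_(m - n + n + 1, m) := col_mx (col_mx (\matrix_(i, k) e i (x k)) (\matrix_(i,
  k) h i (x k))) (\row_k v (x k)).
have kA : kermx A != 0.
  rewrite -mxrank_eq0 mxrank_ker -lt0n subn_gt0 (leq_ltn_trans (rank_leq_col A)) //.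
  by rewrite subnK ?addn1 // ltnW.
have /rowV0Pn[u /sub_kermxP uA u0] := kA.
have [a [b [s uE]]] : exists a b s, u = row_mx (row_mx a b) s.
  by exists (lsubmx (lsubmx u)), (rsubmx (lsubmx u)), (rsubmx u); rewrite !hsubmxK.
have S : \sum_i a 0 i *: e i + \sum_i b 0 i *: h i + s 0 0 *: v = 0.
  rewrite (frame_expand (_ + _) F Wp) big1 // => k _.
  suff -> : (\sum_i a 0 i *: e i + \sum_i b 0 i *: h i + s 0 0 *: v) (x k) = 0 by rewrite scale0r.
  have := congr1 (fun A : 'rV[R]_m => A 0 k) uA; rewrite uE /A !mul_row_col !mxE => <-.
  rewrite !tan_valD !tan_val_sum big_ord1 tan_valZ mxE; congr (_ + _ + _).
    by apply: eq_bigr => i _; rewrite mxE.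
  by apply: eq_bigr => i _; rewrite mxE.
set w1 := \sum_i a 0 i *: e i in S; set w2 := \sum_i b 0 i *: h i in S.
have hw2 : horizontal g prj w2.
  by apply: horizontal_sum => i; apply: horizontalZ; case: (Hh i).
have a0 : a = 0.
  apply/eqP; apply/negP => /negP a0.
  have : g p w1 w1 < 0.
    apply: he; apply: contrapT => H; move/eqP: a0; apply; apply/rowP => i; rewrite mxE.
    by apply/eqP/negP => /negP ai; apply: H; exists i.
  have -> : w1 = - (w2 + s 0 0 *: v) by apply/eqP; rewrite -addr_eq0 addrA S.
  rewrite gNl gNr opprK gDl !gDr gZl !gZr (hw2 v vv) gval_sym (hw2 v vv) !mulr0 addr0 add0r.
  apply/negP; rewrite -leNgt addr_ge0 ?horizontal_ge0 //.
  by rewrite gZl mulrA -expr2 mulr_ge0 // sqr_ge0.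
have w10 : w1 = 0 by rewrite /w1 big1 // => i _; rewrite a0 mxE scale0r.
rewrite w10 add0r in S.
have w20 : w2 = 0.
  apply: horizontal_vertical0 => //.
  have -> : w2 = (- s 0 0) *: v by apply/eqP; rewrite -subr_eq0 scaleNr opprK S.
  by rewrite /vertical dmapZ vv scaler0.
have b0 : b = 0.
  apply/rowP => j; rewrite [RHS]mxE.
  have E1 : dmap prj w2 = \sum_i b 0 i *: vf_at (E' i) (prj p).
    by rewrite /w2 dmap_sum; apply: eq_bigr => i _; rewrite dmapZ (Hh i).2.
  by rewrite -(frame_coord (b 0) j F' W'p) -E1 w20 dmap0.
move: S; rewrite w20 add0r => /eqP; rewrite scaler_eq0 => /orP[/eqP s0|//].
move: u0; rewrite uE a0 b0 (_ : s = 0) ?row_mx0 ?row_mx0 ?eqxx //.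
by apply/rowP => i; rewrite (ord1 i) s0 mxE.
Qed.

Lemma vertical_nonzero p : exists v : tangent p, vertical prj v /\ v != 0.
Proof.
have [c [W [x [E [d [W' [y [E' [F F' Wp W'p]]]]]]]]] := two_frames p.
have kA : kermx (jac E y p) != 0.
  by rewrite -mxrank_eq0 mxrank_ker -lt0n subn_gt0 (leq_ltn_trans (rank_leq_col _)).
have /rowV0Pn[u /sub_kermxP uA u0] := kA.
exists (\sum_i u 0 i *: vf_at (E i) p); split.
  apply: (vertical_coord F') => // j; rewrite (jac_tangent y F) //.
  transitivity ((u *m jac E y p) 0 j); last by rewrite uA mxE.
  by rewrite [RHS]mxE; apply: eq_bigr => i _; rewrite (frame_coord (u 0) i F Wp).
apply: contra u0 => /eqP w0; apply/eqP/rowP => j.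
by rewrite -(frame_coord (u 0) j F Wp) w0 mxE.
Qed.

End Definite.

End Submersion.

(** * Connections and O'Neill's formula *)

Ltac vf_ring := apply: vf_ext => ?; apply: tangentP => ?;
  rewrite ?(vf_atD, vf_atN, vf_atZ, tan_valD, tan_valN, tan_valZ, cinfD, cinfN, cinfM); ring.

Section LeviCivitaAlgebra.
Context {R : realType} {n : nat} {M : @manifold R n}.
Variables (g : metric M) (D : connection M).
Hypothesis LC : Levi_Civita g D.
Implicit Types (X Y Z V W : vfield M) (h f : Cinf M).

Lemma vf_N X f : X (- f) = - X f.
Proof. by apply: cinfP => q; exact: (tanN (vf_at X q)). Qed.
Lemma vf_M X f h : X (f * h) = X f * h + f * X h.
Proof. by apply: cinfP => q; exact: (tanM (vf_at X q)). Qed.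
Lemma vf_0 X : X 0 = 0.
Proof. by apply: cinfP => q; exact: (tan0 (vf_at X q)). Qed.
Lemma DD X Y Z : D (X + Y) Z = D X Z + D Y Z.
Proof. by have := LC_linl LC 1 X Y Z; rewrite !scale1r. Qed.
Lemma D0l Z : D 0 Z = 0.
Proof. by have := DD 0 0 Z; rewrite addr0 => /eqP;
  rewrite -subr_eq0 opprD addrA subrr sub0r oppr_eq0 => /eqP. Qed.
Lemma DZ h X Z : D (h *: X) Z = h *: D X Z.
Proof. by have := LC_linl LC h X 0 Z; rewrite !addr0 D0l addr0. Qed.
Lemma DN X Z : D (- X) Z = - D X Z.
Proof. by rewrite -scaleN1r DZ scaleN1r. Qed.
Lemma D0r X : D X 0 = 0.
Proof. by have := LC_addr LC X 0 0; rewrite addr0 => /eqP;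
  rewrite -subr_eq0 opprD addrA subrr sub0r oppr_eq0 => /eqP. Qed.
Lemma gfE X Y q : gfun g X Y q = g q (vf_at X q) (vf_at Y q). Proof. by []. Qed.
Lemma gfC X Y : gfun g X Y = gfun g Y X.
Proof. by apply: cinfP => q; rewrite !gfE gval_sym. Qed.
Lemma gfDl X Y Z : gfun g (X + Y) Z = gfun g X Z + gfun g Y Z.
Proof. by apply: cinfP => q; rewrite cinfD !gfE vf_atD gDl. Qed.
Lemma gfZl h X Z : gfun g (h *: X) Z = h * gfun g X Z.
Proof. by apply: cinfP => q; rewrite cinfM !gfE vf_atZ gZl. Qed.
Lemma gfNl X Z : gfun g (- X) Z = - gfun g X Z.
Proof. by apply: cinfP => q; rewrite cinfN !gfE vf_atN gNl. Qed.
Lemma gfDr X Y Z : gfun g Z (X + Y) = gfun g Z X + gfun g Z Y.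
Proof. by rewrite !(gfC Z) gfDl. Qed.
Lemma gfZr h X Z : gfun g Z (h *: X) = h * gfun g Z X.
Proof. by rewrite !(gfC Z) gfZl. Qed.

Lemma bracketC X Y : bracket X Y = - bracket Y X.
Proof. by apply: vf_ext => q; apply: tangentP => f /=; rewrite opprB. Qed.
Lemma bracketDl X Y Z : bracket (X + Y) Z = bracket X Z + bracket Y Z.
Proof.
rewrite -!(LC_torsion LC) DD (LC_addr LC) opprD !addrA; congr (_ + _).
by rewrite addrAC.
Qed.
Lemma bracketZl h X Z : bracket (h *: X) Z = h *: bracket X Z - Z h *: X.
Proof.
rewrite -!(LC_torsion LC) DZ (LC_leibniz LC); move: (D X Z) (D Z X) => a b.
vf_ring.
Qed.

Lemma curvatureC X Y Z : curvature D X Y Z = - curvature D Y X Z.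
Proof. by rewrite /curvature bracketC DN !opprD !opprK [_ + D X _]addrC. Qed.

Lemma curvatureDl X Y Z W : curvature D (X + Y) Z W = curvature D X Z W + curvature D Y Z W.
Proof.
rewrite /curvature bracketDl !DD (LC_addr LC).
move: (D X (D Z W)) (D Y (D Z W)) (D Z (D X W)) (D Z (D Y W)) (D (bracket X Z) W) (D (bracket Y Z)
  W) => a b c d e f.
vf_ring.
Qed.

Lemma curvatureZl h X Z W : curvature D (h *: X) Z W = h *: curvature D X Z W.
Proof.
rewrite /curvature (bracketZl h X Z) DD DN !DZ (LC_leibniz LC).
move: (D X (D Z W)) (D Z (D X W)) (D (bracket X Z) W) (D X W) => a b c d.
vf_ring.
Qed.

Lemma curvatureDr X Z W W' : curvature D X Z (W + W') = curvature D X Z W + curvature D X Z W'.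
Proof.
rewrite /curvature !(LC_addr LC).
move: (D X (D Z W)) (D X (D Z W')) (D Z (D X W)) (D Z (D X W')) (D (bracket X Z) W).
move: (D (bracket X Z) W').
move=> a b c d e f; vf_ring.
Qed.

Lemma curvatureZr h X Z W : curvature D X Z (h *: W) = h *: curvature D X Z W.
Proof.
rewrite /curvature !(LC_leibniz LC) !(LC_addr LC) !(LC_leibniz LC).
have -> : bracket X Z h = X (Z h) - Z (X h) by [].
move: (D X (D Z W)) (D Z (D X W)) (D (bracket X Z) W) (D X W) (D Z W) => a b c d e.
vf_ring.
Qed.

(** Permits replacing arbitrary fields by basic and vertical ones with the same values at [p].
    Derivatives of a coefficient cancel between the second derivatives and the bracket term. *)
Lemma curvature4_tensor p X X' Y Y' Z Z' W W' :
  vf_at X p = vf_at X' p -> vf_at Y p = vf_at Y' p ->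
  vf_at Z p = vf_at Z' p -> vf_at W p = vf_at W' p ->
  curvature4 g D X Y Z W p = curvature4 g D X' Y' Z' W' p.
Proof.
move=> hX hY hZ hW.
have -> : curvature4 g D X Y Z W p = curvature4 g D X' Y Z W p.
  apply: (@tensor_eq _ _ _ p (fun X => curvature4 g D X Y Z W p)) => // [E F|h E].
    by rewrite /curvature4 curvatureDl gfDl opprD.
  by rewrite /curvature4 curvatureZl gfZl !cinfN cinfM mulrN.
have -> : curvature4 g D X' Y Z W p = curvature4 g D X' Y' Z W p.
  apply: (@tensor_eq _ _ _ p (fun Y => curvature4 g D X' Y Z W p)) => // [E F|h E].
    by rewrite /curvature4 !(curvatureC X') curvatureDl opprD gfDl opprD.
  by rewrite /curvature4 !(curvatureC X') curvatureZl !gfNl gfZl opprK cinfM !cinfN opprK.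
have -> : curvature4 g D X' Y' Z W p = curvature4 g D X' Y' Z' W p.
  apply: (@tensor_eq _ _ _ p (fun Z => curvature4 g D X' Y' Z W p)) => // [E F|h E].
    by rewrite /curvature4 curvatureDr gfDl opprD.
  by rewrite /curvature4 curvatureZr gfZl !cinfN cinfM mulrN.
by rewrite /curvature4 !cinfN !gfE hW.
Qed.

End LeviCivitaAlgebra.

(** * The mixed curvature and its consequences *)

Section Geometry.
Context {R : realType} {m n : nat} {M : @manifold R m} {B : @manifold R n}.
Variables (g : metric M) (g' : metric B) (prj : smooth_map M B).
Variables (D : connection M) (H : vfield M).
Hypotheses (nm : (n < m)%N) (cB : compact [set: B]) (Rie : Riemannian g')
  (ind : has_index g (m - n)) (sub : semi_Riemannian_submersion g g' prj)
  (LC : Levi_Civita g D) (umb : totally_umbilic_fibres g prj D H)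
  (mix : forall (p : M) (X V : vfield M),
      horizontal g prj (vf_at X p) -> vf_at X p != 0 ->
      vertical prj (vf_at V p) -> vf_at V p != 0 ->
      0 <= sectional g D X V p)
  (bH : basic g prj H).
Local Notation gf := (gfun g).
Local Notation hor := (horizontal_field g prj).
Local Notation ver := (vertical_field prj).
Implicit Types (X Y V U : vfield M) (p q : M).

Let c0 : R := (m - n)%:R^-1.
Let c0_gt0 : 0 < c0. Proof. by rewrite invr_gt0 ltr0n subn_gt0. Qed.

Lemma hprojP p (z : tangent p) : horizontal g prj (hproj g prj z) /\
  vertical prj (z - hproj g prj z).
Proof.
have [Z Zz] := tangent_extension z; have [X [hX vX]] := horizontal_part sub Z.
have ex : exists y : tangent p, horizontal g prj y /\ vertical prj (z - y).
  by exists (vf_at X p); split; [exact: hX|have := vX p; rewrite vf_atD vf_atN Zz].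
rewrite /hproj; have [y yP] := ex.
by case: xgetP => [_ _ //|/(_ y)]; case.
Qed.

Lemma g_hproj p (x z : tangent p) : horizontal g prj x -> g p x (hproj g prj z) = g p x z.
Proof.
move=> hx; have [_ vz] := hprojP z; have := hx _ vz; rewrite gDr gNr => /eqP.
by rewrite subr_eq0 => /eqP ->.
Qed.

Lemma gf_hv X V : hor X -> ver V -> gf X V = 0.
Proof. by move=> hX vV; apply: cinfP => q; rewrite gfE (hX q) //; exact: vV. Qed.

Lemma umbilic X V U : hor X -> ver V -> ver U ->
  gf X (D V U) = cinf_const c0 * gf V U * gf X H.
Proof.
move=> hX vV vU; apply: cinfP => q; rewrite gfE -g_hproj; last exact: hX.
have := umb vV vU q; rewrite /fibre_sff => ->.
by rewrite gZr !cinfM cinf_constE.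
Qed.

Lemma hor_test p (x : tangent p) : (forall U, ver U -> g p x (vf_at U p) = 0) ->
  horizontal g prj x.
Proof. by move=> Hx u vu; have [U [vU <-]] := vertical_extension sub vu; exact: Hx. Qed.

Lemma ver_pullback V f : ver V -> V (pullback prj f) = 0.
Proof. by move=> vV; apply: cinfP => q; exact: (congr1 (fun t : tangent (prj q) => t f) (vV q)).
Qed.

Lemma basic_pullback X (X' : vfield B) f : (forall p, dmap prj (vf_at X p) = vf_at X' (prj p)) ->
  X (pullback prj f) = pullback prj (X' f).
Proof. by move=> XX'; apply: cinfP => q; exact: (congr1 (fun t : tangent (prj q) => t f) (XX' q)).
Qed.

Lemma bracket_vertical X V : basic g prj X -> ver V -> ver (bracket X V).
Proof.
move=> [_ [X' XX']] vV p; apply: tangentP => f.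
rewrite -[LHS]/((X (V (pullback prj f)) - V (X (pullback prj f))) p).
by rewrite (basic_pullback f XX') !ver_pullback // vf_0 subrr.
Qed.

Lemma gf_basic X Y : basic g prj X -> basic g prj Y -> exists f, gf X Y = pullback prj f.
Proof.
move=> [hX [X' XX']] [hY [Y' YY']]; exists (gfun g' X' Y'); apply: cinfP => q.
rewrite -[RHS]/(g' (prj q) (vf_at X' (prj q)) (vf_at Y' (prj q))) -XX' -YY'.
by rewrite (subm_isometry sub (hX q) (hY q)).
Qed.

Lemma ver_gf_basic X Y V : basic g prj X -> basic g prj Y -> ver V -> V (gf X Y) = 0.
Proof. by move=> bX bY vV; have [f ->] := gf_basic bX bY; exact: ver_pullback. Qed.

Lemma metric_rule X Y Z : X (gf Y Z) = gf (D X Y) Z + gf Y (D X Z).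
Proof. exact: LC_metric LC X Y Z. Qed.

Lemma D_swap X V : D X V = D V X + bracket X V.
Proof. by rewrite -(LC_torsion LC) addrC subrK. Qed.

(** Differentiating [g(X, U) = 0] along [V] brings in [g(X, D_V U)], which umbilicity evaluates: the
    shape operator of the fibres is a multiple of the identity. *)
Lemma DV_vertical X V U : hor X -> ver V -> ver U ->
  gf (D V X) U = - (cinf_const c0 * gf V U * gf X H).
Proof.
move=> hX vV vU; have := metric_rule V X U; rewrite gf_hv // vf_0 (umbilic hX vV vU) => /eqP.
by rewrite eq_sym addr_eq0 => /eqP.
Qed.

Lemma DV_horizontal X V : hor X -> ver V ->
  hor (D V X + (cinf_const c0 * gf X H) *: V).
Proof.
move=> hX vV p; apply: hor_test => U vU; rewrite -gfE gfDl DV_vertical // gfZl.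
rewrite cinfD cinfN !cinfM; move: (gf V U p) (gf X H p) (cinf_const c0 p) => a b d.
by ring.
Qed.

(** Since [[X, V]] is vertical, [g(D_X X, V) = - g(X, D_X V) = - g(X, D_V X)], and the last term is
    minus half of [V (g(X, X))], zero because [g(X, X)] is constant along fibres. *)
Lemma DX_horizontal X : basic g prj X -> hor (D X X).
Proof.
move=> bX p; have hX := bX.1; apply: hor_test => V vV; rewrite -gfE.
have h1 := metric_rule X X V; rewrite gf_hv // vf_0 (D_swap X V) gfDr in h1.
rewrite (gf_hv hX (bracket_vertical bX vV)) addr0 in h1.
have h2 := metric_rule V X X; rewrite (ver_gf_basic bX bX vV) (gfC g (D V X) X) in h2.
have p1 : 0 = gf (D X X) V p + gf X (D V X) p := congr1 (fun f : Cinf M => f p) h1.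
have p2 : 0 = gf X (D V X) p + gf X (D V X) p := congr1 (fun f : Cinf M => f p) h2.
by move: (gf _ _ p) (gf _ _ p) p1 p2 => a b; lra.
Qed.

(** As [[X, V]] is vertical and [D X X] horizontal, umbilicity evaluates every second derivative
    paired with [V]. The terms in [g([X, V], V)] and in [g(D_X X, H)] cancel; splitting [D V X] into
    the horizontal [W] and a multiple of [V] collects the rest. *)
Lemma mixed_curvature X V p : basic g prj X -> ver V ->
  let W := D V X + (cinf_const c0 * gf X H) *: V in
  curvature4 g D X V X V p =
    gf V V p * (c0 * gf X (D X H) p - (c0 * gf X H p) ^+ 2) + gf W W p.
Proof.
move=> bX vV W; have hX := bX.1; have vb := bracket_vertical bX vV.
have gWW : gf W W p = gf (D V X) (D V X) p + 2 * (c0 * gf X H p) * gf (D V X) V p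
   + (c0 * gf X H p) ^+ 2 * gf V V p.
  rewrite /W gfDl !gfDr !gfZl !gfZr (gfC g V (D V X)) !cinfD !cinfM !cinf_constE.
  by move: (gf X H p) (gf (D V X) V p) (gf V V p) (gf (D V X) (D V X) p) => r1 r2 r3 r4; ring.
move: (gf W W p) gWW => w ->.
have e1 : gf (D X (D V X)) V = X (gf (D V X) V) - gf (D V X) (D V X + bracket X V).
  by rewrite metric_rule -(D_swap X V) addrK.
have e2 : gf (D V (D X X)) V = - (cinf_const c0 * gf V V * gf (D X X) H).
  have := metric_rule V (D X X) V; rewrite gf_hv //; last exact: DX_horizontal.
  rewrite vf_0 (umbilic (DX_horizontal bX) vV vV) => /eqP.
  by rewrite eq_sym addr_eq0 => /eqP.
have e3 := DV_vertical hX vb vV.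
have e4 := DV_vertical hX vV vV.
have e5 := metric_rule X V V.
have e6 : gf (D X V) V = gf (D V X) V + gf (bracket X V) V by rewrite (D_swap X V) gfDl.
have e7 := metric_rule X X H.
have e8 := DV_vertical hX vV vb.
have Xc : X (cinf_const c0) = 0 by apply: cinfP => q; exact: (tan_const (vf_at X q)).
rewrite /curvature4 /curvature !gfDl !gfNl e1 e2 e3 gfDr e4 e8.
rewrite vf_N !vf_M Xc e5 e7 (gfC g V (D X V)) e6 e4.
rewrite (gfC g (bracket X V) V) !(cinfD, cinfN, cinfM, cinf_constE, cinf0).
move: (gf V V p) (gf (D X X) H p) (gf X (D X H) p) (gf X H p) (gf V (bracket X V) p).
by move: (gf (D V X) (D V X) p) => r1 r2 r3 r4 r5 r6; ring.
Qed.

Lemma gf_hor_ge0 X p : hor X -> 0 <= gf X X p.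
Proof. by move=> hX; apply: (horizontal_ge0 sub Rie); exact: hX. Qed.

Lemma mixed_le0 X V p : hor X -> ver V -> vf_at X p != 0 -> vf_at V p != 0 ->
  curvature4 g D X V X V p <= 0.
Proof.
move=> hX vV X0 V0; have := mix (hX p) X0 (vV p) V0; rewrite /sectional (gf_hv hX vV) cinf0.
rewrite expr0n subr0 gfE => K0.
have d0 : g p (vf_at X p) (vf_at X p) * gf V V p < 0.
  by rewrite pmulr_rlt0 ?(horizontal_pos sub Rie (hX p) X0) // (vertical_neg sub Rie ind nm (vV p)
    V0).
rewrite -[curvature4 _ _ _ _ _ _ _](divfK (ltr0_neq0 d0)).
exact: mulr_ge0_le0 K0 (ltW d0).
Qed.

Lemma mean_curvature_zero : H = 0.
Proof.
apply: vf_ext => q0; rewrite vf_at0.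
have [hH [H' HH']] := bH.
have [f fE] := gf_basic bH bH.
have cf : continuous (f : B -> R).
  by move=> b; apply: smooth_at_continuous; exact: cinf_smooth_at.
have [|b _ bmax] := compact_EVT_max (A := [set: B]) (f := f) _ cB (continuous_subspaceT cf).
  by exists (prj q0).
have [p pb] := subm_surj sub b.
have pmax q : gf H H q <= gf H H p.
  rewrite fE -[leLHS]/(f (prj q)) -[leRHS]/(f (prj p)) pb; apply: bmax; exact: in_setT.
(* If [H] vanishes at the maximum point then [g(H, H) <= 0] everywhere, and positivity on horizontal
   vectors finishes. *)
suff Hp : vf_at H p = 0.
  apply/eqP; apply: contraT => Hq; have := pmax q0; rewrite !gfE Hp g0l.
  by rewrite leNgt (horizontal_pos sub Rie (hH q0) Hq).
apply/eqP; apply: contraT => Hp.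
have [v [vv v0]] := vertical_nonzero prj nm p.
have [V [vV Vv]] := vertical_extension sub vv.
have Vp : vf_at V p != 0 by rewrite Vv.
have := mixed_le0 hH vV Hp Vp; rewrite (mixed_curvature p bH vV).
have DH0 : gf H (D H H) p = 0.
  have h : H (gf H H) p = gf (D H H) H p + gf H (D H H) p.
    exact: (congr1 (fun f : Cinf M => f p) (metric_rule H H H)).
  have h2 : H (gf H H) p = 0 := tan_max (vf_at H p) pmax.
  by rewrite (gfC g (D H H)) h2 in h; move: (gf H (D H H) p) h => r; lra.
have W0 := gf_hor_ge0 p (DV_horizontal hH vV).
have HH0 := horizontal_pos sub Rie (hH p) Hp.
have VV0 := vertical_neg sub Rie ind nm (vV p) Vp.
rewrite DH0 mulr0 sub0r mulrN => le0.
have : 0 < - (gf V V p * (c0 * gf H H p) ^+ 2).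
  by rewrite -mulNr mulr_gt0 ?oppr_gt0 // exprn_gt0 // mulr_gt0.
by move: le0 W0; move: (gfun g (_ + _) (_ + _) p) (_ * _ ^+ 2) => a b'; lra.
Qed.

Lemma fibres_totally_geodesic : totally_geodesic_fibres g prj D.
Proof.
by move=> U V vU vV p; rewrite umb // mean_curvature_zero vf_at0 scaler0.
Qed.

Lemma gf_H0 X : gf X H = 0.
Proof. by apply: cinfP => q; rewrite mean_curvature_zero gfE vf_at0 g0r. Qed.

Lemma DV_hor X V : hor X -> ver V -> hor (D V X).
Proof.
move=> hX vV; have hW : hor _ := DV_horizontal hX vV.
by move: hW; rewrite gf_H0 mulr0 scale0r addr0.
Qed.

Lemma mixed_curvature0 X V p : basic g prj X -> ver V ->
  curvature4 g D X V X V p = gf (D V X) (D V X) p.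
Proof.
move=> bX vV; have E := mixed_curvature p bX vV; cbv zeta in E.
rewrite E {E} gf_H0 !mulr0 scale0r addr0.
have gX0 : gf X 0 p = 0 by rewrite gfE vf_at0 g0r.
rewrite mean_curvature_zero (D0r LC) !gX0.
by rewrite !mulr0 expr0n subr0 mulr0 add0r.
Qed.

(** Were [D V X] nonzero at [p], the curvature there would be positive, against [mixed_le0]. That
    bound is about nonzero vectors, hence the separate treatment of [V] or [X] vanishing at [p]. *)
Lemma DV_zero X V p : basic g prj X -> ver V -> vf_at (D V X) p = 0.
Proof.
move=> bX vV; have hX := bX.1; have hD := DV_hor hX vV.
apply/eqP; apply: contraT => D0.
have Dpos := horizontal_pos sub Rie (hD p) D0.
have [V0|V0] := eqVneq (vf_at V p) 0.
  move: D0; rewrite (_ : vf_at (D V X) p = 0) ?eqxx //; apply: tangentP => f.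
  apply: (@tensor_zero _ _ _ p (fun V => D V X f p)) => // [Y Z|h Y].
    by rewrite (DD LC).
  by rewrite (DZ LC).
(* For [X] zero at [p], a basic [Y] equal to [D V X] at [p] is used: [g(X, Y)] is constant along
   fibres, and its derivative along [V] at [p] is [g(D V X, D V X)]. *)
have [X0|X0] := eqVneq (vf_at X p) 0.
  have [Y [bY YE]] := basic_extension sub (hD p).
  have := congr1 (fun f : Cinf M => f p) (metric_rule V X Y).
  rewrite (ver_gf_basic bX bY vV) cinf0 cinfD !gfE X0 g0l addr0 YE => E.
  by move: Dpos; rewrite -E ltxx.
have := mixed_le0 hX vV X0 V0; rewrite mixed_curvature0 // gfE.
by rewrite leNgt Dpos.
Qed.

Lemma mixed_flat p (X V : vfield M) :
  horizontal g prj (vf_at X p) -> vertical prj (vf_at V p) -> sectional g D X V p = 0.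
Proof.
move=> hX vV; have [X1 [bX1 X1E]] := basic_extension sub hX.
have [V1 [vV1 V1E]] := vertical_extension sub vV.
rewrite /sectional (curvature4_tensor LC (esym X1E) (esym V1E) (esym X1E) (esym V1E)).
by rewrite mixed_curvature0 // gfE DV_zero // g0l mul0r.
Qed.

(** For basic [Z] and [T], [g(D_Z T, V) = - g(T, D_V Z + [Z, V])]; [D_V Z] vanishes and [[Z, V]] is
    vertical. So O'Neill's integrability tensor is zero. *)
Lemma bracket_horizontal X Y : basic g prj X -> basic g prj Y -> hor (bracket X Y).
Proof.
move=> bX bY p; apply: hor_test => V vV; rewrite -gfE -(LC_torsion LC) gfDl gfNl.
have e Z T : basic g prj Z -> basic g prj T -> gf (D Z T) V p = 0.
  move=> bZ bT; have := congr1 (fun f : Cinf M => f p) (metric_rule Z T V).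
  rewrite (gf_hv bT.1 vV) vf_0 cinf0 (D_swap Z V) gfDr !cinfD (gf_hv bT.1 (bracket_vertical bZ vV)).
  by rewrite [gf T _ p]gfE DV_zero // g0r cinf0 !addr0.
by rewrite cinfD cinfN !e // subrr.
Qed.

(** Infinitesimal form of the flow of [X] acting isometrically on the fibres: only the terms [D U X]
    and [D V X] could contradict it, and they vanish. *)
Lemma basic_derivative X U V p : basic g prj X -> ver U -> ver V ->
  X (gf U V) p = gf (bracket X U) V p + gf U (bracket X V) p.
Proof.
move=> bX vU vV; rewrite metric_rule (D_swap X U) (D_swap X V) gfDl gfDr !cinfD.
by rewrite [gf (D U X) V p]gfE [gf U (D V X) p]gfE !DV_zero // g0l g0r !add0r.
Qed.

End Geometry.

(** * Adapted charts *)

Section ChartTools.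
Context {R : realType} {n : nat} {M : @manifold R n}.
Implicit Types (p q : M) (X Y V : vfield M).

Lemma near_open (T : topologicalType) (U : set T) (P : T -> Prop) x : open U -> U x ->
  (forall y, U y -> P y) -> \near x, P x.
Proof. by move=> oU Ux H; apply: filterS (open_near oU Ux). Qed.

Lemma vf_near X q (f h : Cinf M) : (\near q, f q = h q) -> X f q = X h q.
Proof. exact: (tan_near (vf_at X q)). Qed.

Lemma bracket_near q X X' Y Y' : (\near q, vf_at X q = vf_at X' q) ->
  (\near q, vf_at Y q = vf_at Y' q) -> vf_at (bracket X Y) q = vf_at (bracket X' Y') q.
Proof.
move=> XX YY; apply: tangentP => f.
have e X1 X2 h : (\near q, vf_at X1 q = vf_at X2 q) -> \near q, X1 h q = X2 h q.
  by apply: filterS => r H; exact: (congr1 (fun t : tangent r => t h) H).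
rewrite -[LHS]/(X (Y f) q - Y (X f) q) -[RHS]/(X' (Y' f) q - Y' (X' f) q).
rewrite (vf_near X (e _ _ f YY)) (vf_near Y (e _ _ f XX)).
by rewrite (nbhs_singleton (e _ _ _ XX)) (nbhs_singleton (e _ _ _ YY)).
Qed.

Lemma frame_bracket c W x (E : 'I_n -> vfield M) q i j : chart_frame c W x E -> W q ->
  vf_at (bracket (E i) (E j)) q = 0.
Proof.
move=> F Wq; rewrite (frame_expand (vf_at _ q) F Wq) big1 // => k _.
have z a b : E a (E b (x k)) q = 0.
  rewrite (@vf_near _ _ _ (cinf_const (b == k)%:R)); first exact: (tan_const (vf_at (E a) q)).
  apply: near_open (cf_open F) Wq _ => r Wr.
  by rewrite (cf_dual F _ _ Wr) cinf_constE.
by rewrite -[vf_at _ q (x k)]/(E i (E j (x k)) q - E j (E i (x k)) q) !z subrr scale0r.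
Qed.

Lemma tan_chart c q (v : tangent q) (k : 'I_n -> Cinf M) f : admissible c -> dom c q ->
  (forall i, \near q, k i q = c q 0 i) ->
  v f = \sum_i v (k i) * 'D_(delta_mx 0 i) (f \o cinv c) (c q).
Proof.
move=> ac dq kc; have [W [x [E [F Wq]]]] := chart_frame_exists ac dq.
rewrite (cf_tan F v f Wq); apply: eq_bigr => i _; rewrite (cf_field F _ _ Wq); congr (_ * _).
apply: tan_near; apply: filterS2 (kc i) (open_near (cf_open F) Wq) => r -> Wr.
by rewrite (cf_coord F).
Qed.

Lemma chart_frame_extend c q X f : admissible c -> dom c q -> forall W x (E : 'I_n -> vfield M),
  chart_frame c W x E -> W q ->
  X f q = 'D_(\row_i X (x i) q) (f \o cinv c) (c q).
Proof.
move=> ac dq W x E F Wq; rewrite -[LHS]/(vf_at X q f) (cf_tan F _ f Wq).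
rewrite derive_sum_coord; last exact: chart_differentiable.
by apply: eq_bigr => i _; rewrite (cf_field F _ _ Wq) mxE.
Qed.

(** The new chart is [s] after [c]. Besides the bijection, admissibility uses that [G] and [s] are
    both smooth, one for each direction of the transition maps. *)
Lemma chart_change (c : @chart R M n) (V : set 'rV[R]_n) (G s : 'rV[R]_n -> 'rV[R]_n) :
  admissible c -> open V -> smooth_onv V G -> smooth_onv setT s ->
  open (G @` V) -> G @` V `<=` c @` dom c -> (forall y, V y -> s (G y) = y) ->
  exists e : @chart R M n, [/\ admissible e, e @` dom e = V,
    forall q, dom e q <-> dom c q /\ (G @` V) (c q),
    forall q, e q = s (c q) & forall w, cinv e w = cinv c (G w)].
Proof.
move=> ac oV sG ss oGV GVc sK.
pose de := [set q | dom c q /\ (G @` V) (c q)].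
have ode : open de.
  rewrite openE => q [dq Gq]; rewrite /interior.
  by apply: filterS2 (open_near (dom_open c) dq) (near_cmap dq (open_near oGV Gq)) => r.
have Gdc w : V w -> dom c (cinv c (G w)) /\ c (cinv c (G w)) = G w.
  by move=> Vw; have [] := chart_cinvK (@subset_refl _ (dom c)) (GVc _ (ex_intro2 _ _ w Vw erefl)).
have codE : (fun q => s (c q)) @` de = V.
  apply/seteqP; split=> [_ [q [dq [w Vw wq]] <-]|w Vw]; first by rewrite -wq sK.
  by have [h1 h2] := Gdc w Vw; exists (cinv c (G w)); [split=> //; rewrite h2;
    exists w|rewrite h2 sK].
have ocod : open ((fun q => s (c q)) @` de) by rewrite codE.
have cK q : de q -> cinv c (G (s (c q))) = q.
  by move=> [dq [w Vw wq]]; rewrite -wq sK // wq cmapK.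
have cc q : de q -> {for q, continuous (fun q => s (c q))}.
  move=> [dq _]; apply: continuous_comp; first exact: cmap_cont.
  exact: smoothv_continuous ss I.
have cic w : ((fun q => s (c q)) @` de) w -> {for w, continuous (fun w => cinv c (G w))}.
  rewrite codE => Vw; apply: continuous_comp; first exact: smoothv_continuous sG Vw.
  by apply: cinv_cont; apply: GVc; exists w.
pose e := Chart ode ocod cK cc cic; exists e; split=> //.
move=> c' Ac'; have [cc' c'c] := ac c' Ac'; split=> j.
- have sub : dom e `&` dom c' `<=` dom e by move=> q [].
  have oe : open (e @` (dom e `&` dom c')).
    by apply: chart_open => //; apply: openI => //; exact: dom_open.
  have S := smooth_comp oe (W := c @` (dom c `&` dom c')) _ (_ : smooth_onv _ G) (cc' j).
  apply: (smooth_ext oe _ (S _ _)) => //.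
    move=> _ [q [[dq [w Vw wq]] dq'] <-].
    by rewrite /= -wq sK //= wq; exists q.
  move=> i; apply: (smooth_sub _ (sG i)) => _ [q [[dq [w Vw wq]] dq'] <-].
  by rewrite /= -wq sK.
- have sub : dom c' `&` dom e `<=` dom c' by move=> q [].
  have oe : open (c' @` (dom c' `&` dom e)).
    by apply: chart_open => //; apply: openI => //; exact: dom_open.
  have S := smooth_comp oe (W := setT) (t := c \o cinv c') (fun _ _ => I) _ (ss j).
  apply: (smooth_ext oe _ (S _)) => // i.
  apply: (smooth_sub _ (c'c i)) => _ [q [dq [dq' _]] <-].
  by exists q.
Qed.

End ChartTools.

Lemma kernel_basis (K : fieldType) a b k (A : 'M[K]_(a, b)) : \rank (kermx A) = k ->
  exists L : 'M[K]_(k, a), L *m A = 0 /\ forall u : 'rV[K]_k, u *m L = 0 -> u = 0.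
Proof.
move=> <-; exists (row_base (kermx A)); split.
  by apply/sub_kermxP; rewrite eq_row_base.
move=> u uL; apply: (row_free_inj (row_base_free (kermx A))).
by rewrite uL mul0mx.
Qed.

Section AdaptedChart.
Context {R : realType} {n r : nat} {M : @manifold R (n + r)} {B : @manifold R n}.
Variables (g : metric M) (g' : metric B) (prj : smooth_map M B).
Hypothesis sub : semi_Riemannian_submersion g g' prj.
Hypothesis integrable : forall X Y : vfield M, basic g prj X -> basic g prj Y ->
  horizontal_field g prj (bracket X Y).

(** The norm is the sup norm, so [ad_cod] makes the image a cube, hence a product of two cubes.
    [ad_field] straightens the lifts on the entire cube, and by [ad_prj] the fibres are the slices
    with fixed first [n] coordinates. *)
Record adapted (p0 : M) (e : @chart R M (n + r)) (dl : R) (d : @chart R B n) (W' : set B)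
    (y : 'I_n -> Cinf B) (E' : 'I_n -> vfield B) (X : 'I_n -> vfield M) (b0 : 'rV[R]_n) : Prop :=
  Adapted {
  ad_pos : 0 < dl;
  ad_adm : admissible e;
  ad_dom : dom e p0;
  ad_center : e p0 = 0;
  ad_cod : e @` dom e = [set w | `|w| < dl];
  ad_frame : chart_frame d W' y E';
  ad_lift : forall i, horizontal_field g prj (X i) /\
    forall p, dmap prj (vf_at (X i) p) = vf_at (E' i) (prj p);
  ad_field : forall w (f : Cinf M) i, `|w| < dl ->
    'D_(delta_mx 0 (lshift r i)) (f \o cinv e) w = X i f (cinv e w);
  ad_prj : forall w, `|w| < dl -> W' (prj (cinv e w)) /\ prj (cinv e w) = cinv d (b0 + lsubmx w)
}.

(** The bracket is horizontal by integrability and projects to the bracket of two coordinate fields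
    of [B], which is zero. *)
Lemma lift_bracket (d : @chart R B n) W' y (E' : 'I_n -> vfield B) (X : 'I_n -> vfield M) q i l :
  chart_frame d W' y E' ->
  (forall i, horizontal_field g prj (X i) /\
    forall p, dmap prj (vf_at (X i) p) = vf_at (E' i) (prj p)) ->
  W' (prj q) -> vf_at (bracket (X i) (X l)) q = 0.
Proof.
move=> F' HX W'q; have bX j : basic g prj (X j).
  by split; [exact: (HX j).1|exists (E' j); exact: (HX j).2].
apply: (horizontal_vertical0 sub); first exact: integrable.
apply: tangentP => f.
rewrite -[LHS]/((X i (X l (pullback prj f)) - X l (X i (pullback prj f))) q).
rewrite !(basic_pullback _ (HX _).2).
have := congr1 (fun t : tangent (prj q) => t f) (frame_bracket i l F' W'q).
exact.
Qed.

(* The chart inverts [Th (b, u) = transport (b - (pi (S u) - pi z0)) (S u)], where [S] is an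
   affine slice tangent to the fibre; the correction of [b] makes [prj] read [b0 + b]. *)
Lemma adapted_chart p0 : exists e dl d W' y E' X b0, adapted p0 e dl d W' y E' X b0.
Proof.
have [c [W [x [E [ac dp F Wp]]]]] := frame_near p0.
have [d [W' [y [E' [ad dp' F' W'p]]]]] := frame_near (prj p0).
have /choice[X HX] i := basic_lift sub (E' i).
pose z0 := c p0; pose U := c @` dom c.
have oU : open U by exact: cod_open.
have Uz0 : U z0 by exists p0.
have cz0 : cinv c z0 = p0 by rewrite cmapK.
have sC (h : Cinf M) : smooth_on U (h \o cinv c).
  apply: smooth_local => _ [q dq <-].
  have [Wq [oWq Wqq sWq]] := (smooth_atE h ac dq).1 (cinf_smooth_at h q).
  by exists Wq.
pose xi l z : 'rV[R]_(n + r) := \row_i X l (x i) (cinv c z).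
have sxi l : smooth_onv U (xi l).
  by move=> i; apply: (smooth_ext oU _ (sC (X l (x i)))) => z _; rewrite mxE.
have /choice[Xi HXi] l := smooth_extendv oU Uz0 (sxi l).
have /choice[C HC] := HXi.
pose pz z : 'rV[R]_n := \row_j pullback prj (y j) (cinv c z).
have spz : smooth_onv U pz.
  by move=> j; apply: (smooth_ext oU _ (sC (pullback prj (y j)))) => z _; rewrite mxE.
have [Pz [CP [sPz nPz _]]] := smooth_extendv oU Uz0 spz.
pose K0 := \sum_i C i.
have sX l : smooth_onv setT (Xi l) by have [] := HC l.
have C0 l : 0 <= C l by have [_ _ []] := HC l.
have K00 : 0 <= K0 by apply: sumr_ge0 => l _; exact: C0.
have bX l z : `|Xi l z| <= K0.
  have [_ _ [_ H]] := HC l; apply: le_trans (H z) _.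
  by rewrite /K0 (bigD1 l) //= lerDl; apply: sumr_ge0 => j _; exact: C0.
have nX : \near z0, forall l, Xi l z0 = xi l z0.
  have H l : \near z0, Xi l z0 = xi l z0 by have [_ + _] := HC l.
  exact: (@filter_forall _ _ _ (nbhs z0) (nbhs_filter (z0 : 'rV[R]_(n + r))) H).
have nW : \forall z \near z0, W (cinv c z) /\ W' (prj (cinv c z)).
  have nq : \near p0, W p0 /\ W' (prj p0).
    have [cprj _] := smapP prj.
    have n2 : \near p0, W' (prj p0).
      by apply: (cprj p0 I); apply: open_nbhs_nbhs; split=> //; exact: cf_open F'.
    by apply: filterS2 (open_near (cf_open F) Wp) n2 => q.
  exact: near_cinv dp nq.
(* Within [ee] of [z0] all the globalized data are faithful; every later use of transport is
   confined to this ball. *)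
have [ee e0 He] : exists2 ee, 0 < ee & forall z, `|z - z0| < ee ->
    [/\ U z, W (cinv c z) /\ W' (prj (cinv c z)), Pz z = pz z & forall l, Xi l z = xi l z].
  have /nbhs_normP[ee /= e0 He] : \forall z \near z0,
      [/\ U z, W (cinv c z) /\ W' (prj (cinv c z)), Pz z = pz z & forall l, Xi l z = xi l z].
    apply: filterS2 (open_near oU Uz0) (filterI nW (filterI nPz nX)) => z Uz [h1 [h2 h3]].
    by split.
  by exists ee => // z ze; apply: He; rewrite /= distrC.
have near_ball z : `|z - z0| < ee -> \near z, `|z - z0| < ee.
  move=> ye; have : nbhs z (ball z0 ee).
    by apply: open_nbhs_nbhs; split; [exact: ball_open|rewrite -ball_normE /= distrC].
  by apply: filterS => w; rewrite -ball_normE /= distrC.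
have dC z (h : Cinf M) : `|z - z0| < ee -> differentiable (h \o cinv c) z.
  by move=> /He[Uz _ _ _]; exact: smooth_differentiable (sC h) Uz.
have XiE z l (f : Cinf M) : `|z - z0| < ee -> 'D_(Xi l z) (f \o cinv c) z = X l f (cinv c z).
  move=> ze; have [[q dq qz] [Wq _] _ ->] := He z ze.
  rewrite /xi -qz cmapK // in Wq *.
  by rewrite (chart_frame_extend _ _ ac dq F Wq).
have DXi z l v i : `|z - z0| < ee -> ('D_v (Xi l) z) 0 i = 'D_v (X l (x i) \o cinv c) z.
  move=> ze; rewrite derive_rV; last exact: smoothv_differentiable (sX l) I.
  apply: near_eq_derive; apply: filterS (near_ball z ze) => z' z'e.
  by have [_ _ _ ->] := He z' z'e; rewrite mxE.
have DPz z v j : `|z - z0| < ee -> ('D_v Pz z) 0 j = 'D_v (pullback prj (y j) \o cinv c) z.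
  move=> ze; rewrite derive_rV; last exact: smoothv_differentiable sPz I.
  apply: near_eq_derive; apply: filterS (near_ball z ze) => z' z'e.
  by have [_ _ -> _] := He z' z'e; rewrite mxE.
have comm z l i : `|z - z0| < ee -> 'D_(Xi l z) (Xi i) z = 'D_(Xi i z) (Xi l) z.
  move=> ze; apply/rowP => k; rewrite !DXi // !XiE //.
  have [_ [_ W'q] _ _] := He z ze.
  have := congr1 (fun t : tangent (cinv c z) => t (x k)) (lift_bracket l i F' HX W'q).
  by move/eqP; rewrite subr_eq0 => /eqP.
(* The lifts [X l] project to the coordinate fields [E' l], so in coordinates of [B] a motion along
   [comb Xi b] has velocity [b]. *)
have XiPz z (b : 'rV[R]_n) : `|z - z0| < ee -> 'D_(comb Xi b z) Pz z = b.
  move=> ze; rewrite /comb (derive_vsum _ _ _ sPz) [RHS]row_sum_delta.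
  apply: eq_bigr => l _; congr (_ *: _); apply/rowP => j; rewrite DPz // XiE //.
  have [_ [_ W'q] _ _] := He z ze.
  rewrite (basic_pullback _ (HX l).2) -[LHS]/(E' l (y j) (prj (cinv c z))) (cf_dual F' _ _ W'q).
  by rewrite mxE eqxx eq_sym.
have DPz0 v : 'D_v Pz z0 = v *m jac prj E y p0.
  have z0e : `|z0 - z0| < ee by rewrite subrr normr0.
  apply/rowP => j; rewrite DPz // derive_sum_coord; last exact: dC.
  rewrite [RHS]mxE; apply: eq_bigr => i _; congr (_ * _).
  by rewrite -(cf_field F _ _ Wp) mxE.
have rJ : \rank (jac prj E y p0) = n.
  apply/eqP; rewrite -/(row_full _); apply/row_fullP.
  have H j : exists u : 'rV[R]_(n + r), u *m jac prj E y p0 = delta_mx 0 j.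
    have [v vE] := subm_onto sub (vf_at (E' j) (prj p0)).
    exists (\row_i v (x i)); apply/rowP => k.
    transitivity (v (pullback prj (y k))).
      by rewrite (jac_tangent prj y F) // mxE; apply: eq_bigr => i _; rewrite mxE.
    rewrite -dmapE vE -[LHS]/(E' j (y k) (prj p0)) (cf_dual F' _ _ W'p).
    by rewrite mxE eqxx eq_sym.
  have [T HT] := choice H; exists (\matrix_j T j); apply/row_matrixP => j.
  by rewrite row_mul rowK HT row1.
(* The rows of [L] form a basis of the kernel of the differential of the projection at [p0], the
   fibre directions; rank [n] leaves exactly [r] of them. *)
have [L [LJ Lfree]] : exists L : 'M[R]_(r, n + r), L *m jac prj E y p0 = 0 /\
    forall u : 'rV[R]_r, u *m L = 0 -> u = 0.
  by apply: kernel_basis; rewrite mxrank_ker rJ addKn.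
pose S (u : 'rV[R]_r) := z0 + u *m L.
pose be (w : 'rV[R]_(n + r)) : 'rV[R]_n := lsubmx w - (Pz (S (rsubmx w)) - Pz z0).
pose Q (z : 'rV[R]_(n + (n + r))) := transport Xi (lsubmx z) (rsubmx z).
pose Th w := transport Xi (be w) (S (rsubmx w)).
have sl : smooth_onv setT (fun w : 'rV[R]_(n + r) => lsubmx w).
  by apply: (smoothv_lsub openT); exact: smoothv_id.
have sr : smooth_onv setT (fun w : 'rV[R]_(n + r) => rsubmx w).
  by apply: (smoothv_rsub openT); exact: smoothv_id.
have sS : smooth_onv setT (fun w : 'rV[R]_(n + r) => S (rsubmx w)).
  by apply: (smoothvD openT); [exact: smoothv_cst|exact: (smoothv_mulmx L openT sr)].
have sPS : smooth_onv setT (fun w : 'rV[R]_(n + r) => Pz (S (rsubmx w))).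
  exact: (smoothv_comp openT (fun _ _ => I) sS sPz).
have sbe : smooth_onv setT be.
  move=> j; have s1 := smoothB openT (sl j) (smoothB openT (sPS j) (smooth_cst _ (Pz z0 0 j))).
  have sub3 (a b t : 'rV[R]_n) : (a - (b - t)) 0 j = a 0 j - (b 0 j - t 0 j) by rewrite !mxE.
  by apply: (smooth_ext openT _ s1) => w _; rewrite /be sub3.
have sQ : smooth_onv setT Q by exact: smooth_transport sX K00 bX.
have sbS : smooth_onv setT (fun w => row_mx (be w) (S (rsubmx w))) by exact: (smoothv_row_mx openT).
have ThE w : Th w = Q (row_mx (be w) (S (rsubmx w))) by rewrite /Q row_mxKl row_mxKr.
have sTh : smooth_onv setT Th.
  have s1 := smoothv_comp openT (fun _ _ => I) sbS sQ.
  by move=> j; apply: (smooth_ext openT _ (s1 j)) => w _; rewrite ThE.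
have S0 : S 0 = z0 by rewrite /S mul0mx addr0.
have be0 : be 0 = 0 by rewrite /be !linear0 S0 !subrr.
have Th0 : Th 0 = z0 by rewrite /Th be0 linear0 S0 (transport0 sX K00 bX).
pose K := n%:R * K0.
have Kp : 0 <= K by rewrite mulr_ge0.
(* [N] collects the [w] for which everything reachable from the slice point with coefficients [be w]
   lies in the faithful ball. *)
have [N [oN N0 HN]] : exists N : set 'rV[R]_(n + r), [/\ open N, N 0 &
    forall w, N w -> forall z, `|z - S (rsubmx w)| <= K * `|be w| -> `|z - z0| < ee].
  pose rho (w : 'rV[R]_(n + r)) : R := K * `|be w| + `|S (rsubmx w) - z0|.
  have crho : continuous rho.
    move=> w; have c1 : be x @[x --> w] --> be w by exact: (smoothv_continuous sbe I).
    have c2 : S (rsubmx x) @[x --> w] --> S (rsubmx w) by exact: (smoothv_continuous sS I).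
    have n2 : (S (rsubmx x) - z0) @[x --> w] --> S (rsubmx w) - z0 by exact: (cvgB c2 (cvg_cst _)).
    exact: (cvgD (cvgM (cvg_cst K) (cvg_norm c1)) (cvg_norm n2)).
  exists (rho @^-1` [set t | t < ee]); split.
  - by apply: open_comp => // w _; exact: crho.
  - by rewrite /= /rho be0 linear0 S0 subrr !normr0 mulr0 addr0.
  - move=> w; rewrite /= /rho => Nw z zS; apply: le_lt_trans Nw.
    rewrite -(subrK (S (rsubmx w)) z) -addrA.
    by apply: le_trans (ler_normD _ _) _; rewrite lerD2r.
have Thz w : N w -> `|Th w - z0| < ee.
  by move=> Nw; apply: (HN w Nw); exact: (transport_bound sX K00 bX).
have PTh w : N w -> Pz (Th w) = Pz z0 + lsubmx w.
  move=> Nw; rewrite (transport_integral sX K00 bX (c := be w) sPz); last first.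
    by move=> z /(HN w Nw) ze; exact: XiPz.
  by rewrite /be opprB addrC addrA subrK addrC.
have dS w : differentiable (fun w : 'rV[R]_(n + r) => S (rsubmx w)) w.
  exact: smoothv_differentiable sS I.
have dbe w : differentiable be w by exact: smoothv_differentiable sbe I.
have dQ z : differentiable Q z by exact: smoothv_differentiable sQ I.
have dPz z : differentiable Pz z by exact: smoothv_differentiable sPz I.
have dTh z : differentiable Th z by exact: smoothv_differentiable sTh I.
have DS w v : 'D_v (fun w : 'rV[R]_(n + r) => S (rsubmx w)) w = rsubmx v *m L.
  have dr : differentiable (fun w : 'rV[R]_(n +
    r) => rsubmx w) w by exact: smoothv_differentiable sr I.
  have sm : smooth_onv setT (fun u : 'rV[R]_r => u *m L) by exact: (smoothv_mulmx L openT
    (@smoothv_id _ _ _)).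
  have dm : differentiable (mulmxr L : {linear 'rV[R]_r -> 'rV[R]_(n +
    r)}) (rsubmx w) by exact: smoothv_differentiable sm I.
  rewrite /S deriveD; last 2 first.
  - exact: derivable_cst.
  - apply: diff_derivable; exact: (@differentiable_comp _ _ _ _ (fun w : 'rV[R]_(n +
    r) => rsubmx w) (mulmxr L)).
  rewrite derive_cst add0r (derive_comp (f := mulmxr L) v dr dm) derive_rsubmx // derive_idE.
  rewrite deriveE // diff_lin //.
  by move=> u; exact: smoothv_continuous sm I.
have Dbe w v : 'D_v be w = lsubmx v - 'D_(rsubmx v *m L) Pz (S (rsubmx w)).
  have dl : differentiable (fun w : 'rV[R]_(n +
    r) => lsubmx w) w by exact: smoothv_differentiable sl I.
  have dPS : differentiable (fun w : 'rV[R]_(n +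
    r) => Pz (S (rsubmx w))) w by exact: smoothv_differentiable sPS I.
  have dc : derivable (cst (Pz z0) : 'rV[R]_(n + r) -> 'rV[R]_n) w v by exact: derivable_cst.
  have E1 := deriveB (diff_derivable (v := v) dPS) dc.
  have E2 := deriveB (diff_derivable (v := v) dl) (derivableB (diff_derivable (v := v) dPS) dc).
  have E3 : 'D_v (cst (Pz z0) : 'rV[R]_(n + r) -> 'rV[R]_n) w = 0 := derive_cst _ _ _.
  have E4 := derive_comp v (dS w) (dPz (S (rsubmx w))); rewrite DS in E4.
  have E5 : 'D_v (fun w : 'rV[R]_(n + r) => lsubmx w) w = lsubmx v.
    by rewrite derive_lsubmx // derive_idE.
  apply: (etrans E2); apply: (etrans (congr2 (fun a b => a - b) E5 E1)).
  apply: (etrans (congr2 (fun a b => lsubmx v - (a - b)) E4 E3)).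
  exact: (congr1 (fun t => lsubmx v - t) (subr0 _)).
have DTh w v : 'D_v Th w = 'D_(row_mx ('D_v be w) (rsubmx v *m L)) Q (row_mx (be w) (S (rsubmx w))).
  have -> : Th = (fun w => Q (row_mx (be w) (S (rsubmx w)))) by apply/funext => ?; exact: ThE.
  have db : differentiable (fun w => row_mx (be w) (S (rsubmx w))) w by exact:
    smoothv_differentiable sbS I.
  apply: (etrans (derive_comp v db (dQ (row_mx (be w) (S (rsubmx w)))))).
  have E1 := etrans (derive_row_mx v (dbe w) (dS w)) (congr1 (row_mx ('D_v be w)) (DS w v)).
  exact: (congr1 (fun u => 'D_u Q (row_mx (be w) (S (rsubmx w)))) E1).
(* Along the first coordinates the slice point is fixed and [be] moves along [delta_mx 0 i], so this
   is the derivative of transport in its coefficients, given by [transport_derive]. *)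
have DTh_b w i : N w -> 'D_(delta_mx 0 (lshift r i)) Th w = Xi i (Th w).
  move=> Nw; rewrite DTh Dbe.
  have rd : rsubmx (delta_mx 0 (lshift r i) : 'rV[R]_(n + r)) = 0.
    by apply/rowP => k; rewrite !mxE eq_rlshift andbF.
  have ld : lsubmx (delta_mx 0 (lshift r i) : 'rV[R]_(n + r)) = delta_mx 0 i.
    by apply/rowP => k; rewrite !mxE eq_lshift.
  rewrite rd ld mul0mx derive0 subr0.
  rewrite -(@transport_derive _ _ _ Xi K0 sX K00 bX (be w) (S (rsubmx w)) i); last first.
    by move=> z /(HN w Nw) ze l; exact: comm.
  have di : differentiable (fun b : 'rV[R]_n => b) (be w) by [].
  have dc : differentiable (fun _ : 'rV[R]_n => S (rsubmx w)) (be w) by exact: differentiable_cst.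
  have dr : differentiable (fun b : 'rV[R]_n => row_mx b (S (rsubmx w))) (be w).
    apply: (@smoothv_differentiable _ _ _ setT) => //.
    by apply: (smoothv_row_mx openT); [exact: smoothv_id|exact: smoothv_cst].
  have -> : transport Xi ^~ (S (rsubmx w)) = (fun b => Q (row_mx b (S (rsubmx w)))).
    by apply/funext => b; rewrite /Q row_mxKl row_mxKr.
  have E1 := derive_comp (delta_mx 0 i) dr (dQ (row_mx (be w) (S (rsubmx w)))).
  apply: esym; apply: (etrans E1).
  have E2 := derive_row_mx (delta_mx 0 i) di dc.
  have E3 : 'D_(delta_mx 0 i) (fun _ : 'rV[R]_n => S (rsubmx w)) (be w) = 0 := derive_cst _ _ _.
  rewrite derive_idE E3 in E2.
  exact: (congr1 (fun u => 'D_u Q (row_mx (be w) (S (rsubmx w)))) E2).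
(* For [v] in the kernel, [Pz (Th w) = Pz z0 + lsubmx w] gives [lsubmx v = 0]. The derivative then
   reduces to [rsubmx v *m L]: the correction in [be] has derivative zero since [L] is in the kernel
   of [jac], and [transport 0] is the identity. [Lfree] concludes. *)
have uJ : 'J Th 0 \in unitmx.
  apply: unitmx_ker => v; rewrite -deriveEjacobian // => Dv0.
  have v1 : lsubmx v = 0.
    have E1 := derive_comp v (dTh 0) (dPz (Th 0)); rewrite Dv0 derive0 in E1.
    have nP : \forall w \near (0 : 'rV[R]_(n + r)), Pz (Th w) = Pz z0 + lsubmx w.
      by apply: filterS (open_near oN N0) => w Nw; rewrite PTh.
    have dl : differentiable (fun w : 'rV[R]_(n +
      r) => lsubmx w) 0 by exact: smoothv_differentiable sl I.
    have dc : derivable (cst (Pz z0) : 'rV[R]_(n + r) -> 'rV[R]_n) 0 v by exact: derivable_cst.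
    have E2 := deriveD dc (diff_derivable (v := v) dl).
    have E3 : 'D_v (cst (Pz z0) : 'rV[R]_(n + r) -> 'rV[R]_n) 0 = 0 := derive_cst _ _ _.
    have E5 : 'D_v (fun w : 'rV[R]_(n + r) => lsubmx w) 0 = lsubmx v.
      by rewrite derive_lsubmx // derive_idE.
    have {}E2 := etrans E2 (congr2 (fun a b => a + b) E3 E5).
    have E6 := near_eq_derive v nP.
    apply: (etrans (esym (add0r (lsubmx v)))).
    exact: (etrans (esym E2) (etrans (esym E6) E1)).
  move: Dv0; rewrite DTh Dbe v1 be0 linear0 S0 DPz0 -mulmxA LJ mulmx0 subr0 => Dv0.
  have v2 : rsubmx v = 0.
    apply: Lfree.
    have di : differentiable (fun b : 'rV[R]_(n + r) => b) z0 by [].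
    have dc : differentiable (fun _ : 'rV[R]_(n + r) => (0 :
      'rV[R]_n)) z0 by exact: differentiable_cst.
    have dr : differentiable (fun z : 'rV[R]_(n + r) => row_mx (0 : 'rV[R]_n) z) z0.
      apply: (@smoothv_differentiable _ _ _ setT) => //.
      by apply: (smoothv_row_mx openT); [exact: smoothv_cst|exact: smoothv_id].
    have E1 := derive_comp (rsubmx v *m L) dr (dQ (row_mx 0 z0)).
    have E2 := derive_row_mx (rsubmx v *m L) dc di.
    have E3 : 'D_(rsubmx v *m L) (fun _ : 'rV[R]_(n + r) => (0 : 'rV[R]_n)) z0 = 0 :=
      derive_cst _ _ _.
    rewrite derive_idE E3 in E2.
    have {}E1 := etrans E1 (congr1 (fun u => 'D_u Q (row_mx 0 z0)) E2); rewrite Dv0 in E1.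
    have E4 : (fun z : 'rV[R]_(n + r) => z) = (fun z => Q (row_mx (0 : 'rV[R]_n) z)).
      by apply/funext => z; rewrite /Q row_mxKl row_mxKr (transport0 sX K00 bX).
    apply: (etrans (esym (derive_idE z0 (rsubmx v *m L)))).
    exact: (etrans (congr1 (fun h : 'rV[R]_(n + r) -> 'rV[R]_(n +
      r) => 'D_(rsubmx v *m L) h z0) E4) E1).
  by rewrite -[v]hsubmxK v1 v2 row_mx0.
have [V [sg [oV V0 VN oTV [ssg sgK]]]] := inverse_function oN N0 (fun j => smooth_sub (@subsetT _
  N) (sTh j)) uJ.
(* Shrinking the domain to a ball of the sup norm turns the image of the chart into a cube. *)
have /nbhs_normP[dl /= dl0 HV] := open_near oV V0.
pose V2 := [set w : 'rV[R]_(n + r) | `|w| < dl].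
have V2V w : V2 w -> V w by move=> Vw; apply: HV; rewrite /= sub0r normrN.
have oV2 : open V2.
  apply: (@open_comp _ _ (fun w : 'rV[R]_(n + r) => `|w|) [set t | t < dl]); last exact: open_lt.
  by move=> w _; exact: norm_continuous.
have oTV2 : open (Th @` V2).
  have -> : Th @` V2 = Th @` V `&` sg @^-1` V2.
    apply/seteqP; split=> [_ [w V2w <-]|_ [[w Vw <-]] /=].
      by split; [exists w => //; exact: V2V|rewrite /= sgK //; exact: V2V].
    by rewrite sgK // => V2w; exists w.
  by apply: openI => //; apply: open_comp => // z _; exact: smoothv_continuous ssg I.
have TV2U : Th @` V2 `<=` c @` dom c.
  by move=> _ [w /V2V/VN Nw <-]; have [Uz _ _ _] := He _ (Thz w Nw).
have [e [ae ecod edom eE einv]] := chart_change ac oV2 (fun j => smooth_sub (@subsetT _ V2) (sTh j))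
  ssg oTV2 TV2U (fun w h => sgK w (V2V w h)).
have V20 : V2 0 by rewrite /V2 /= normr0.
exists e, dl, d, W', y, E', X, (Pz z0); split => //.
- by apply/edom; split=> //; exists 0 => //; rewrite Th0.
- by rewrite eE -/z0 -Th0 sgK.
- move=> w f i Vw; have Nw := VN _ (V2V w Vw).
  have -> : f \o cinv e = (fun w => (f \o cinv c) (Th w)).
    by apply/funext => w'; rewrite /= einv.
  rewrite (derive_comp (f := f \o cinv c) _ (dTh w) (dC _ _ (Thz w Nw))) DTh_b //.
  by rewrite XiE ?einv //; exact: Thz.
- move=> w Vw; have Nw := VN _ (V2V w Vw); rewrite einv.
  have [_ [Wq W'q] PE _] := He _ (Thz w Nw); split=> //.
  rewrite -PTh // PE; set q := cinv c (Th w).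
  have -> : pz (Th w) = d (prj q).
    by apply/rowP => j; rewrite mxE -(cf_coord F' _ W'q).
  by rewrite cmapK //; exact: cf_dom F' _ W'q.
Qed.

End AdaptedChart.

(** * Cubes as manifolds *)

Section Box.
Context {R : realType} (k : nat).

Lemma rV_second_countable : @second_countable 'rV[R]_k.
Proof.
pose cen (q : 'rV[rat]_k) : 'rV[R]_k := map_mx ratr q.
exists ((fun c : 'rV[rat]_k * rat => ball (cen c.1) (ratr c.2)) @` setT).
  exact: card_le_trans (card_image_le _ _) (countableP _).
split=> [_ [c _ <-]|x A nA]; first exact: ball_open.
have /nbhs_normP[eps /= e0 He] := nA.
(* With a rational radius below [eps / 2] and a centre nearer to [x] than this radius, the ball
   contains [x] and lies within [eps] of it. *)
have e2 : 0 < eps / 2 by rewrite divr_gt0.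
have [s] := rat_in_itvoo e2; rewrite in_itv /= => /andP[s0 s1].
have H j : exists q : rat, `|ratr q - x 0 j| < ratr s.
  have lt : x 0 j - ratr s < x 0 j + ratr s :> R by rewrite ltrBlDr -addrA ltrDl addr_gt0.
  have [q] := rat_in_itvoo lt; rewrite in_itv /= => /andP[q1 q2]; exists q.
  by rewrite ltr_norml; apply/andP; split; lra.
have [q Hq] := choice H.
have nq : ball (cen (\row_j q j)) (ratr s) x.
  rewrite -ball_normE /=; have : `|cen (\row_j q j) - x| < ratr s.
    rewrite [ltLHS]/Num.Def.normr/= mx_normrE; apply/bigmax_ltP; split=> // -[i j] _ /=.
    by rewrite (ord1 i) !mxE.
  by [].
exists (ball (cen (\row_j q j)) (ratr s)).
  by split=> //=; exists (\row_j q j, s).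
move=> y /= yb; apply: He => /=; 
move: nq yb; rewrite -!ball_normE /= => h1 h2.
have -> : x - y = (cen (\row_j q j) - y) - (cen (\row_j q j) - x).
  by rewrite opprB [RHS]addrC subrKA.
apply: le_lt_trans (ler_normB _ _) _; lra.
Qed.

Lemma rV_connected : connected [set: 'rV[R]_k].
Proof.
have -> : [set: 'rV[R]_k] = \bigcup_(x in [set: 'rV[R]_k]) ((fun t : R^o => t *: x) @` [set: R]).
  by apply/seteqP; split=> // x _; exists x => //; exists 1 => //; rewrite scale1r.
apply: bigcup_connected; first by exists 0 => x _; exists 0 => //; rewrite scale0r.
move=> x _; apply: connected_continuous_connected.
  by apply/connected_intervalP => a b _ _ c _.
by apply: continuous_subspaceT => t; exact: (@scalel_continuous _ _ x t).
Qed.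

Variables (dl : R) (dl0 : 0 < dl).

Definition squash (x : 'rV[R]_k) := (dl / (1 + `|x|)) *: x.
Definition unsquash (y : 'rV[R]_k) := (dl - `|y|)^-1 *: y.

Let norm1 (x : 'rV[R]_k) : 0 < 1 + `|x|. Proof. by rewrite ltr_wpDr. Qed.

Lemma squash_norm x : `|squash x| = dl * `|x| / (1 + `|x|).
Proof. by rewrite normrZ ger0_norm ?divr_ge0 ?(ltW dl0) ?(ltW (norm1 x)) // mulrAC. Qed.

Lemma squash_lt x : `|squash x| < dl.
Proof. by rewrite squash_norm ltr_pdivrMr // ltr_pM2l // ltrDr. Qed.

Lemma squashK x : unsquash (squash x) = x.
Proof.
rewrite /unsquash squash_norm /squash scalerA.
have n0 : 1 + `|x| != 0 by rewrite gt_eqF.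
have -> : dl - dl * `|x| / (1 + `|x|) = dl / (1 + `|x|) by field.
by rewrite mulVf ?scale1r // mulf_neq0 ?invr_eq0 // gt_eqF.
Qed.

Lemma unsquashK y : `|y| < dl -> squash (unsquash y) = y.
Proof.
move=> yd; have d0 : 0 < dl - `|y| by rewrite subr_gt0.
have nd : dl - `|y| != 0 by rewrite gt_eqF.
rewrite /squash /unsquash normrZ scalerA ger0_norm ?invr_ge0 ?(ltW d0) //.
have dn : dl != 0 by rewrite gt_eqF.
have -> : dl / (1 + (dl - `|y|)^-1 * `|y|) / (dl - `|y|) = 1.
  by field; rewrite nd subrK dn.
by rewrite scale1r.
Qed.

Lemma squash_cod : squash @` setT = [set y | `|y| < dl].
Proof.
apply/seteqP; split=> [_ [x _ <-]|y yd]; first exact: squash_lt.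
by exists (unsquash y) => //; exact: unsquashK.
Qed.

Lemma squash_cod_open : open (squash @` setT).
Proof.
rewrite squash_cod; apply: (@open_comp _ _ (fun w : 'rV[R]_k => `|w|) [set t | t < dl]);
  last exact: open_lt.
by move=> w _; exact: norm_continuous.
Qed.

Lemma squash_cont x : setT x -> {for x, continuous squash}.
Proof.
move=> _; have c1 : (1 + `|y|) @[y --> x] --> 1 + `|x|.
  exact: (cvgD (cvg_cst (1 : R)) (@norm_continuous R 'rV[R]_k x)).
have n0 : 1 + `|x| != 0 by rewrite gt_eqF.
exact: (cvgZ (cvgM (cvg_cst dl) (cvgV n0 c1)) (@cvg_id _ _)).
Qed.

Lemma unsquash_cont y : (squash @` setT) y -> {for y, continuous unsquash}.
Proof.
rewrite squash_cod => yd; have c1 : (dl - `|z|) @[z --> y] --> dl - `|y|.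
  exact: (cvgB (cvg_cst dl) (@norm_continuous R 'rV[R]_k y)).
have n0 : dl - `|y| != 0 by rewrite gt_eqF // subr_gt0.
exact: (cvgZ (cvgV n0 c1) (@cvg_id _ _)).
Qed.

Definition box_chart : @chart R 'rV[R]_k k :=
  Chart openT squash_cod_open (fun x _ => squashK x) squash_cont unsquash_cont.

Lemma box_cover (p : 'rV[R]_k) : exists2 c, [set box_chart] c & dom c p.
Proof. by exists box_chart. Qed.

Lemma box_compat c c' : [set box_chart] c -> [set box_chart] c' -> chart_compat c c'.
Proof.
move=> -> -> j; rewrite setIid.
have oc := @cod_open _ _ _ box_chart.
apply: (smooth_ext oc _ (smooth_sub (@subsetT _ _) (@smoothv_id R k setT j))) => y.
by case=> q _ <- /=; rewrite squashK.
Qed.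

(* The open cube of half-side [dl]: all of ['rV_k] in a chart with image the cube, which
   spares a subtype; [squash] is only a homeomorphism, as transition maps do not see it. *)
Definition box : @manifold R k :=
  Manifold box_cover box_compat (@norm_hausdorff _ _) rV_second_countable rV_connected.

End Box.

(** * Tangent vectors and maps read in charts *)

Section ChartedMaps.
Context {R : realType}.

Lemma derive_along_line (V W : normedModType R) (f : V -> W) x v :
  (forall t, f (t *: v + x) = f x) -> 'D_v f x = 0.
Proof.
move=> H; rewrite /derive (_ : (fun h => _) = cst 0) ?lim_cst //.
by apply/funext => t /=; rewrite /= H subrr scaler0.
Qed.

Section Coordinates.
Context {k : nat} {L : @manifold R k}.
Variables (a : @chart R L k) (aa : admissible a) (aT : forall s, dom a s).

(** The chart is defined everywhere, so its coordinates are global smooth functions without any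
    cut-off. *)
Definition chart_coord i : Cinf L := cinf_build (fun q => smooth_at_chart i aa (aT q)).

Lemma chart_coord_tan q (v : tangent q) f :
  v f = \sum_i v (chart_coord i) * 'D_(delta_mx 0 i) (f \o cinv a) (a q).
Proof. by apply: tan_chart => // i; apply: filterE. Qed.

Lemma chart_coord_tan0 q (v : tangent q) : (forall i, v (chart_coord i) = 0) -> v = 0.
Proof.
move=> H; apply: tangentP => f; rewrite chart_coord_tan big1 // => i _.
by rewrite H mul0r.
Qed.

Lemma chart_coord_surj q (c : 'I_k -> R) : exists v : tangent q, forall i, v (chart_coord i) = c i.
Proof.
have [W [x [E [F Wq]]]] := chart_frame_exists aa (aT q).
exists (\sum_i c i *: vf_at (E i) q) => i; rewrite -[RHS](frame_coord c i F Wq).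
by apply: tan_near; apply: filterS (open_near (cf_open F) Wq) => r Wr; rewrite (cf_coord F).
Qed.

End Coordinates.

Section CoordTangent.
Context {k : nat} {M : @manifold R k}.
Variables (e : @chart R M k) (ae : admissible e).

(** The fields of a [chart_frame] are faithful only near a point; specifying the vector by its
    action gives one family over the whole image of the chart. The default 0 can occur only outside
    that image. *)
Definition coord_tan w j : tangent (cinv e w) :=
  xget 0 [set t : tangent (cinv e w) |
    forall f : Cinf M, t f = 'D_(delta_mx 0 j) (f \o cinv e) w].

Lemma coord_tanE w j (f : Cinf M) : (e @` dom e) w ->
  coord_tan w j f = 'D_(delta_mx 0 j) (f \o cinv e) w.
Proof.
move=> ew; rewrite /coord_tan; case: xgetP => [t -> //|H]; exfalso.
have [dq wq] := chart_cinvK (@subset_refl _ (dom e)) ew.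
have [W [x [E [F Wq]]]] := chart_frame_exists ae dq.
by apply: (H (vf_at (E j) (cinv e w))) => h; rewrite -[LHS]/(E j h (cinv e w)) (cf_field F _ _ Wq)
  wq.
Qed.

Lemma coord_tan_frame W x (E : 'I_k -> vfield M) w j : chart_frame e W x E ->
  (e @` dom e) w -> W (cinv e w) -> coord_tan w j = vf_at (E j) (cinv e w).
Proof.
move=> F ew Wq; apply: tangentP => f; rewrite coord_tanE //.
have [dq wq] := chart_cinvK (@subset_refl _ (dom e)) ew.
by rewrite -[RHS]/(E j f (cinv e w)) (cf_field F _ _ Wq) wq.
Qed.

Lemma coord_tan_free w (c : 'I_k -> R) : (e @` dom e) w ->
  \sum_j c j *: coord_tan w j = 0 -> forall j, c j = 0.
Proof.
move=> ew; have [dq wq] := chart_cinvK (@subset_refl _ (dom e)) ew.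
have [W [x [E [F Wq]]]] := chart_frame_exists ae dq.
rewrite (eq_bigr (fun j => c j *: vf_at (E j) (cinv e w))) => [H j|j _].
  by rewrite -(frame_coord c j F Wq) H tan_val0.
by rewrite (coord_tan_frame _ F).
Qed.

Definition coord_gram (g : metric M) i j w : R := g (cinv e w) (coord_tan w i) (coord_tan w j).

Lemma coord_gram_frame (g : metric M) W x (E : 'I_k -> vfield M) w i j : chart_frame e W x E ->
  (e @` dom e) w -> W (cinv e w) ->
  \forall z \near w, coord_gram g i j z = (gfun g (E i) (E j) \o cinv e) z.
Proof.
move=> F ew Wq; have [dq wq] := chart_cinvK (@subset_refl _ (dom e)) ew.
have nW := near_cinv dq (open_near (cf_open F) Wq); rewrite wq in nW.
apply: filterS2 (open_near (@cod_open _ _ _ e) ew) nW => z ez Wz.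
by rewrite /coord_gram !(coord_tan_frame _ F).
Qed.

Lemma coord_gram_smooth (g : metric M) i j w : (e @` dom e) w -> smooth_near (coord_gram g i j) w.
Proof.
move=> ew; have [dq wq] := chart_cinvK (@subset_refl _ (dom e)) ew.
have [W [x [E [F Wq]]]] := chart_frame_exists ae dq.
have S := (smooth_atE (gfun g (E i) (E j)) ae dq).1 (cinf_smooth_at _ _); rewrite wq in S.
apply: smooth_near_ext S; apply: filterS (coord_gram_frame g i j F ew Wq) => z.
exact: esym.
Qed.

End CoordTangent.

Section Maps.
Context {k l : nat} {L : @manifold R k} {M : @manifold R l}.
Variables (a : @chart R L k) (e : @chart R M l).
Hypotheses (La : forall c, atlas c -> c = a) (aT : forall s, dom a s) (ae : admissible e).

Lemma smooth_map_chart (t : 'rV[R]_k -> 'rV[R]_l) : smooth_onv (a @` dom a) t ->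
  (forall y, (a @` dom a) y -> (e @` dom e) (t y)) ->
  smooth_map_on [set: L] (fun s => cinv e (t (a s)) : M).
Proof.
move=> st te; have aO s : (a @` dom a) (a s) by exists s.
have ct (s : L) : {for s, continuous (fun s => cinv e (t (a s)))}.
  have c1 : {for a s, continuous (fun y => cinv e (t y))}.
    apply: (continuous_comp (f := t) (g := cinv e)); first exact: smoothv_continuous st (aO s).
    exact/cinv_cont/te.
  exact: (continuous_comp (cmap_cont (aT s)) c1).
split=> [p _|c c' /La -> Ac' j]; first exact: ct.
set W := dom a `&` setT `&` _.
have sW : W `<=` dom a by [].
have oW : open W.
  apply: openI; first by rewrite setIT; exact: dom_open.
  by apply: open_comp (dom_open c') => s _; exact: ct.
have oa : open (a @` W) by exact: chart_open.
have S := smooth_comp oa (W := e @` (dom e `&` dom c')) (t := t) _ _ ((ae Ac').1 j).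
apply: (smooth_ext oa _ (S _ _)).
- by move=> y /(chart_cinvK sW)[_ /= ->].
- move=> y /(chart_cinvK sW)[[_ d'] ay]; rewrite /= ay in d'.
  have [dq wq] := chart_cinvK (@subset_refl _ (dom e)) (te _ (eq_ind _ _ (aO (cinv a y)) _ ay)).
  by exists (cinv e (t y)).
- by move=> i; apply: (smooth_sub _ (st i)); exact: image_subset.
Qed.

Hypothesis (aa : admissible a).

Lemma dmap_chart (F : smooth_map L M) (t : 'rV[R]_k -> 'rV[R]_l) s (v : tangent s) f :
  (forall s, F s = cinv e (t (a s))) ->
  dmap F v f = \sum_j v (chart_coord aa aT j) * 'D_(delta_mx 0 j) (f \o cinv e \o t) (a s).
Proof.
move=> Ft; rewrite dmapE (chart_coord_tan aa aT); apply: eq_bigr => j _; congr (_ * _).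
apply: near_eq_derive; apply: filterS (open_near (@cod_open _ _ _ a) (ex_intro2 _ _ s (aT s)
  erefl)).
by move=> y /(chart_cinvK (@subset_refl _ (dom a)))[_ ay] /=; rewrite Ft ay.
Qed.

End Maps.

Lemma smooth_map_unchart k (L M : @manifold R k) (a : @chart R L k) (e : @chart R M k) :
  (forall c, atlas c -> c = a) -> (forall s, dom a s) -> admissible e -> a @` dom a = e @` dom e ->
  smooth_map_on (dom e) (fun q => cinv a (e q) : L).
Proof.
move=> La aT ae aeE.
have eO q : dom e q -> (a @` dom a) (e q) by rewrite aeE; exists q.
split=> [q dq|c c' Ac /La -> j].
  by apply: continuous_comp; [exact: cmap_cont|apply: cinv_cont; exact: eO].
set W := _ `&` _.
have WE : W = dom c `&` dom e by by apply/seteqP; split=> q; [case|move=> dq; split=> //;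
  exact: aT].
have oa : open (c @` W) by apply: chart_open; rewrite WE; [apply: openI;
  exact: dom_open|move=> ? []].
rewrite WE in oa *; apply: (smooth_ext oa _ ((ae c Ac).2 j)) => _ [q [dq dq'] <-] /=.
have := eO q dq'; rewrite cmapK // => /(chart_cinvK (@subset_refl _ (dom a)))[_ ->].
by [].
Qed.

End ChartedMaps.

(** * Metrics on a cube from prescribed coefficients *)

Section BoxMetric.
Context {R : realType} (k : nat) (dl : R) (dl0 : 0 < dl).
Notation L := (box k dl0).

Lemma box_admissible : @admissible R k L (box_chart k dl0).
Proof. by apply: atlas_admissible. Qed.

Definition box_coord i : Cinf L := chart_coord box_admissible (fun _ => I) i.

Variable G : 'I_k -> 'I_k -> 'rV[R]_k -> R.
Hypotheses (Gs : forall i j y, `|y| < dl -> smooth_near (G i j) y)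
  (Gsym : forall i j y, G i j y = G j i y)
  (Gdef : forall y (c : 'I_k -> R), `|y| < dl ->
     \sum_i \sum_j c i * c j * G i j y = 0 -> forall i, c i = 0).

(** Points of [L] are arbitrary row vectors, and the chart sends [q] to [squash dl q]; the
    coefficients live on the cube and are read there. *)
Definition box_form (q : L) (v w : tangent q) : R :=
  \sum_i \sum_j v (box_coord i) * w (box_coord j) * G i j (squash dl q).

Lemma box_form_linear q (b : R) (x y z : @tangent R k L q) :
  box_form (b *: x + y) z = b * box_form x z + box_form y z.
Proof.
rewrite /box_form mulr_sumr -big_split; apply: eq_bigr => i _.
rewrite mulr_sumr -big_split; apply: eq_bigr => j _.
rewrite -[(b *: x + y) _]/(b * x (box_coord i) + y (box_coord i)).
by rewrite /= !mulrDl !mulrA.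
Qed.

Lemma box_form_sym q (x y : @tangent R k L q) : box_form x y = box_form y x.
Proof.
rewrite /box_form exchange_big; apply: eq_bigr => i _; apply: eq_bigr => j _ /=.
by rewrite Gsym (mulrC (x _)).
Qed.

(** Pairing [x] with itself suffices, as [Gdef] excludes null vectors. This anisotropy is available
    because both blocks to be used are definite. *)
Lemma box_form_nondeg q (x : @tangent R k L q) : (forall y, box_form x y = 0) -> x = 0.
Proof.
move=> H; apply: (@chart_coord_tan0 R k L (box_chart k dl0) box_admissible (fun _ => I) q x) => i.
by apply: (Gdef (squash_lt dl0 q) (H x)).
Qed.

Lemma box_form_smooth (X Y : vfield L) : smooth_fun (fun q : L => box_form (vf_at X q) (vf_at Y q)).
Proof.
apply/smooth_funP => q; apply: smooth_at_sum => i; apply: smooth_at_sum => j.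
apply: smooth_atM; first by apply: smooth_atM; exact: cinf_smooth_at.
apply: (@smooth_at_comp _ _ _ _ (fun q : L => squash dl q)); last exact/Gs/squash_lt.
by move=> l; exact: (@smooth_at_chart R k L (box_chart k dl0) q l box_admissible I).
Qed.

Definition box_metric : metric L :=
  @Defs.Metric R k L box_form box_form_linear box_form_sym box_form_nondeg box_form_smooth.

End BoxMetric.

(** * Local products *)

Section LocalProduct.
Context {R : realType} {n r : nat} {M : @manifold R (n + r)} {B : @manifold R n}.
Variables (g : metric M) (g' : metric B) (prj : smooth_map M B).
Hypotheses (nm : (n < n + r)%N) (Rie : Riemannian g') (ind : has_index g (n + r - n))
  (sub : semi_Riemannian_submersion g g' prj).
Hypothesis integrable : forall X Y : vfield M, basic g prj X -> basic g prj Y ->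
  horizontal_field g prj (bracket X Y).
Hypothesis fibres_isometric : forall (X U V : vfield M) p, basic g prj X ->
  vertical_field prj U -> vertical_field prj V ->
  X (gfun g U V) p = gfun g (bracket X U) V p + gfun g U (bracket X V) p.

Section AtPoint.
Variables (p0 : M) (e : @chart R M (n + r)) (dl : R) (d : @chart R B n) (W' : set B)
  (y : 'I_n -> Cinf B) (E' : 'I_n -> vfield B) (X : 'I_n -> vfield M) (b0 : 'rV[R]_n).
Hypothesis A : adapted g prj p0 e dl d W' y E' X b0.

Let dl0 : 0 < dl := ad_pos A.
Let ae : admissible e := ad_adm A.
Notation dv := (coord_tan e).
Notation Gm := (coord_gram e g).
Notation hi := (lshift r).
Notation vi := (@rshift n r).

Let cod w : `|w| < dl -> (e @` dom e) w.
Proof. by rewrite (ad_cod A). Qed.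

Let basicX i : basic g prj (X i).
Proof. by have [h1 h2] := ad_lift A i; split=> //; exists (E' i). Qed.

Lemma adapted_field w i : `|w| < dl -> dv w (hi i) = vf_at (X i) (cinv e w).
Proof.
move=> wd; apply: tangentP => f; rewrite coord_tanE //; last exact: cod.
by rewrite (ad_field A).
Qed.

Lemma adapted_horizontal w i : `|w| < dl -> horizontal g prj (dv w (hi i)).
Proof. by move=> wd; rewrite adapted_field //; have [h _] := ad_lift A i; exact: h. Qed.

Lemma near_cube (w : 'rV[R]_(n + r)) : `|w| < dl -> \near w, `|w| < dl.
Proof.
move=> wd; have : open [set w : 'rV[R]_(n + r) | `|w| < dl].
  by rewrite -(ad_cod A); exact: cod_open.
by move=> oW; exact: (open_near oW).
Qed.

(** In the chart the projection depends on [lsubmx] only, so any function pulled back from [B] is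
    constant in the last [r] directions. *)
Lemma adapted_vertical w a : `|w| < dl -> vertical prj (dv w (vi a)).
Proof.
move=> wd; apply: tangentP => f; rewrite dmapE coord_tanE //; last exact: cod.
rewrite (@near_eq_derive _ _ _ _ (fun w => f (cinv d (b0 + lsubmx w)))).
  apply: derive_along_line => t; congr (f (cinv d (b0 + _))).
  by apply/rowP => j; rewrite !mxE eq_lrshift andbF mulr0 add0r.
by apply: filterS (near_cube wd) => z zd /=; have [_ ->] := ad_prj A zd.
Qed.

Lemma gram_cross w i a : `|w| < dl -> Gm (hi i) (vi a) w = 0.
Proof. by move=> wd; apply: adapted_horizontal => //; exact: adapted_vertical. Qed.

Lemma norm_horizontal_part (w : 'rV[R]_(n + r)) : `|w| < dl -> `|row_mx (lsubmx w) (0 :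
  'rV[R]_r)| < dl.
Proof.
move=> wd; apply: le_lt_trans wd; apply: norm_row_mx; first exact: norm_lsub.
by rewrite normr0.
Qed.

(** The coefficient is [g(X i, X j)], a function pulled back from [B], and both points have the same
    projection. *)
Lemma gram_horizontal w i j : `|w| < dl ->
  Gm (hi i) (hi j) w = Gm (hi i) (hi j) (row_mx (lsubmx w) 0).
Proof.
move=> wd; have wd' := norm_horizontal_part wd.
rewrite /coord_gram !adapted_field //.
have [f fE] := gf_basic sub (basicX i) (basicX j).
have H q : g q (vf_at (X i) q) (vf_at (X j) q) = f (prj q) := congr1 (fun h : Cinf M => h q) fE.
rewrite !H (ad_prj A wd).2 (ad_prj A wd').2.
by rewrite row_mxKl.
Qed.

(** In the chart [X i] is a coordinate field and commutes with the vertical coordinate fields, so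
    both bracket terms of [fibres_isometric] vanish. *)
Lemma gram_vertical_derive w i a b : `|w| < dl -> 'D_(delta_mx 0 (hi i)) (Gm (vi a) (vi b)) w = 0.
Proof.
move=> wd; have ew := cod wd.
have [dq wq] := chart_cinvK (@subset_refl _ (dom e)) ew.
have [W [x [E [F Wq]]]] := chart_frame_exists ae dq.
(* The frame fields are known to be vertical on [W] only; the factor [h] makes them vertical on all
   of [M] without changing them near the point. *)
have [h [K [cK KW h0 h1]]] := bump (open_near (cf_open F) Wq).
have inW q : W q -> `|e q| < dl /\ cinv e (e q) = q.
  move=> /(cf_dom F) dq'; split; last exact: cmapK.
  have : (e @` dom e) (e q) by exists q.
  by rewrite (ad_cod A).
have vV c : vertical_field prj (h *: E (vi c)).
  move=> q; rewrite vf_atZ; have [Wr|nW] := pselect (W q); last first.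
    by rewrite h0 ?scale0r; [exact: dmap0|move=> /KW].
  have [qd qe] := inW q Wr.
  have Hv := adapted_vertical c qd.
  rewrite (coord_tan_frame ae (vi c) F (cod qd)) ?qe // in Hv.
  by rewrite /vertical dmapZ Hv scaler0.
have near1 c : \forall q \near cinv e w, vf_at (h *: E (vi c)) q = vf_at (E (vi c)) q.
  by apply: filterS h1 => q hq; rewrite vf_atZ hq scale1r.
rewrite (@near_eq_derive _ _ _ _ (gfun g (h *: E (vi a)) (h *: E (vi b)) \o cinv e)); last first.
  have nab : \forall q \near cinv e w, vf_at (h *: E (vi a)) q = vf_at (E (vi a)) q /\
      vf_at (h *: E (vi b)) q = vf_at (E (vi b)) q.
    exact: (filterI (near1 a) (near1 b)).
  have nh := near_cinv dq nab; rewrite wq in nh.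
  apply: filterS2 (coord_gram_frame ae g (vi a) (vi b) F ew Wq) nh => z -> [Ea Eb].
  by rewrite /= -[RHS]/(g _ (vf_at _ (cinv e z)) (vf_at _ (cinv e z))) Ea Eb.
rewrite (ad_field A) // fibres_isometric //.
have Z c : vf_at (bracket (X i) (h *: E (vi c))) (cinv e w) = 0.
  rewrite -(frame_bracket (hi i) (vi c) F Wq); apply: bracket_near (near1 c).
  apply: filterS (open_near (cf_open F) Wq) => q Wr.
  have [qd qe] := inW q Wr; have := adapted_field i qd.
  by rewrite (coord_tan_frame ae (hi i) F (cod qd)) ?qe.
by rewrite !gfE !Z g0l g0r addr0.
Qed.

(** The mean value theorem on the segment from [row_mx 0 (rsubmx w)] to [w]: only the first [n]
    coordinates vary along it, and the derivatives in these directions vanish. *)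
Lemma gram_vertical w a b : `|w| < dl ->
  Gm (vi a) (vi b) w = Gm (vi a) (vi b) (row_mx 0 (rsubmx w)).
Proof.
move=> wd; set w0 := row_mx 0 _.
have seg t : 0 <= t <= 1 -> `|w0 + t *: (w - w0)| < dl.
  move=> /andP[t0 t1]; apply: le_lt_trans wd.
  have -> : w0 + t *: (w - w0) = row_mx (t *: lsubmx w) (rsubmx w).
    rewrite -[w in _ *: (w - _)]hsubmxK /w0 opp_row_mx add_row_mx scale_row_mx add_row_mx.
    by rewrite subrr scaler0 addr0 add0r subr0.
  apply: norm_row_mx; last exact: norm_rsub.
  rewrite normrZ ger0_norm //; apply: le_trans (norm_lsub w).
  by rewrite ler_piMl.
have ds z : `|z| < dl -> differentiable (Gm (vi a) (vi b)) z.
  move=> zd; have [W [oW Wz S]] := coord_gram_smooth ae g (vi a) (vi b) (cod zd).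
  exact: smooth_differentiable S Wz.
have [t t01 E] := MVT_line (fun t t01 => ds _ (seg t t01)).
apply/eqP; rewrite -subr_eq0 E derive_sum_coord; last exact/ds/seg.
apply/eqP; rewrite big_split_ord /= !big1 ?addr0 // => j _.
  by rewrite [(w - w0) _ _]mxE [(- w0) _ _]mxE row_mxEr mxE subrr scale0r.
by rewrite gram_vertical_derive ?scaler0 //; exact: seg.
Qed.

Lemma gram_sum w (u v : 'I_(n + r) -> R) :
  g (cinv e w) (\sum_i u i *: dv w i) (\sum_j v j *: dv w j) =
  \sum_i \sum_j u i * v j * Gm i j w.
Proof.
rewrite g_suml; apply: eq_bigr => i _; rewrite g_sumr; apply: eq_bigr => j _.
by rewrite gZl gZr mulrA.
Qed.

Lemma gram_split w (u v : 'I_(n + r) -> R) : `|w| < dl ->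
  \sum_i \sum_j u i * v j * Gm i j w =
  \sum_i \sum_j u (hi i) * v (hi j) * Gm (hi i) (hi j) (row_mx (lsubmx w) 0) +
  \sum_a \sum_b u (vi a) * v (vi b) * Gm (vi a) (vi b) (row_mx 0 (rsubmx w)).
Proof.
move=> wd; rewrite big_split_ord /=; congr (_ + _); apply: eq_bigr => i _.
  rewrite big_split_ord /= [X in _ + X]big1 ?addr0 => [|a _].
    by apply: eq_bigr => j _; rewrite gram_horizontal.
  by rewrite gram_cross ?mulr0.
rewrite big_split_ord /= [X in X + _]big1 ?add0r => [|a _].
  by apply: eq_bigr => j _; rewrite gram_vertical.
by rewrite /coord_gram gval_sym -/(Gm _ _ _) gram_cross ?mulr0.
Qed.

Lemma horizontal_gram_def (z : 'rV[R]_n) (c : 'I_n -> R) : `|z| < dl ->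
  \sum_i \sum_j c i * c j * Gm (hi i) (hi j) (row_mx z 0) = 0 -> forall i, c i = 0.
Proof.
move=> zd; have wd : `|row_mx z (0 : 'rV[R]_r)| < dl.
  by apply: le_lt_trans zd; apply: norm_row_mx => //; rewrite normr0.
set w := row_mx _ _ in wd *; pose x : tangent (cinv e w) := \sum_i c i *: dv w (hi i).
have -> : \sum_i \sum_j c i * c j * Gm (hi i) (hi j) w = g (cinv e w) x x.
  rewrite g_suml; apply: eq_bigr => i _; rewrite g_sumr; apply: eq_bigr => j _.
  by rewrite gZl gZr mulrA.
have hx : horizontal g prj x.
  by apply: horizontal_sum => i; apply: horizontalZ; exact: adapted_horizontal.
move=> gx; have x0 : x = 0.
  by apply/eqP/negPn/negP => /(horizontal_pos sub Rie hx); rewrite gx ltxx.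
pose c' (j : 'I_(n + r)) := match fintype.split j with inl i => c i | inr _ => 0 end.
have := @coord_tan_free _ _ _ e ae w c' (cod wd) _ (hi _).
rewrite big_split_ord /= [X in _ + X]big1 ?addr0 => [H i|a _]; last first.
  by rewrite /c' (unsplitK (inr a)) scale0r.
have := H _ i; rewrite /c' (unsplitK (inl i)); apply.
by rewrite -[RHS]x0; apply: eq_bigr => j _; rewrite (unsplitK (inl j)).
Qed.

Lemma vertical_gram_def (z : 'rV[R]_r) (c : 'I_r -> R) : `|z| < dl ->
  \sum_i \sum_j c i * c j * Gm (vi i) (vi j) (row_mx 0 z) = 0 -> forall i, c i = 0.
Proof.
move=> zd; have wd : `|row_mx (0 : 'rV[R]_n) z| < dl.
  by apply: le_lt_trans zd; apply: norm_row_mx => //; rewrite normr0.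
set w := row_mx _ _ in wd *; pose x : tangent (cinv e w) := \sum_i c i *: dv w (vi i).
have -> : \sum_i \sum_j c i * c j * Gm (vi i) (vi j) w = g (cinv e w) x x.
  rewrite g_suml; apply: eq_bigr => i _; rewrite g_sumr; apply: eq_bigr => j _.
  by rewrite gZl gZr mulrA.
have hx : vertical prj x.
  rewrite /vertical dmap_sum big1 // => i _; rewrite dmapZ.
  by have := adapted_vertical i wd; rewrite /vertical => ->; rewrite scaler0.
move=> gx; have x0 : x = 0.
  by apply/eqP/negPn/negP => /(vertical_neg sub Rie ind nm hx); rewrite gx ltxx.
pose c' (j : 'I_(n + r)) := match fintype.split j with inl _ => 0 | inr a => c a end.
have := @coord_tan_free _ _ _ e ae w c' (cod wd) _ (vi _).
rewrite big_split_ord /= [X in X + _]big1 ?add0r => [H i|a _]; last first.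
  by rewrite /c' (unsplitK (inl a)) scale0r.
have := H _ i; rewrite /c' (unsplitK (inr i)); apply.
by rewrite -[RHS]x0; apply: eq_bigr => j _; rewrite (unsplitK (inr j)).
Qed.

(** Serves both factors: [t] places the cube of dimension [k] as a coordinate slice of the large
    one, and [h] selects the coordinate directions of that slice. *)
Lemma gram_box_metric (k : nat) (h : 'I_k -> 'I_(n + r)) (t : 'rV[R]_k -> 'rV[R]_(n + r)) :
  (forall z, `|z| < dl -> `|t z| < dl) -> smooth_onv setT t ->
  (forall z (c : 'I_k -> R), `|z| < dl ->
    \sum_i \sum_j c i * c j * Gm (h i) (h j) (t z) = 0 -> forall i, c i = 0) ->
  exists gk : metric (box k dl0), forall q (x z : @tangent R k (box k dl0) q),
    gk q x z = \sum_i \sum_j x (box_coord dl0 i) * z (box_coord dl0 j) * Gm (h i) (h j) (t (squash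
      dl q)).
Proof.
move=> td st def.
have sG i j z : `|z| < dl -> smooth_near (fun z => Gm (h i) (h j) (t z)) z.
  move=> zd; apply: (@smooth_near_comp _ _ _ t).
    by move=> l; exists setT; split; [exact: openT|by []|exact: st].
  by apply: coord_gram_smooth => //; apply: cod; exact: td.
have symG i j z : Gm (h i) (h j) (t z) = Gm (h j) (h i) (t z) by exact: gval_sym.
by exists (box_metric dl0 sG symG def) => q x z.
Qed.

Notation N := (prod_manifold (box n dl0) (box r dl0)).
Let pc : @chart R N (n + r) := prod_chart (box_chart n dl0) (box_chart r dl0).

Let N_chart c : @atlas R _ N c -> c = pc.
Proof. by move=> [c1 [c2 [-> -> ->]]]. Qed.

Let pcT (s : N) : dom pc s. Proof. by []. Qed.

Let pcA : admissible pc.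
Proof. by apply: atlas_admissible; exists (box_chart n dl0), (box_chart r dl0). Qed.

Let pc_lt s : `|pc s| < dl.
Proof.
have [h1 h2] : `|squash dl s.1| < dl /\ `|squash dl s.2| < dl by split; exact: squash_lt.
have h : `|pc s| <= Num.max `|squash dl s.1| `|squash dl s.2|.
  by apply: norm_row_mx; rewrite le_max lexx ?orbT.
by apply: le_lt_trans h _; rewrite gt_max h1.
Qed.

Let pc_cod : pc @` dom pc = e @` dom e.
Proof.
rewrite (ad_cod A); apply/seteqP; split=> [_ [s _ <-]|w wd]; first exact: pc_lt.
exists (cinv pc w) => //=.
rewrite !unsquashK ?hsubmxK //; first exact: le_lt_trans (norm_rsub _) wd.
exact: le_lt_trans (norm_lsub _) wd.
Qed.

Lemma adapted_product : exists (gB : metric (box n dl0)) (gF : metric (box r dl0))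
    (f : Cinf (box n dl0)) (phi : smooth_map N M) (psi : M -> N),
  [/\ forall b, 0 < f b,
      open (range phi) /\ range phi p0,
      cancel phi psi,
      smooth_map_on (range phi) psi &
      forall (q : N) (x z : tangent q),
        g (phi q) (dmap phi x) (dmap phi z) =
        gB q.1 (dmap (prod_fst (box n dl0) (box r dl0)) x) (dmap (prod_fst (box n dl0) (box r
          dl0)) z) +
        (f q.1) ^+ 2 *
        gF q.2 (dmap (prod_snd (box n dl0) (box r dl0)) x) (dmap (prod_snd (box n dl0) (box r
          dl0)) z)].
Proof.
have [gB gBE] : exists gk : metric (box n dl0), forall q (x z : @tangent R n (box n dl0) q),
    gk q x z = \sum_i \sum_j x (box_coord dl0 i) * z (box_coord dl0 j) *
      Gm (hi i) (hi j) (row_mx (squash dl q) 0).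
  apply: (@gram_box_metric n hi (fun z => row_mx z 0)) horizontal_gram_def.
    by move=> z zd; apply: le_lt_trans zd; apply: norm_row_mx => //; rewrite normr0.
  by apply: (smoothv_row_mx openT); [exact: smoothv_id|exact: smoothv_cst].
have [gF gFE] : exists gk : metric (box r dl0), forall q (x z : @tangent R r (box r dl0) q),
    gk q x z = \sum_i \sum_j x (box_coord dl0 i) * z (box_coord dl0 j) *
      Gm (vi i) (vi j) (row_mx 0 (squash dl q)).
  apply: (@gram_box_metric r vi (fun z => row_mx 0 z)) vertical_gram_def.
    by move=> z zd; apply: le_lt_trans zd; apply: norm_row_mx => //; rewrite normr0.
  by apply: (smoothv_row_mx openT); [exact: smoothv_cst|exact: smoothv_id].
have sphi : smooth_map_on [set: N] (fun s => cinv e (pc s) : M).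
  apply: (smooth_map_chart (t := id) N_chart pcT ae); first exact: smoothv_id.
  by move=> z; rewrite pc_cod.
pose phi := SmoothMap sphi.
have ephi s : e (phi s) = pc s.
  by have [] := chart_cinvK (@subset_refl _ (dom e)) (cod (pc_lt s)).
have rE : range phi = dom e.
  apply/seteqP; split=> [_ [s _ <-]|q dq].
    by have [] := chart_cinvK (@subset_refl _ (dom e)) (cod (pc_lt s)).
  have : (pc @` dom pc) (e q) by rewrite pc_cod; exists q.
  by case=> s _ sq; exists s => //=; rewrite -[RHS](cmapK dq) -sq.
(* The product chart [pc] and [e] have the same cube as image, so [phi] identifies the product with
   [dom e], and its inverse there is [cinv pc] after [e]. *)
exists gB, gF, 1, phi, (fun q => cinv pc (e q)); split.
- by move=> b; rewrite cinf1.
- by rewrite rE; split; [exact: dom_open|exact: ad_dom A].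
- by move=> s; rewrite ephi; exact: cmapK.
- rewrite rE; exact: smooth_map_unchart N_chart pcT ae pc_cod.
move=> q x z; rewrite cinf1 expr1n mul1r.
have dphi (v : tangent q) : dmap phi v = \sum_j v (chart_coord pcA pcT j) *: dv (pc q) j.
  apply: tangentP => f; rewrite (dmap_chart (e := e) (t := id) pcT pcA) // tan_val_sum.
  by apply: eq_bigr => j _; rewrite tan_valZ coord_tanE //; exact/cod/pc_lt.
have c1 (v : tangent q) i : dmap (prod_fst (box n dl0) (box r dl0)) v (box_coord dl0 i) =
    v (chart_coord pcA pcT (hi i)).
  by rewrite dmapE; congr (v _); apply: cinfP => s /=; rewrite row_mxEl.
have c2 (v : tangent q) i : dmap (prod_snd (box n dl0) (box r dl0)) v (box_coord dl0 i) =
    v (chart_coord pcA pcT (vi i)).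
  by rewrite dmapE; congr (v _); apply: cinfP => s /=; rewrite row_mxEr.
rewrite !dphi [LHS]gram_sum gram_split ?pc_lt // gBE gFE /= row_mxKl row_mxKr.
congr (_ + _); apply: eq_bigr => i _; apply: eq_bigr => j _.
  exact: (congr1 (fun t => t * _) (congr2 (fun u v => u * v) (esym (c1 x i)) (esym (c1 z j)))).
exact: (congr1 (fun t => t * _) (congr2 (fun u v => u * v) (esym (c2 x i)) (esym (c2 z j)))).
Qed.

(** The leaf is the slice of the chart on which the last [r] coordinates vanish; its tangent vectors
    are the combinations of the [X i], which span the horizontal space. *)
Lemma adapted_leaf : exists (L : @manifold R n) (f : smooth_map L M) (q : L),
  [/\ f q = p0, injective f,
      forall (x : L) (v : tangent x), dmap f v = 0 -> v = 0 &
      forall (x : L) (w : tangent (f x)),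
        horizontal g prj w <-> exists v : tangent x, dmap f v = w].
Proof.
pose a := box_chart n dl0.
have La c : @atlas R _ (box n dl0) c -> c = a by [].
have aT (s : box n dl0) : dom a s by [].
have aA := @box_admissible R n dl dl0.
pose t (b : 'rV[R]_n) : 'rV[R]_(n + r) := row_mx b 0.
have st : smooth_onv setT t.
  by apply: (smoothv_row_mx openT); [exact: smoothv_id|exact: smoothv_cst].
have tlt b : `|b| < dl -> `|t b| < dl.
  by move=> bd; apply: le_lt_trans bd; apply: norm_row_mx => //; rewrite normr0.
have slt s : `|t (a s)| < dl by apply: tlt; exact: squash_lt.
have sf : smooth_map_on [set: box n dl0] (fun s => cinv e (t (a s)) : M).
  apply: (smooth_map_chart La aT ae); first by move=> j; exact: smooth_sub (@subsetT _ _) (st j).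
  by move=> _ [s _ <-]; exact: cod.
pose f := SmoothMap sf.
have ef s : e (f s) = t (a s).
  by have [] := chart_cinvK (@subset_refl _ (dom e)) (cod (slt s)).
have df (s : box n dl0) (v : tangent s) :
    dmap f v = \sum_i v (chart_coord aA aT i) *: dv (t (a s)) (hi i).
  apply: tangentP => h; rewrite (dmap_chart (e := e) (t := t) aT aA) // tan_val_sum.
  apply: eq_bigr => i _; rewrite tan_valZ coord_tanE; [|exact: ae|exact: cod].
  congr (_ * _); have dt : differentiable t (a s) by exact: smoothv_differentiable st I.
  have [dq wq] := chart_cinvK (@subset_refl _ (dom e)) (cod (slt s)).
  have dh : differentiable (h \o cinv e) (t (a s)).
    by have H := chart_differentiable h ae dq; rewrite wq in H.
  rewrite (derive_comp (f := h \o cinv e) _ dt dh).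
  have di : differentiable (fun b : 'rV[R]_n => b) (a s) by [].
  have dc : differentiable (fun _ : 'rV[R]_n => (0 : 'rV[R]_r)) (a s) by exact: differentiable_cst.
  have E2 := derive_row_mx (delta_mx 0 i) di dc.
  have E3 : 'D_(delta_mx 0 i) (fun _ : 'rV[R]_n => (0 : 'rV[R]_r)) (a s) = 0 := derive_cst _ _ _.
  rewrite derive_idE E3 in E2.
  have E4 : row_mx (delta_mx 0 i) 0 = delta_mx 0 (hi i) :> 'rV[R]_(n + r).
    apply/rowP => j; rewrite -(splitK j); case: (fintype.split j) => l /=.
      by rewrite row_mxEl !mxE eq_lshift.
    by rewrite row_mxEr !mxE eq_rlshift andbF.
  exact: (congr1 (fun u => 'D_u (h \o cinv e) (t (a s))) (etrans E2 E4)).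
exists (box n dl0), f, (0 : 'rV[R]_n); split.
- have := cmapK (ad_dom A); rewrite (ad_center A) => <- /=.
  by rewrite /squash scaler0 /t row_mx0.
- move=> s s' ss; have := ef s; rewrite ss ef => /eq_row_mx[+ _].
  by move=> /(congr1 (unsquash dl)); rewrite !squashK.
- move=> s v; rewrite df => H; apply: (@chart_coord_tan0 R n (box n dl0) a aA aT s v) => i.
  pose c' (j : 'I_(n + r)) := match fintype.split j with inl i => v (chart_coord aA aT i) | inr _
    => 0 end.
  have := @coord_tan_free _ _ _ e ae _ c' (cod (slt s)) _ (hi i).
  rewrite big_split_ord /= [X in _ + X]big1 ?addr0 => [H'|b _]; last first.
    by rewrite /c' (unsplitK (inr b)) scale0r.
  move: H'; rewrite /c' (unsplitK (inl i)); apply.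
  by rewrite -[RHS]H; apply: eq_bigr => j _; rewrite (unsplitK (inl j)).
- move=> s w; split=> [hw|[v <-]]; last first.
    rewrite df; apply: horizontal_sum => i; apply: horizontalZ.
    by apply: adapted_horizontal; exact: slt.
  (* The components of [v] are those of the projection of [w]. Its image and [w] are then horizontal
     with the same projection, hence equal. *)
  have [v vE] := @chart_coord_surj R n (box n dl0) a aA aT s (fun i => dmap prj w (y i)).
  exists v; rewrite df; apply: (horizontal_inj sub) => //.
    by apply: horizontal_sum => i; apply: horizontalZ; apply: adapted_horizontal; exact: slt.
  have [W'q _] := ad_prj A (slt s).
  rewrite dmap_sum [RHS](frame_expand _ (ad_frame A) W'q); apply: eq_bigr => i _.
  by rewrite dmapZ vE adapted_field // (ad_lift A i).2.
Qed.

End AtPoint.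

Lemma horizontal_leaves : horizontal_integrable g prj.
Proof.
move=> p; have [e [dl [d [W' [y [E' [X [b0 A]]]]]]]] := adapted_chart sub integrable p.
exact: adapted_leaf A.
Qed.

Lemma local_product : locally_warped_product g n r.
Proof.
move=> p; have [e [dl [d [W' [y [E' [X [b0 A]]]]]]]] := adapted_chart sub integrable p.
have := adapted_product A.
by exists (box n (ad_pos A)), (box r (ad_pos A)).
Qed.

End LocalProduct.

Theorem theorem3p13 (R : realType) (m n : nat)
    (M : @manifold R m) (B : @manifold R n)
    (g : metric M) (g' : metric B) (prj : smooth_map M B)
    (D : connection M) (H : vfield M)
    (n_lt_m : (n < m)%N)
    (B_compact : compact [set: B])
    (B_orientable : orientable B)
    (B_Riemannian : Riemannian g')
    (M_index : has_index g (m - n))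
    (prj_submersion : semi_Riemannian_submersion g g' prj)
    (fibres_connected : forall b : B, connected (prj @^-1` [set b]))
    (D_Levi_Civita : Levi_Civita g D)
    (H_mean_curvature : mean_curvature g prj D H)
    (fibres_umbilic : totally_umbilic_fibres g prj D H)
    (mixed_ge0 : forall (p : M) (X V : vfield M),
      horizontal g prj (vf_at X p) -> vf_at X p != 0 ->
      vertical prj (vf_at V p) -> vf_at V p != 0 ->
      0 <= sectional g D X V p)
    (R_constant : forall X Y : vfield M, basic g prj X -> basic g prj Y ->
      forall p q : M, prj p = prj q ->
      curvature4 g D X Y X Y p = curvature4 g D X Y X Y q)
    (H_basic : basic g prj H) :
  (forall (p : M) (X V : vfield M),
    horizontal g prj (vf_at X p) -> vf_at X p != 0 ->
    vertical prj (vf_at V p) -> vf_at V p != 0 ->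
    sectional g D X V p = 0) /\
  (totally_geodesic_fibres g prj D /\
   horizontal_integrable g prj /\
   locally_warped_product g n (m - n)).
Proof.
(* The charts split rows of length [n + r], so the dimension of [M] has to be literally such a
   sum. *)
have [r mE] : exists r, m = (n + r)%N by exists (m - n)%N; rewrite subnKC // ltnW.
subst m.
have Hint := bracket_horizontal n_lt_m B_compact B_Riemannian M_index prj_submersion
  D_Levi_Civita fibres_umbilic mixed_ge0 H_basic.
have Hder := basic_derivative n_lt_m B_compact B_Riemannian M_index prj_submersion
  D_Levi_Civita fibres_umbilic mixed_ge0 H_basic.
split=> [p X V hX _ vV _|].
  exact: (mixed_flat n_lt_m B_compact B_Riemannian M_index prj_submersion
    D_Levi_Civita fibres_umbilic mixed_ge0 H_basic).
split.
  exact: (fibres_totally_geodesic n_lt_m B_compact B_Riemannian M_index prj_submersion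
    D_Levi_Civita fibres_umbilic mixed_ge0 H_basic).
split; first exact: horizontal_leaves prj_submersion Hint.
rewrite addKn; exact: local_product n_lt_m B_Riemannian M_index prj_submersion Hint Hder.
Qed.
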